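(* There exists a holomorphic family of compact complex manifolds $\{X_t\}_{t\in\Delta}$ of complex dimension $4$, where $\Delta=\{t\in\mathbb C\mid |t|<1\}$, such that $X_t$ admits a complex symplectic structure for every $t\in\Delta\setminus\{0\}$, but $X_0$ is not a complex symplectic manifold (that is, $X_0$ admits no complex symplectic form).
   Context: A holomorphic family of compact complex manifolds over $\Delta$ is a proper holomorphic submersion $\pi:\mathcal X\to\Delta$ between complex manifolds; its members are the fibers $X_t=\pi^{-1}(t)$. A complex symplectic form on a complex manifold $X$ is a $d$-closed differential form of bidegree $(2,0)$ (equivalently, a closed holomorphic $2$-form) that is non-degenerate as a bilinear form on the holomorphic tangent bundle. $X$ admits a complex symplectic structure (is a complex symplectic manifold) if such a form exists on $X$ with its given complex structure. *)

(* Defs.v *)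
From HB Require Import structures.
From mathcomp Require Import all_boot all_order all_algebra.
From mathcomp Require Import all_classical all_reals all_analysis.
From mathcomp Require Import complex.

Set Implicit Arguments.
Unset Strict Implicit.
Unset Printing Implicit Defensive.

Import Order.TTheory GRing.Theory Num.Theory.
Import numFieldNormedType.Exports.

Local Open Scope classical_set_scope.
Local Open Scope ring_scope.

(* The definitions are meant for K = R[i], R a realType (Cplx R below), where
   differentiable means complex differentiable. They are stated over an abstract
   K because its carrier is what MathComp-Analysis equips with a norm and a
   topology: complex R itself has no canonical topology. *)

Definition unit_disc (K : numFieldType) : set K := [set t | `|t| < 1].

Definition holomorphic (K : numFieldType) (V W : normedModType K)
    (U : set V) (f : V -> W) : Prop :=
  forall z, U z -> differentiable f z.

(* A coordinate map together with its inverse; cmap is meaningful on cdom only,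
   and cinv on the image of cdom only. *)
Record chart (K : numFieldType) (T : topologicalType) (n : nat) := Chart {
  cdom : set T;
  cmap :> T -> 'rV[K]_n;
  cinv : 'rV[K]_n -> T }.

Definition cimg (K : numFieldType) (T : topologicalType) (n : nat)
  (c : chart K T n) : set 'rV[K]_n := c @` cdom c.

Definition is_chart (K : numFieldType) (T : topologicalType) (n : nat)
    (c : chart K T n) : Prop :=
  [/\ open (cdom c), open (cimg c),
      forall x, cdom c x -> cinv c (c x) = x,
      {within cdom c, continuous c} &
      {within cimg c, continuous (cinv c)}].

Definition complex_manifold (K : numFieldType) (T : topologicalType) (n : nat)
    (A : set (chart K T n)) : Prop :=
  [/\ hausdorff_space T, @second_countable T,
      forall c, A c -> is_chart c,
      forall x, exists2 c, A c & cdom c x &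
      forall c d, A c -> A d ->
        holomorphic (c @` (cdom c `&` cdom d)) (d \o cinv c)].

Definition holomorphic_function (K : numFieldType) (X : topologicalType) (n : nat)
    (A : set (chart K X n)) (f : X -> K) : Prop :=
  forall c, A c -> holomorphic (cimg c) (f \o cinv c).

Definition submersion (K : numFieldType) (X : topologicalType) (n : nat)
    (A : set (chart K X n)) (f : X -> K) : Prop :=
  forall c z, A c -> cimg c z -> forall w, exists v, 'd (f \o cinv c) z v = w.

Definition proper_to_disc (K : numFieldType) (X : topologicalType)
    (f : X -> K) : Prop :=
  forall B : set K, compact B -> B `<=` @unit_disc K ->
    compact (f @^-1` B).

Definition holomorphic_family (K : numFieldType) (X : topologicalType) (n : nat)
    (A : set (chart K X n)) (proj : X -> K) : Prop :=
  [/\ complex_manifold A, forall x, unit_disc (proj x),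
      holomorphic_function A proj, submersion A proj & proper_to_disc proj].

Definition fiber (K : numFieldType) (X : topologicalType) (proj : X -> K)
  (t : K) : topologicalType := set_type (proj @^-1` [set t]).

(* The complex structure of the fiber over t as a complex submanifold of X: all
   charts of the subspace whose inverse is a holomorphic immersion into X. *)
Definition fiber_atlas (K : numFieldType) (X : topologicalType) (m : nat)
    (A : set (chart K X m)) (proj : X -> K) (t : K) (n : nat) :
    set (chart K (fiber proj t) n) :=
  [set c | is_chart c /\
    forall a, A a ->
      let f : 'rV[K]_n -> 'rV[K]_m := a \o set_val \o cinv c in
      let D := c @` (cdom c `&` set_val @^-1` cdom a) in
      holomorphic D f /\ forall z, D z -> injective ('d f z)].

Arguments fiber_atlas {K X m} A proj t n.

(* A holomorphic 2-form is given by its coefficient matrices: in the chart c it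
   is \sum_(i < j) (omega c z) i j dz_i /\ dz_j, and its value on tangent
   vectors u, v is u *m omega c z *m v^T. As 'J acts on row vectors from the
   right, pulling back along a change of charts with Jacobian J turns a
   coefficient matrix M into J *m M *m J^T. *)
Definition holomorphic_2form (K : numFieldType) (T : topologicalType) (n : nat)
    (A : set (chart K T n))
    (omega : chart K T n -> 'rV[K]_n -> 'M[K]_n) : Prop :=
  [/\ forall c z, A c -> cimg c z -> (omega c z)^T = - omega c z,
      forall c, A c -> forall i j, holomorphic (cimg c) (fun z => omega c z i j) &
      forall c d x, A c -> A d -> cdom c x -> cdom d x ->
        let J := jacobian (d \o cinv c) (c x) in
        omega c (c x) = J *m omega d (d x) *m J^T].

Definition closed_2form (K : numFieldType) (T : topologicalType) (n : nat)
    (A : set (chart K T n))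
    (omega : chart K T n -> 'rV[K]_n -> 'M[K]_n) : Prop :=
  forall c z, A c -> cimg c z -> forall i j k : 'I_n,
    let partial l (f : 'rV[K]_n -> K) := 'D_(delta_mx 0 l) f z in
    partial i (fun y => omega c y j k) + partial j (fun y => omega c y k i)
      + partial k (fun y => omega c y i j) = 0.

Definition nondegenerate_2form (K : numFieldType) (T : topologicalType) (n : nat)
    (A : set (chart K T n))
    (omega : chart K T n -> 'rV[K]_n -> 'M[K]_n) : Prop :=
  forall c z, A c -> cimg c z -> forall u : 'rV[K]_n,
    (forall v : 'rV[K]_n, u *m omega c z *m v^T = 0) -> u = 0.

Definition admits_complex_symplectic_form (K : numFieldType) (T : topologicalType)
    (n : nat) (A : set (chart K T n)) : Prop :=
  exists omega, [/\ holomorphic_2form A omega, closed_2form A omega &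
                    nondegenerate_2form A omega].

Definition Cplx (R : realType) : numFieldType := R[i]%C.

(* Main.v *)
Require Import Defs.
From HB Require Import structures.
From mathcomp Require Import all_boot all_order all_algebra.
From mathcomp Require Import all_classical all_reals all_analysis.
From mathcomp Require Import complex.
From mathcomp Require Import ring lra.

Set Implicit Arguments.
Unset Strict Implicit.
Unset Printing Implicit Defensive.

Import Order.TTheory GRing.Theory Num.Theory.
Import numFieldNormedType.Exports.

Local Open Scope classical_set_scope.
Local Open Scope ring_scope.

(** The family is [X_t = C^4 / Gamma_t], where an element of [Gamma_t] with integer parameters
    [a_k], [b_k], [m_k] maps [(z0, z1, z2, z3)] to
<<
    (z0 + a1 + 2 i b1, z1 + a2 + 2 i b2, z2 + u1 + i u2, z3 + t u2 + m3 + i m4)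
>>
    with [u1 = b1 z0 + i b1^2 + m1] and [u2 = b2 z1 + i b2^2 + m2]. Each [X_t] is a bundle of complex
    tori over a complex torus. The total space is the quotient of the product of [C^4] with the disc
    by the corresponding group; freeness and properness of the action ([deck_free], [deck_proper])
    make it a manifold, and each orbit meets a fixed bounded region of [C^4] ([deck_reduce]), which
    makes the projection to [t] proper.

    For [t] nonzero, the vectors [(1, 0)] and [(i, t)] form a basis of the plane of [(z2, z3)]; in
    the corresponding coordinates [(s1, s2)], deck transformations add [b1 z0] to [s1] and [b2 z1]
    to [s2], up to constants. Hence [dz0 /\ ds1 + dz1 /\ ds2] is invariant; it is closed and
    nondegenerate, and descends to [X_t] ([fiber_symplectic]).

    For [t = 0], these two vectors span a line over the complex numbers: [z2] moves by [u1 + i u2],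
    and [z3] only by constants. The coefficients [f_jk] of a holomorphic two-form on [X_0] are entire
    functions on [C^4], and since [dz2] becomes [dz2 + b1 dz0 + i b2 dz1], the [f_2j] are
    invariant, hence bounded, hence constant. The remaining transformation rules, such as
    [f_03 = f_03 o g + b1 f_23], say that [f_03] and [f_01] are quasi-periodic with additive periods
    proportional to [f_23], [f_21] and [f_20]. An entire function of one variable with period [1]
    and an additive period [k] in the direction [2 i] has linear growth, so it is affine, so it is
    constant and [k = 0] ([quasi_periodic_zero]). Thus all [f_2j] vanish ([coef2_zero]), and [dz2]
    does not occur in the form: every holomorphic two-form on [X_0] is degenerate.

    The complex analysis rests on a maximum principle ([maximum_principle]). Goursat's bisection argument
    is carried out on midpoint sums along the boundary of squares ([square_sum_small]) instead of
    integrals, and comparison with the winding number of [1 / (z - w)] gives the maximum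
    principle. It yields second-order Taylor estimates ([taylor2], [taylor2_mag]), from which follow
    Liouville's theorem ([entire_affine]) and the existence and symmetry of second derivatives in
    several variables ([diff_of_partial], [diff_partial_sym]); the latter two give holomorphy of the
    coefficients and closedness of the form. The charts of [X_t] are all charts whose inverse is an
    immersion into the total space; [immersion_lift] shows that their changes are holomorphic. *)

(** * The modulus *)

Section Modulus.
Context {R : realType}.
Local Notation K := (Cplx R).
Local Notation iC := ('i%C : K).

Definition rc (x : R) : K := x%:C%C.

(** The norm of a module over the complex numbers is a complex number; all estimates are made
    on its real part, where the order is total. *)
Definition mag {V : normedModType K} (v : V) : R := complex.Re `|v|.

Lemma magE {V : normedModType K} (v : V) : `|v| = rc (mag v).
Proof.
rewrite /rc /mag; have : (0 : K) <= `|v| by [].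
case: `|v| => a b; rewrite lecE /= => /andP[/eqP -> _]; by [].
Qed.

Lemma rcD x y : rc (x + y) = rc x + rc y. Proof. exact: (rmorphD (real_complex R)). Qed.
Lemma rcN x : rc (- x) = - rc x. Proof. exact: (rmorphN (real_complex R)). Qed.
Lemma rcB x y : rc (x - y) = rc x - rc y. Proof. by rewrite rcD rcN. Qed.
Lemma rcM x y : rc (x * y) = rc x * rc y. Proof. exact: (rmorphM (real_complex R)). Qed.
Lemma rcV x : rc (x^-1) = (rc x)^-1. Proof. exact: (fmorphV (real_complex R)). Qed.
Lemma rc0 : rc 0 = 0. Proof. by []. Qed.
Lemma rc1 : rc 1 = 1. Proof. by []. Qed.
Lemma rc_nat n : rc n%:R = n%:R. Proof. exact: (rmorph_nat (real_complex R)). Qed.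
Lemma rc_int n : rc n%:~R = n%:~R. Proof. exact: (rmorph_int (real_complex R)). Qed.
Lemma rc_le x y : (rc x <= rc y) = (x <= y). Proof. exact: lecR. Qed.
Lemma rc_lt x y : (rc x < rc y) = (x < y). Proof. exact: ltcR. Qed.
Lemma rc_inj : injective rc. Proof. exact: complexI. Qed.

Lemma rc_gt0 (e : K) : 0 < e -> exists2 d : R, 0 < d & e = rc d.
Proof.
case: e => a b; rewrite ltcE /= => /andP[/eqP -> a0]; by exists a.
Qed.

Section NormedModule.
Context {V : normedModType K}.
Implicit Types u v w : V.

Lemma mag_ge0 v : 0 <= mag v.
Proof. by rewrite -rc_le -magE normr_ge0. Qed.
Lemma mag0 : mag (0 : V) = 0.
Proof. by apply: rc_inj; rewrite -magE normr0. Qed.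
Lemma mag_eq0 v : (mag v == 0) = (v == 0).
Proof. by rewrite -(inj_eq rc_inj) -magE normr_eq0. Qed.
Lemma mag_gt0 v : (0 < mag v) = (v != 0).
Proof. by rewrite lt_def mag_eq0 mag_ge0 andbT. Qed.
Lemma magD u v : mag (u + v) <= mag u + mag v.
Proof. by rewrite -rc_le rcD -!magE ler_normD. Qed.
Lemma magN v : mag (- v) = mag v.
Proof. by apply: rc_inj; rewrite -!magE normrN. Qed.
Lemma magB u v : mag (u - v) <= mag u + mag v.
Proof. by rewrite -(magN v) magD. Qed.
Lemma mag_distC u v : mag (u - v) = mag (v - u).
Proof. by rewrite -magN opprB. Qed.
Lemma mag_tri w u v : mag (u - v) <= mag (u - w) + mag (w - v).
Proof. by apply: le_trans (magD _ _); rewrite addrA subrK. Qed.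
Lemma mag_sub u v : mag u - mag v <= mag (u - v).
Proof. by have := magD (u - v) v; rewrite subrK; lra. Qed.
Lemma magZ (a : K) v : mag (a *: v) = mag a * mag v.
Proof. by apply: rc_inj; rewrite rcM -!magE normrZ. Qed.
Lemma mag_sum (I : Type) (r : seq I) (F : I -> V) :
  mag (\sum_(i <- r) F i) <= \sum_(i <- r) mag (F i).
Proof.
elim/big_rec2: _ => [|i y x _ h]; first by rewrite mag0.
by apply: le_trans (magD _ _) _; rewrite lerD2l.
Qed.
End NormedModule.

Implicit Types x y z : K.
Lemma magM x y : mag (x * y) = mag x * mag y.
Proof. by apply: rc_inj; rewrite rcM -!magE normrM. Qed.
Lemma mag1 : mag (1 : K) = 1.
Proof. by apply: rc_inj; rewrite -magE normr1. Qed.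
Lemma magV x : mag (x^-1) = (mag x)^-1.
Proof. by apply: rc_inj; rewrite rcV -!magE normfV. Qed.
Lemma magX x n : mag (x ^+ n) = mag x ^+ n.
Proof. by elim: n => [|n IH]; rewrite ?expr0 ?mag1 // !exprS magM IH. Qed.
Lemma mag_rc (a : R) : mag (rc a) = `|a|.
Proof. by apply: rc_inj; rewrite -magE /rc normc_def /= expr0n addr0 sqrtr_sqr. Qed.
Lemma mag_sqr x : mag x ^+ 2 = complex.Re x ^+ 2 + complex.Im x ^+ 2.
Proof.
apply: (@complexI R); rewrite (add_Re2_Im2 (x : R[i])).
by rewrite (magE x : `|x : R[i]| = _) /rc rmorphXn.
Qed.
Lemma mag_i : mag iC = 1.
Proof.
apply/eqP; rewrite -(@eqrXn2 _ 2) ?mag_ge0 ?ler01 //.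
by rewrite mag_sqr /= expr0n add0r !expr1n.
Qed.
Lemma mag_Re x : `|complex.Re x| <= mag x.
Proof.
rewrite -(@ler_pXn2r _ 2) ?nnegrE ?mag_ge0 //.
by rewrite mag_sqr real_normK ?num_real // lerDl sqr_ge0.
Qed.
Lemma mag_Im x : `|complex.Im x| <= mag x.
Proof.
rewrite -(@ler_pXn2r _ 2) ?nnegrE ?mag_ge0 //.
by rewrite mag_sqr [X in X <= _]real_normK ?num_real // lerDr sqr_ge0.
Qed.
Lemma ReD x y : complex.Re (x + y) = complex.Re x + complex.Re y.
Proof. by case: x y => ? ? []. Qed.
Lemma ImD x y : complex.Im (x + y) = complex.Im x + complex.Im y.
Proof. by case: x y => ? ? []. Qed.
Lemma ReB x y : complex.Re (x - y) = complex.Re x - complex.Re y.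
Proof. by case: x y => ? ? []. Qed.
Lemma ImB x y : complex.Im (x - y) = complex.Im x - complex.Im y.
Proof. by case: x y => ? ? []. Qed.
Lemma cplxE x : x = rc (complex.Re x) + iC * rc (complex.Im x).
Proof. exact: (complexE (x : R[i])). Qed.
Lemma Re_cplx (a b : R) : complex.Re (rc a + iC * rc b) = a.
Proof. by rewrite ReD /= mul0r mul1r oppr0 !addr0. Qed.
Lemma Im_cplx (a b : R) : complex.Im (rc a + iC * rc b) = b.
Proof. by rewrite ImD /= mul0r mul1r !add0r. Qed.
Lemma Im_rc (a : R) x : complex.Im (rc a * x) = a * complex.Im x.
Proof. by case: x => u v /=; rewrite mul0r addr0. Qed.
Lemma Re_rc (a : R) x : complex.Re (rc a * x) = a * complex.Re x.
Proof. by case: x => u v /=; rewrite mul0r subr0. Qed.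
Lemma Im_i x : complex.Im (iC * x) = complex.Re x.
Proof. by case: x => u v /=; rewrite mul0r mul1r add0r. Qed.
Lemma Im_inv x : complex.Im (x^-1) = - complex.Im x / mag x ^+ 2.
Proof. by rewrite mag_sqr; case: x => u v /=; rewrite mulNr. Qed.
Lemma Re_inv x : complex.Re (x^-1) = complex.Re x / mag x ^+ 2.
Proof. by rewrite mag_sqr; case: x => u v. Qed.
Lemma nbhs_magP {V : normedModType K} (x : V) (P : set V) :
  nbhs x P <-> exists2 d : R, 0 < d & forall y : V, mag (y - x) < d -> P y.
Proof.
rewrite -nbhs_ballE; split.
  case=> e /= /rc_gt0[d d0 ->] h; exists d => // y hy.
  by apply: h; rewrite -ball_normE /ball_ /= distrC magE rc_lt.
case=> d d0 h; exists (rc d) => /=; first by rewrite -rc0 rc_lt.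
by move=> y; rewrite -ball_normE /ball_ /= distrC magE rc_lt; apply: h.
Qed.

Lemma cts_magP {V W : normedModType K} (f : V -> W) (x : V) :
  {for x, continuous f} <-> forall e : R, 0 < e ->
    exists2 d : R, 0 < d & forall y : V, mag (y - x) < d -> mag (f y - f x) < e.
Proof.
split=> [cf e e0|h].
  have /cf : nbhs (f x) [set y | mag (y - f x) < e].
    by apply/nbhs_magP; exists e.
  by move=> /nbhs_magP.
move=> P /nbhs_magP[e e0 hP]; apply/nbhs_magP.
by have [d d0 hd] := h e e0; exists d => // y /hd; apply: hP.
Qed.

Lemma diff_mag {V W : normedModType K} (f : V -> W) (x : V) :
  differentiable f x -> forall e : R, 0 < e ->
  exists2 d : R, 0 < d & forall h, mag h < d ->
    mag (f (x + h) - f x - 'd f x h) <= e * mag h.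
Proof.
move=> /diff_locallyP [_ /eqaddoP df] e e0.
have /df : (0 : K) < rc e by rewrite -rc0 rc_lt.
move=> /nbhs_magP[d d0 hd]; exists d => // h hh.
have := hd h; rewrite subr0 => /(_ hh) /=.
by rewrite !magE -rcM rc_le /= /shift /= !fctE [h + x]addrC opprD addrA.
Qed.

Lemma mag_diff {V W : normedModType K} (f : V -> W) (x : V) (L : {linear V -> W}) :
  continuous L ->
  (forall e : R, 0 < e -> exists2 d : R, 0 < d & forall h, mag h < d ->
    mag (f (x + h) - f x - L h) <= e * mag h) ->
  differentiable f x /\ 'd f x = L :> (V -> W).
Proof.
move=> cL H.
have E : f \o shift x = cst (f x) + L +o_ 0 id.
  apply/eqaddoP => _ /rc_gt0[e e0 ->]; have [d d0 hd] := H e e0.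
  apply/nbhs_magP; exists d => // h; rewrite subr0 => /hd.
  by rewrite !magE -rcM rc_le /= /shift /= !fctE [h + x]addrC opprD addrA.
have D := diff_unique cL E; split=> //.
by apply/diff_locallyP; rewrite D; split.
Qed.

End Modulus.

(** * Goursat's theorem for midpoint sums *)

Section Goursat.
Context {R : realType}.
Local Notation K := (Cplx R).
Local Notation iC := ('i%C : K).
Implicit Types (f g : K -> K) (p s d z w : K).

Lemma nested_intervals (a r : nat -> R) :
  (forall m n, (m <= n)%N -> `|a n - a m| <= r m - r n) -> (forall n, 0 <= r n) ->
  exists x, forall n, `|x - a n| <= r n.
Proof.
move=> h r0.
have hA m n : a m - r m <= a n + r n.
  case: (leqP m n) => [mn|/ltnW nm].
    have := h _ _ mn; rewrite ler_norml => /andP[h1 h2].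
    by have := r0 n; have := r0 m; lra.
  have := h _ _ nm; rewrite ler_norml => /andP[h1 h2].
  by have := r0 n; have := r0 m; lra.
pose E := [set a n - r n | n in [set: nat]].
have hsE : has_sup E.
  split; first by exists (a 0%N - r 0%N), 0%N.
  by exists (a 0%N + r 0%N) => _ [n _ <-].
exists (sup E) => n; rewrite ler_distl; apply/andP; split.
  by apply: ub_le_sup; [case: hsE | exists n].
by apply: ge_sup; [case: hsE | move=> _ [m _ <-]].
Qed.

Lemma geom_small (C q e : R) : 0 <= q -> q < 1 -> 0 < e ->
  exists n, C * q ^+ n < e.
Proof.
move=> q0 q1 e0.
have hq : `|q| < 1 by rewrite ger0_norm.
have /cvgrPdist_lt : ((fun n => C * q ^+ n) @ \oo --> (C * 0 : R))%classic.
  by apply: cvgM (cvg_expr hq); exact: cvg_cst.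
move=> /(_ e e0) /filter_ex[n]; rewrite mulr0 sub0r normrN => h.
by exists n; apply: le_lt_trans h; apply: ler_norm.
Qed.

Let half : K := 2^-1.

Lemma mag_half : mag half = 2^-1.
Proof. by rewrite /half magV -(rc_nat 2) mag_rc ger0_norm ?ler0n. Qed.

(** A bisection principle: a property of squares that passes from the four
    quarters of a square to the square, and that holds for all small squares
    close to any given point, holds for every square. *)
Lemma square_bisection (P : K -> K -> Prop) p s :
  (forall p s, P p (s / 2) -> P (p + s / 2) (s / 2) -> P (p + iC * (s / 2)) (s / 2) ->
     P (p + s / 2 + iC * (s / 2)) (s / 2) -> P p s) ->
  (forall z, mag (z - p) <= 4 * mag s -> exists2 e : R, 0 < e &
     forall q u : K, mag (q - z) <= 4 * mag u -> mag u < e -> P q u) ->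
  P p s.
Proof.
move=> Hsub Hloc; apply: contrapT => nP.
pose child (q : K) u : K :=
  if `[< ~ P q (u / 2) >] then q else
  if `[< ~ P (q + u / 2) (u / 2) >] then q + u / 2 else
  if `[< ~ P (q + iC * (u / 2)) (u / 2) >] then q + iC * (u / 2)
  else q + u / 2 + iC * (u / 2).
have childP q u : ~ P q u -> ~ P (child q u) (u / 2).
  move=> h; rewrite /child; case: asboolP => // /contrapT h0.
  case: asboolP => // /contrapT h1; case: asboolP => // /contrapT h2 h3.
  by apply: h; apply: Hsub.
have child_mag q u : mag (child q u - q) <= mag u.
  have hu : mag (u / 2) = mag u / 2 by rewrite magM -/half mag_half.
  have hi : mag (iC * (u / 2)) = mag u / 2 by rewrite magM mag_i mul1r.
  rewrite /child; do 3 ?[case: ifP => _].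
  - by rewrite subrr mag0 mag_ge0.
  - by rewrite addrAC subrr add0r hu; have := mag_ge0 u; lra.
  - by rewrite addrAC subrr add0r hi; have := mag_ge0 u; lra.
  - rewrite (_ : _ - q = u / 2 + iC * (u / 2)); last by ring.
    apply: le_trans (magD _ _) _.
    by rewrite hu hi; lra.
pose st n := iter n (fun qu => (child qu.1 qu.2, qu.2 / 2)) (p, s).
have stP n : ~ P (st n).1 (st n).2.
  by elim: n => [//|n IH] /=; apply: childP.
pose r n := 2 * mag (st n).2.
have rS n : r n.+1 = r n / 2.
  by rewrite /r /= magM -/half mag_half; lra.
have r0 n : 0 <= r n by rewrite /r mulr_ge0 // mag_ge0.
have stD m n : (m <= n)%N -> mag ((st n).1 - (st m).1) <= r m - r n.
  move=> /subnKC <-; elim: (n - m)%N => [|k IH].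
    by rewrite addn0 !subrr mag0.
  rewrite addnS; apply: le_trans (mag_tri (st (m + k)%N).1 _ _) _.
  have := child_mag (st (m + k)%N).1 (st (m + k)%N).2.
  have := rS (m + k)%N; rewrite /= /r in IH *; lra.
have [x hx] : exists x, forall n, `|x - complex.Re (st n).1| <= r n.
  apply: nested_intervals => // m n /stD; apply: le_trans.
  by apply: le_trans (mag_Re _); rewrite ReB.
have [y hy] : exists y, forall n, `|y - complex.Im (st n).1| <= r n.
  apply: nested_intervals => // m n /stD; apply: le_trans.
  by apply: le_trans (mag_Im _); rewrite ImB.
pose z : K := rc x + iC * rc y.
have hz n : mag (z - (st n).1) <= 4 * mag (st n).2.
  have -> : z - (st n).1 = rc (x - complex.Re (st n).1) + iC * rc (y - complex.Im (st n).1).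
    by rewrite {1}(cplxE (st n).1) /z !rcB; ring.
  apply: le_trans (magD _ _) _; rewrite magM mag_i mul1r !mag_rc.
  by have := hx n; have := hy n; rewrite /r; lra.
have [e e0 he] := Hloc z (hz 0%N).
have [n hn] : exists n, r n < e.
  have rE n : r n = r 0%N * 2^-1 ^+ n.
    by elim: n => [|n IH]; rewrite ?expr0 ?mulr1 // rS IH exprSr; lra.
  have h0 : (0 : R) <= 2^-1 by lra.
  have h1 : (2^-1 : R) < 1 by lra.
  have [n hn] := geom_small (r 0%N) h0 h1 e0.
  by exists n; rewrite rE.
apply: (stP n); apply: he; first by rewrite mag_distC.
by have := r0 n; move: hn; rewrite /r; lra.
Qed.

(** Midpoint sums of the integral of [f] along the segment from [p] to [p + d]
    cut into [2 ^ n] equal parts. Working with these sums instead of the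
    integral makes subdivision an identity. *)
Fixpoint seg_sum f (n : nat) p d : K :=
  if n is n'.+1 then seg_sum f n' p (d / 2) + seg_sum f n' (p + d / 2) (d / 2)
  else d * f (p + d / 2).

Definition square_sum f n p s : K :=
  seg_sum f n p s + seg_sum f n (p + s) (iC * s)
  - seg_sum f n (p + iC * s) s - seg_sum f n p (iC * s).

Lemma seg_sumD f g n p d :
  seg_sum (fun z => f z + g z) n p d = seg_sum f n p d + seg_sum g n p d.
Proof. by elim: n p d => [|n IH] p d /=; rewrite ?mulrDr // !IH addrACA. Qed.

Lemma seg_sumN f n p d : seg_sum (fun z => - f z) n p d = - seg_sum f n p d.
Proof. by elim: n p d => [|n IH] p d /=; rewrite ?mulrN // !IH opprD. Qed.

Lemma seg_sum_affine a b n p d :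
  seg_sum (fun z => a + b * z) n p d = d * (a + b * (p + d / 2)).
Proof. elim: n p d => [//|n IH] p d /=; by rewrite !IH; field. Qed.

Lemma square_sumD f g n p s :
  square_sum (fun z => f z + g z) n p s = square_sum f n p s + square_sum g n p s.
Proof. rewrite /square_sum !seg_sumD; ring. Qed.

Lemma square_sum_affine a b n p s : square_sum (fun z => a + b * z) n p s = 0.
Proof.
by rewrite /square_sum !seg_sum_affine; field.
Qed.

Lemma square_sum_quarters f n p s :
  square_sum f n.+1 p s =
  square_sum f n p (s / 2) + square_sum f n (p + s / 2) (s / 2) +
  square_sum f n (p + iC * (s / 2)) (s / 2) +
  square_sum f n (p + s / 2 + iC * (s / 2)) (s / 2).
Proof.
rewrite /square_sum /=.
have E1 : iC * s / 2 = iC * (s / 2) by rewrite mulrA.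
have E2 : p + iC * s = p + iC * (s / 2) + iC * (s / 2) by field.
have E3 : p + s = p + s / 2 + s / 2 by field.
have E4 : p + iC * (s / 2) + s / 2 = p + s / 2 + iC * (s / 2) by ring.
have E5 : p + s / 2 + iC * (s / 2) + s / 2 = p + s / 2 + s / 2 + iC * (s / 2) by ring.
have E6 : p + iC * (s / 2) + iC * (s / 2) + s / 2 = p + s / 2 + iC * (s / 2) + iC * (s / 2) by ring.
rewrite !E1 !E2 !E3 !E4 !E5 !E6; ring.
Qed.

Lemma seg_sum_le f n p d B :
  (forall t : R, 0 <= t <= 1 -> mag (f (p + rc t * d)) <= B) ->
  mag (seg_sum f n p d) <= mag d * B.
Proof.
have h2 (x : K) : x / 2 = rc 2^-1 * x by rewrite rcV (rc_nat 2) mulrC.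
have hm (x : K) : mag (x / 2) = mag x / 2 by rewrite magM -/half mag_half.
elim: n p d => [|n IH] p d hB /=.
  by rewrite magM ler_wpM2l ?mag_ge0 // h2; apply: hB; apply/andP; split; lra.
apply: le_trans (magD _ _) _; rewrite [leRHS](_ : _ = mag (d / 2) * B + mag (d / 2) * B); last first.
  by rewrite hm; lra.
apply: lerD; apply: IH => t /andP[t0 t1].
  rewrite h2 mulrA -rcM; apply: hB; apply/andP; split; lra.
rewrite h2 mulrA -rcM -addrA -mulrDl -rcD; apply: hB; apply/andP; split; lra.
Qed.

Lemma seg_sum_Im_ge f n p d (k : R) :
  (forall t : R, 0 <= t <= 1 -> k <= complex.Im (d * f (p + rc t * d))) ->
  k <= complex.Im (seg_sum f n p d).
Proof.
have h2 (x : K) : x / 2 = rc 2^-1 * x by rewrite rcV (rc_nat 2) mulrC.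
have I2 (x : K) : complex.Im (rc 2^-1 * x) = complex.Im x / 2.
  by rewrite /rc; case: x => a b /=; rewrite mul0r addr0 mulrC.
elim: n p d k => [|n IH] p d k hB /=.
  by rewrite h2; apply: hB; apply/andP; split; lra.
rewrite ImD (splitr k); apply: lerD; apply: IH => t /andP[t0 t1].
  rewrite h2 mulrA -rcM -mulrA I2 ler_pdivlMr // divfK //.
  by apply: hB; apply/andP; split; lra.
rewrite h2 mulrA -rcM -addrA -mulrDl -rcD -mulrA I2 ler_pdivlMr // divfK //.
by apply: hB; apply/andP; split; lra.
Qed.

Lemma square_sum_le f n p s B :
  (forall t : R, 0 <= t <= 1 ->
    [/\ mag (f (p + rc t * s)) <= B, mag (f (p + s + rc t * (iC * s))) <= B,
        mag (f (p + iC * s + rc t * s)) <= B & mag (f (p + rc t * (iC * s))) <= B]) ->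
  mag (square_sum f n p s) <= 4 * mag s * B.
Proof.
move=> h; rewrite /square_sum.
have hi : mag (iC * s) = mag s by rewrite magM mag_i mul1r.
apply: le_trans (magB _ _) _; apply: le_trans (lerD (magB _ _) (lexx _)) _.
apply: le_trans (lerD (lerD (magD _ _) (lexx _)) (lexx _)) _.
have := @seg_sum_le f n p s B (fun t ht => let: And4 a _ _ _ := h t ht in a).
have := @seg_sum_le f n (p + s) (iC * s) B (fun t ht => let: And4 _ a _ _ := h t ht in a).
have := @seg_sum_le f n (p + iC * s) s B (fun t ht => let: And4 _ _ a _ := h t ht in a).
have := @seg_sum_le f n p (iC * s) B (fun t ht => let: And4 _ _ _ a := h t ht in a).
by rewrite hi; lra.
Qed.

Lemma diff_scalar f z h : 'd f z h = h * 'd f z 1.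
Proof. by rewrite -[X in 'd f z X]mulr1 -[X in 'd f z X]/(h *: 1) linearZ. Qed.

(** Goursat's theorem for midpoint sums: on a small square, [f] is affine up to
    an error that is small compared with the side, and sums of affine functions
    vanish; bisection does the rest. *)
Lemma square_sum_small f p s (e : R) : 0 < e ->
  (forall z, mag (z - p) <= 4 * mag s -> differentiable f z) ->
  exists N, forall n, (N <= n)%N -> mag (square_sum f n p s) <= e * mag s ^+ 2.
Proof.
move=> e0 df.
apply: (@square_bisection (fun p s => exists N, forall n, (N <= n)%N ->
   mag (square_sum f n p s) <= e * mag s ^+ 2)) => [q u [N0 h0] [N1 h1] [N2 h2] [N3 h3]|z hz].
  exists (maxn (maxn N0 N1) (maxn N2 N3)).+1 => -[//|n]; rewrite ltnS !geq_max.
  move=> /andP[/andP[/h0 H0 /h1 H1] /andP[/h2 H2 /h3 H3]].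
  rewrite square_sum_quarters; apply: le_trans (magD _ _) _.
  apply: le_trans (lerD (magD _ _) (lexx _)) _.
  apply: le_trans (lerD (lerD (magD _ _) (lexx _)) (lexx _)) _.
  have hm : mag (u / 2) = mag u / 2 by rewrite magM -/half mag_half.
  rewrite hm in H0 H1 H2 H3.
  have E : e * (mag u / 2) ^+ 2 = e * mag u ^+ 2 / 4 by field.
  rewrite E in H0 H1 H2 H3; lra.
have e24 : 0 < e / 24 by rewrite divr_gt0.
have [d d0 hd] := diff_mag (df z hz) e24.
exists (d / 8); first by lra.
move=> q u hq hu; exists 0%N => n _.
set D := 'd f z 1.
pose r w := f w - (f z + D * (w - z)).
have -> : square_sum f n q u = square_sum (fun w => (f z - D * z + D * w) + r w) n q u.
  by congr (square_sum _ _ _ _); apply/funext => w; rewrite /r; ring.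
rewrite square_sumD square_sum_affine add0r.
have hr w : mag (w - q) <= 2 * mag u -> mag (r w) <= e / 4 * mag u.
  move=> hw; have hwz : mag (w - z) <= 6 * mag u.
    by apply: le_trans (mag_tri q _ _) _; lra.
  have := hd (w - z); rewrite subrKC diff_scalar -/D /r.
  rewrite (_ : f w - f z - (w - z) * D = f w - (f z + D * (w - z))); last by ring.
  have := mag_ge0 u => u0 /(_ _) h; apply: le_trans (h _) _; first by lra.
  have : e / 24 * mag (w - z) <= e / 24 * (6 * mag u) by rewrite ler_wpM2l //; lra.
  by move=> h'; apply: le_trans h' _; rewrite le_eqVlt; apply/orP; left; apply/eqP; field.
rewrite [leRHS](_ : _ = 4 * mag u * (e / 4 * mag u)); last by field.
have hi : mag (iC * u) = mag u by rewrite magM mag_i mul1r.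
have ht (t : R) x : 0 <= t <= 1 -> mag (rc t * x) <= mag x.
  by move=> /andP[t0 t1]; rewrite magM mag_rc ger0_norm // ler_piMl ?mag_ge0.
have u0 := mag_ge0 u.
apply: square_sum_le => t t01; have h1 := ht t u t01; have h2 := ht t (iC * u) t01.
rewrite hi in h2; split; apply: hr.
- by rewrite addrAC subrr add0r; lra.
- rewrite (_ : _ - q = u + rc t * (iC * u)); last by ring.
  by apply: le_trans (magD _ _) _; lra.
- rewrite (_ : _ - q = iC * u + rc t * u); last by ring.
  by apply: le_trans (magD _ _) _; rewrite hi; lra.
- by rewrite addrAC subrr add0r; lra.
Qed.

End Goursat.

(** * The maximum principle and Taylor estimates in one variable *)

Section MaxPrinciple.
Context {R : realType}.
Local Notation K := (Cplx R).
Local Notation iC := ('i%C : K).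
Implicit Types (f g F G : K -> K) (p s d z w c x : K).

Lemma diff_eq_ball {V W : normedModType K} (f g : V -> W) (x : V) :
  (exists2 e : R, 0 < e & forall y : V, mag (y - x) < e -> f y = g y) ->
  differentiable f x -> differentiable g x /\ 'd g x = 'd f x :> (V -> W).
Proof.
move=> [d d0 fg] df; apply: mag_diff; first exact: diff_continuous.
move=> e e0; have [d' d'0 h] := diff_mag df e0.
exists (Num.min d d'); first by rewrite lt_min d0.
move=> u; rewrite lt_min => /andP[u1 u2].
rewrite -(fg x) ?subrr ?mag0 // -(fg (x + u)); first exact: h.
by rewrite addrAC subrr add0r.
Qed.

Lemma near_eq_diff {V W : normedModType K} (f g : V -> W) (x : V) :
  (\forall y \near x, f y = g y) ->
  differentiable f x -> differentiable g x /\ 'd g x = 'd f x :> (V -> W).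
Proof. by move=> /nbhs_magP h; exact: diff_eq_ball. Qed.

(** This removes the singularities at the points where the function of the maximum principle is
    only continuous: the increment of [(z - e) * H z] at [e] is exactly [h * H (e + h)]. *)
Lemma mul_zero_diff (e : K) (H : K -> K) : {for e, continuous H} ->
  differentiable (fun z => (z - e) * H z) e.
Proof.
move=> /cts_magP cH.
have [] // := @mag_diff R K K (fun z => (z - e) * H z) e ( *:%R (H e) : {linear K^o -> K^o}).
  exact: scaler_continuous.
move=> r r0; have [d d0 hd] := cH r r0; exists d => // h hh.
rewrite subrr mul0r subr0 addrAC subrr add0r [X in _ - X](_ : _ = H e * h) //.
rewrite [H e * h]mulrC -mulrBr magM mulrC ler_wpM2r ?mag_ge0 //.
by apply/ltW/hd; rewrite addrAC subrr add0r.
Qed.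

(** The square gives the numerator a double zero at [w], which cancels the pole. *)
Lemma sq_div_diff G w : differentiable G w -> G w = 1 ->
  differentiable (fun z => (G z - 1) ^+ 2 / (z - w)) w.
Proof.
move=> dG G1; set d := 'd G w 1.
have [] // := @mag_diff R K K (fun z => (G z - 1) ^+ 2 / (z - w)) w
   ( *:%R (d ^+ 2) : {linear K^o -> K^o}).
  exact: scaler_continuous.
move=> e e0.
pose M := 2 * mag d + 1.
have d0 := mag_ge0 d.
have M0 : 0 < M by rewrite /M; lra.
pose e' := Num.min 1 (e / M).
have e'0 : 0 < e' by rewrite lt_min ltr01 divr_gt0.
have [r r0 hr] := diff_mag dG e'0.
exists r => // h hh; rewrite G1 !subrr expr0n mul0r subr0 addrAC subrr add0r.
rewrite [X in _ - X](_ : _ = d ^+ 2 * h) //.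
have [->|h0] := eqVneq h 0.
  by rewrite addr0 invr0 !mulr0 subr0 mag0 mulr0.
have {hh}hh := hr h hh; rewrite G1 diff_scalar -/d in hh.
have -> : (G (w + h) - 1) ^+ 2 / h - d ^+ 2 * h =
  (G (w + h) - 1 - h * d) * (G (w + h) - 1 - h * d + 2 * (h * d)) / h by field.
rewrite !magM magV ler_pdivrMr ?mag_gt0 //.
have m0 : 0 < mag h by rewrite mag_gt0.
have A : mag (G (w + h) - 1 - h * d + 2 * (h * d)) <= M * mag h.
  apply: le_trans (magD _ _) _; rewrite !magM -(rc_nat 2) mag_rc ger0_norm ?ler0n //.
  have : e' * mag h <= 1 * mag h by rewrite ler_wpM2r ?mag_ge0 // ge_min lexx.
  by rewrite /M; lra.
apply: le_trans (ler_pM (mag_ge0 _) (mag_ge0 _) hh A) _.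
have : e' <= e / M by rewrite ge_min lexx orbT.
rewrite ler_pdivlMr // => h1.
rewrite (_ : _ * _ * _ = e' * M * (mag h * mag h)); last by ring.
by rewrite -(mulrA e) ler_wpM2r // mulr_ge0 // ltW.
Qed.

Lemma diff_aff (a z : K) : differentiable (fun x : K => x - a) z.
Proof. by apply: differentiableB; [exact: ex_diff | exact: differentiable_cst]. Qed.

Lemma diff_inv_sub (w z : K) : z != w -> differentiable (fun x : K => (x - w)^-1) z.
Proof.
by move=> zw; apply: (differentiableV (diff_aff w z)); rewrite subr_eq0.
Qed.

Lemma cts_expn f z n : {for z, continuous f} -> {for z, continuous (fun x => f x ^+ n)}.
Proof.
move=> cf; elim: n => [|n IH].
  by rewrite (_ : (fun x => _) = cst 1); [exact: cst_continuous | apply/funext].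
have -> : (fun x => f x ^+ n.+1) = (fun x => f x * f x ^+ n).
  by apply/funext => x; rewrite exprS.
exact: (continuousM cf IH).
Qed.

Lemma diff_expn f z n : differentiable f z -> differentiable (fun x => f x ^+ n) z.
Proof.
move=> cf; elim: n => [|n IH].
  by rewrite (_ : (fun x => _) = cst 1); [exact: differentiable_cst | apply/funext].
have -> : (fun x => f x ^+ n.+1) = (fun x => f x * f x ^+ n).
  by apply/funext => x; rewrite exprS.
exact: (differentiableM cf IH).
Qed.

Section Square.
Variables (c : K) (L : R).
Hypothesis L0 : 0 < L.
Let p := c - rc L - iC * rc L.
Let s : K := rc (2 * L).

(** Recentring: the corner and the side [2 L] serve subdivision, the centre [c] and a parameter
    in [[-1, 1]] serve estimates on the boundary. *)
Lemma square_edges (P1 P2 P3 P4 : K -> Prop) :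
  (forall t : R, -1 <= t <= 1 ->
   [/\ P1 (c + rc L * (rc t - iC)), P2 (c + rc L * (1 + iC * rc t)),
       P3 (c + rc L * (rc t + iC)) & P4 (c + rc L * (-1 + iC * rc t))]) ->
  (forall t : R, 0 <= t <= 1 ->
    [/\ P1 (p + rc t * s), P2 (p + s + rc t * (iC * s)),
        P3 (p + iC * s + rc t * s) & P4 (p + rc t * (iC * s))]).
Proof.
move=> h t t01; have t11 : -1 <= 2 * t - 1 <= 1 by move/andP: t01 => [? ?]; apply/andP; split; lra.
have [a1 a2 a3 a4] := h _ t11.
have E : rc (2 * t - 1) = 2 * rc t - 1 by rewrite rcB rcM rc_nat rc1.
have E2 : s = 2 * rc L by rewrite /s rcM rc_nat.
rewrite {h}E in a1 a2 a3 a4; rewrite /p E2; split.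
- by rewrite (_ : _ + _ = c + rc L * (2 * rc t - 1 - iC)) //; ring.
- by rewrite (_ : _ + _ = c + rc L * (1 + iC * (2 * rc t - 1))) //; ring.
- by rewrite (_ : _ + _ = c + rc L * (2 * rc t - 1 + iC)) //; ring.
- by rewrite (_ : _ + _ = c + rc L * (-1 + iC * (2 * rc t - 1))) //; ring.
Qed.

Lemma square_annulus (P : K -> Prop) :
  (forall z, L <= mag (z - c) <= 2 * L -> P z) ->
  (forall t : R, 0 <= t <= 1 ->
    [/\ P (p + rc t * s), P (p + s + rc t * (iC * s)),
        P (p + iC * s + rc t * s) & P (p + rc t * (iC * s))]).
Proof.
move=> hP; apply: square_edges => t t01.
have t1 : `|t| <= 1 by rewrite ler_norml.
have K1 (x : K) : 1 <= mag x -> mag x <= 2 -> P (c + rc L * x).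
  move=> h1 h2; apply: hP; rewrite addrAC subrr add0r magM mag_rc gtr0_norm //.
  have h3 : 0 <= L * (mag x - 1) by rewrite mulr_ge0 ?subr_ge0 // ltW.
  have h4 : 0 <= L * (2 - mag x) by rewrite mulr_ge0 ?subr_ge0 // ltW.
  by apply/andP; split; lra.
split; apply: K1.
- apply: le_trans (mag_Im _); rewrite (_ : _ - _ = rc t + iC * rc (-1)); last by rewrite rcN rc1; ring.
  by rewrite Im_cplx normrN1.
- by apply: le_trans (magB _ _) _; rewrite mag_i mag_rc; lra.
- apply: le_trans (mag_Re _); rewrite -rc1 Re_cplx normr1 //.
- by apply: le_trans (magD _ _) _; rewrite magM mag_i mag1 mag_rc; lra.
- apply: le_trans (mag_Im _); rewrite (_ : _ + _ = rc t + iC * rc 1); last by rewrite rc1; ring.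
  by rewrite Im_cplx normr1.
- by apply: le_trans (magD _ _) _; rewrite mag_i mag_rc; lra.
- apply: le_trans (mag_Re _); rewrite -rc1 -rcN Re_cplx normrN1 //.
- by apply: le_trans (magD _ _) _; rewrite magM magN mag_i mag1 mag_rc; lra.
Qed.

(** The winding number is positive: along each edge of the square the argument of [z - w]
    increases at a definite rate. *)
Lemma Im_square_sum_inv w n : mag (w - c) <= L / 2 ->
  4 / 9 <= complex.Im (square_sum (fun z => (z - w)^-1) n p s).
Proof.
move=> hw.
have hRe : `|complex.Re (w - c)| <= L / 2 := le_trans (mag_Re _) hw.
have hIm : `|complex.Im (w - c)| <= L / 2 := le_trans (mag_Im _) hw.
move: hRe hIm; rewrite !ler_norml => /andP[a1 a2] /andP[b1 b2].
set a := complex.Re _ in a1 a2; set b := complex.Im _ in b1 b2.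
have wE : w - c = rc a + iC * rc b by exact: cplxE.
(* [u + iv] is the vector from [w] to the point of the edge, [k] the height
   of [w] above the edge. *)
have key (k v u : R) : L / 2 <= k -> `|u| <= 3 / 2 * L -> `|v| <= 3 / 2 * L ->
    k ^+ 2 <= u ^+ 2 + v ^+ 2 -> 1 / 9 <= 2 * L * (k / (u ^+ 2 + v ^+ 2)).
  rewrite !ler_norml => hk /andP[u1 u2] /andP[v1 v2] hk2.
  have h0 : 0 < u ^+ 2 + v ^+ 2.
    have k0 : 0 < k by apply: lt_le_trans hk; rewrite divr_gt0.
    by apply: lt_le_trans hk2; apply: exprn_gt0.
  rewrite mulrA ler_pdivlMr //.
  have hu : 0 <= (3 / 2 * L - u) * (3 / 2 * L + u) by apply: mulr_ge0; lra.
  have hv : 0 <= (3 / 2 * L - v) * (3 / 2 * L + v) by apply: mulr_ge0; lra.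
  have hLk : 0 <= L * (k - L / 2) by apply: mulr_ge0; lra.
  have hL := sqr_ge0 L.
  by lra.
have edge : forall t : R, -1 <= t <= 1 ->
   [/\ 1 / 9 <= complex.Im (s * (c + rc L * (rc t - iC) - w)^-1),
       1 / 9 <= complex.Im (iC * s * (c + rc L * (1 + iC * rc t) - w)^-1),
       1 / 9 <= - complex.Im (s * (c + rc L * (rc t + iC) - w)^-1)
     & 1 / 9 <= - complex.Im (iC * s * (c + rc L * (-1 + iC * rc t) - w)^-1)].
  move=> t /andP[t1 t2].
  have tL1 : 0 <= L * (t + 1) by rewrite mulr_ge0 //; lra.
  have tL2 : 0 <= L * (1 - t) by rewrite mulr_ge0 //; lra.
  have E x : c + x - w = x - (w - c) by ring.
  rewrite !E wE; split.
  - rewrite (_ : _ - _ = rc (L * t - a) + iC * rc (- L - b)); last by rewrite !(rcB, rcM, rcN); ring.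
    rewrite Im_rc Im_inv mag_sqr Re_cplx Im_cplx.
    apply: key; rewrite ?ler_norml; [lra|apply/andP; split; lra|apply/andP; split; lra|].
    have := sqr_ge0 (L * t - a); nra.
  - rewrite (_ : _ - _ = rc (L - a) + iC * rc (L * t - b)); last by rewrite !(rcB, rcM, rcN); ring.
    rewrite -mulrA Im_i Re_rc Re_inv mag_sqr Re_cplx Im_cplx.
    apply: key; rewrite ?ler_norml; [lra|apply/andP; split; lra|apply/andP; split; lra|].
    have := sqr_ge0 (L * t - b); nra.
  - rewrite (_ : _ - _ = rc (L * t - a) + iC * rc (L - b)); last by rewrite !(rcB, rcM, rcN); ring.
    rewrite Im_rc Im_inv mag_sqr Re_cplx Im_cplx mulNr mulrN opprK.
    apply: key; rewrite ?ler_norml; [lra|apply/andP; split; lra|apply/andP; split; lra|].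
    have := sqr_ge0 (L * t - a); nra.
  - rewrite (_ : _ - _ = rc (- L - a) + iC * rc (L * t - b)); last by rewrite !(rcB, rcM, rcN); ring.
    rewrite -mulrA Im_i Re_rc Re_inv mag_sqr Re_cplx Im_cplx -mulrN -mulNr.
    apply: key; rewrite ?ler_norml; [lra|apply/andP; split; lra|apply/andP; split; lra|].
    have := sqr_ge0 (L * t - b); nra.
have ImN x : complex.Im (- x) = - complex.Im x by case: x.
have E3 : - complex.Im (seg_sum (fun z => (z - w)^-1) n (p + iC * s) s) =
    complex.Im (seg_sum (fun z => - (z - w)^-1) n (p + iC * s) s).
  by rewrite seg_sumN ImN.
have E4 : - complex.Im (seg_sum (fun z => (z - w)^-1) n p (iC * s)) =
    complex.Im (seg_sum (fun z => - (z - w)^-1) n p (iC * s)).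
  by rewrite seg_sumN ImN.
have H := @square_edges (fun z => 1 / 9 <= complex.Im (s * (z - w)^-1))
  (fun z => 1 / 9 <= complex.Im (iC * s * (z - w)^-1))
  (fun z => 1 / 9 <= - complex.Im (s * (z - w)^-1))
  (fun z => 1 / 9 <= - complex.Im (iC * s * (z - w)^-1)) edge.
rewrite /square_sum !ImB ImD E3 E4.
have := @seg_sum_Im_ge R (fun z => (z - w)^-1) n p s (1 / 9)
  (fun t ht => let: And4 a _ _ _ := H t ht in a).
have := @seg_sum_Im_ge R (fun z => (z - w)^-1) n (p + s) (iC * s) (1 / 9)
  (fun t ht => let: And4 _ a _ _ := H t ht in a).
have : 1 / 9 <= complex.Im (seg_sum (fun z => - (z - w)^-1) n (p + iC * s) s).
  by apply: seg_sum_Im_ge => t /H[_ _ + _]; rewrite mulrN ImN.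
have : 1 / 9 <= complex.Im (seg_sum (fun z => - (z - w)^-1) n p (iC * s)).
  by apply: seg_sum_Im_ge => t /H[_ _ _]; rewrite mulrN ImN.
by lra.
Qed.

(** Suppose that [F] takes at [w] a larger modulus than on the boundary, and
    normalise so that [F w = 1]. The powers of [F] then tend to [0] on the
    boundary but not at [w]. For [G] a power of [F], [(G - 1)^2 / (z - w)] is
    holomorphic even at [w], so its boundary integral vanishes; in the limit this
    says that the winding number vanishes. The factor [E] makes room for two
    points where [F] is only continuous. *)
Lemma maximum_principle F e1 e2 w (B : R) :
  (forall z, mag (z - c) <= 16 * L -> z != e1 -> z != e2 -> differentiable F z) ->
  {for e1, continuous F} -> {for e2, continuous F} ->
  (forall z, L <= mag (z - c) <= 2 * L -> mag (F z) <= B) ->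
  mag (w - c) <= L / 2 -> w != e1 -> w != e2 -> mag (F w) <= B.
Proof.
move=> dF c1 c2 hB hw we1 we2; rewrite leNgt; apply/negP => hlt.
have L1 := L0.
have B0 : 0 <= B.
  apply: le_trans (mag_ge0 (F (c + rc L))) (hB _ _).
  by rewrite addrAC subrr add0r mag_rc gtr0_norm // lexx /= ler_peMl ?ler1n // ltW.
set a := F w in hlt.
have a0 : 0 < mag a by apply: le_lt_trans hlt.
have nza : a != 0 by rewrite -mag_gt0.
pose q := B / mag a.
have q0 : 0 <= q by rewrite divr_ge0 // ltW.
have q1 : q < 1 by rewrite ltr_pdivrMr // mul1r.
have we1' : w - e1 != 0 by rewrite subr_eq0.
have we2' : w - e2 != 0 by rewrite subr_eq0.
pose E z := (z - e1) * (z - e2) / ((w - e1) * (w - e2)).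
pose C := (2 * L + mag (c - e1)) * (2 * L + mag (c - e2)) / (mag (w - e1) * mag (w - e2)).
have C0 : 0 <= C by rewrite divr_ge0 ?mulr_ge0 ?addr_ge0 ?mag_ge0 // mulr_ge0 // ltW.
have hE z : mag (z - c) <= 2 * L -> mag (E z) <= C.
  move=> hz; rewrite /E magM magV !magM ler_wpM2r ?invr_ge0 ?mulr_ge0 ?mag_ge0 //.
  by apply: ler_pM; rewrite ?mag_ge0 //; apply: le_trans (mag_tri c _ _) _; rewrite lerD2r.
pose G n z := (F z / a) ^+ n * E z.
have Gw n : G n w = 1.
  by rewrite /G /E -/a divff // expr1n mul1r divff // mulf_neq0.
have dG n z : mag (z - c) <= 16 * L -> differentiable (G n) z.
  move=> hz.
  have dEaux (e e' : K) (H : K -> K) : {for e, continuous H} ->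
      differentiable (fun z => H z * ((z - e) * (z - e') / ((w - e1) * (w - e2)))) e.
    move=> cH.
    have -> : (fun z => H z * ((z - e) * (z - e') / ((w - e1) * (w - e2)))) =
        (fun z => (z - e) * (H z * ((z - e') / ((w - e1) * (w - e2))))).
      by apply/funext => x; ring.
    apply: mul_zero_diff; apply: (continuousM cH).
    apply: differentiable_continuous.
    exact: (differentiableM (diff_aff _ _) (differentiable_cst _ _)).
  have cH e : {for e, continuous F} -> {for e, continuous (fun z => (F z / a) ^+ n)}.
    by move=> cF; apply: cts_expn; apply: (continuousM cF); exact: cst_continuous.
  have [->|z1] := eqVneq z e1; first exact: dEaux (cH _ c1).
  have [->|z2] := eqVneq z e2.
    have -> : G n = (fun z => (F z / a) ^+ n * ((z - e2) * (z - e1) / ((w - e1) * (w - e2)))).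
      by apply/funext => x; rewrite /G /E; ring.
    exact: dEaux (cH _ c2).
  have dFz := dF z hz z1 z2.
  apply: (@differentiableM _ _ (fun z => (F z / a) ^+ n) E).
    by apply: diff_expn; exact: (differentiableM dFz (differentiable_cst _ _)).
  apply: (differentiableM _ (differentiable_cst _ _)).
  exact: (differentiableM (diff_aff _ _) (diff_aff _ _)).
have [n hn] : exists n, C * (C + 2) * q ^+ n < 1 / 100.
  by apply: geom_small => //; lra.
pose Q z := (G n z - 1) ^+ 2 / (z - w).
have dQ z : mag (z - c) <= 16 * L -> differentiable Q z.
  move=> hz; have [->|zw] := eqVneq z w.
    by apply: sq_div_diff (Gw n); apply: dG; apply: le_trans hw _; lra.
  apply: (@differentiableM _ _ (fun z => (G n z - 1) ^+ 2) (fun z => (z - w)^-1)).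
    by apply: diff_expn; exact: (differentiableB (dG n z hz) (differentiable_cst _ _)).
  exact: diff_inv_sub.
have hp : mag (p - c) <= 2 * L.
  rewrite (_ : p - c = - (rc L + iC * rc L)); last by rewrite /p; ring.
  rewrite magN; apply: le_trans (magD _ _) _; rewrite magM mag_i mag_rc gtr0_norm //; lra.
have hs : mag s = 2 * L by rewrite /s mag_rc gtr0_norm // mulr_gt0.
have eps0 : 0 < 1 / (100 * L ^+ 2) by rewrite divr_gt0 // mulr_gt0 // exprn_gt0.
have [N hN] : exists N, forall m, (N <= m)%N ->
    mag (square_sum Q m p s) <= 1 / (100 * L ^+ 2) * mag s ^+ 2.
  apply: (square_sum_small eps0) => z hz; apply: dQ.
  by apply: le_trans (mag_tri p _ _) _; rewrite hs in hz; lra.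
have {hN} := hN N (leqnn N).
rewrite hs [leRHS](_ : _ = 4 / 100); last by field; rewrite gt_eqF.
pose S z := (G n z ^+ 2 - 2 * G n z) / (z - w).
have -> : square_sum Q N p s = square_sum (fun z => S z + (z - w)^-1) N p s.
  by congr (square_sum _ _ _ _); apply/funext => z; rewrite /Q /S; ring.
rewrite square_sumD => hQ.
have hS : mag (square_sum S N p s) <= 16 / 100.
  apply: le_trans (@square_sum_le R S N p s (2 / L / 100) _) _.
    apply: (@square_annulus (fun z => mag (S z) <= 2 / L / 100)) => z /andP[z1 z2].
    have zw : L / 2 <= mag (z - w).
      by have := mag_tri w z c; lra.
    have hG : mag (G n z) <= q ^+ n * C.
      rewrite /G magM magX magM magV; apply: ler_pM; rewrite ?mag_ge0 ?exprn_ge0 ?divr_ge0 ?mag_ge0 ?hE //.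
      rewrite lerXn2r ?nnegrE ?divr_ge0 ?mag_ge0 //.
      by rewrite ler_pM2r ?invr_gt0 // hB // z1.
    have qn1 : q ^+ n <= 1 by rewrite exprn_ile1 // ltW.
    have qn0 : 0 <= q ^+ n by rewrite exprn_ge0.
    have h1 : mag (G n z ^+ 2 - 2 * G n z) <= 1 / 100.
      rewrite (_ : _ - _ = G n z * (G n z - 2)); last by ring.
      rewrite magM; apply: le_trans (ltW hn).
      rewrite [leRHS](_ : _ = q ^+ n * C * (C + 2)); last by ring.
      apply: ler_pM; rewrite ?mag_ge0 //.
      apply: le_trans (magB _ _) _; rewrite -(rc_nat 2) mag_rc ger0_norm ?ler0n // lerD2r.
      by apply: le_trans hG _; rewrite ler_piMl.
    rewrite /S magM magV ler_pdivrMr; last by apply: lt_le_trans zw; rewrite divr_gt0.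
    apply: le_trans h1 _.
    have : 2 / L / 100 * (L / 2) <= 2 / L / 100 * mag (z - w).
      by rewrite ler_wpM2l // !divr_ge0 // ltW.
    by apply: le_trans; rewrite le_eqVlt; apply/orP; left; apply/eqP; field; rewrite gt_eqF.
  by rewrite hs le_eqVlt; apply/orP; left; apply/eqP; field; rewrite gt_eqF.
have := Im_square_sum_inv N hw.
set W := square_sum (fun z => (z - w)^-1) N p s in hQ *; set T := square_sum S N p s in hQ hS.
have : complex.Im W <= mag W by apply: le_trans (mag_Im _); exact: ler_norm.
have : mag W <= mag (T + W) + mag T by apply: le_trans (magB _ _); rewrite addrAC subrr add0r.
lra.
Qed.

End Square.

Definition diff_quot g w z : K :=
  if z == w then 'd g w 1 else (g z - g w) / (z - w).

Lemma diff_quot_near g w z : z != w ->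
  exists2 e : R, 0 < e & forall y : K, mag (y - z) < e -> (g y - g w) / (y - w) = diff_quot g w y.
Proof.
move=> zw; exists (mag (z - w)); first by rewrite mag_gt0 subr_eq0.
move=> y hy; rewrite /diff_quot; case: eqP => // yw.
by move: hy; rewrite yw mag_distC ltxx.
Qed.

Lemma diff_quot_diff g w z : z != w -> differentiable g z -> differentiable (diff_quot g w) z.
Proof.
move=> zw dg; apply: (diff_eq_ball (diff_quot_near g zw) _).1.
apply: (differentiableM (differentiableB dg (differentiable_cst _ _)) (diff_inv_sub zw)).
Qed.

Lemma diff_quot_cts_ne g w z : z != w -> {for z, continuous g} -> {for z, continuous (diff_quot g w)}.
Proof.
move=> zw cg; have [d d0 hd] := diff_quot_near g zw.
have cq : {for z, continuous (fun y => (g y - g w) / (y - w))}.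
  apply: (@continuousM _ _ (fun y => g y - g w) (fun y => (y - w)^-1)).
    exact: (@continuousB _ _ _ g (cst (g w)) z cg (@cst_continuous _ _ (g w) z)).
  exact: differentiable_continuous (diff_inv_sub zw).
apply/cts_magP => e e0; have [d' d'0 h] := (cts_magP _ _).1 cq e e0.
exists (Num.min d d') => [|y]; rewrite lt_min ?d0 // => /andP[y1 y2].
by rewrite -(hd y) // -(hd z) ?subrr ?mag0 //; apply: h.
Qed.

Lemma diff_quot_cts g w : differentiable g w -> {for w, continuous (diff_quot g w)}.
Proof.
move=> dg; apply/cts_magP => e e0; have e2 : 0 < e / 2 by rewrite divr_gt0.
have [d d0 hd] := diff_mag dg e2; exists d => // y hy.
rewrite /diff_quot eqxx; case: eqP => [_|/eqP yw]; first by rewrite subrr mag0.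
have := hd _ hy; rewrite subrKC (diff_scalar g w (y - w)) => h.
have yw' : y - w != 0 by rewrite subr_eq0.
rewrite (_ : _ - _ = (g y - g w - (y - w) * 'd g w 1) / (y - w)); last by field.
rewrite magM magV ltr_pdivrMr ?mag_gt0 //; apply: le_lt_trans h _.
by rewrite ltr_pM2r ?mag_gt0 //; lra.
Qed.

(** The maximum principle bounds [(f z - f c) / (z - c)], which is continuous at [c] and
    holomorphic elsewhere; applied once more it bounds the difference quotient of that function,
    and this Lipschitz estimate is the second-order Taylor estimate of [f]. *)
Lemma taylor2 (f : K -> K) c (L M : R) : 0 < L ->
  (forall z, mag (z - c) <= 16 * L -> differentiable f z) ->
  (forall z, mag (z - c) <= 2 * L -> mag (f z) <= M) ->
  forall h, mag h <= L / 8 ->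
    mag (f (c + h) - f c - 'd f c h) <= 32 * M / L ^+ 2 * mag h ^+ 2.
Proof.
move=> L0 df hM h hh.
have M0 : 0 <= M by apply: le_trans (mag_ge0 (f c)) (hM c _); rewrite subrr mag0; lra.
have dfc : differentiable f c by apply: df; rewrite subrr mag0; lra.
pose g := diff_quot f c.
have cg : {for c, continuous g} by exact: diff_quot_cts.
have dg z : mag (z - c) <= 16 * L -> z != c -> differentiable g z.
  by move=> hz zc; exact: (diff_quot_diff zc (df z hz)).
have gM z : mag (z - c) <= L / 2 -> z != c -> mag (g z) <= 2 * M / L.
  move=> hz zc; apply: (@maximum_principle c L L0 g c c z _ _ cg cg _ hz zc zc) => [u hu uc _|u /andP[u1 u2]].
    exact: (dg u hu uc).
  have uc : u != c by apply/eqP => uc; move: u1; rewrite uc subrr mag0; lra.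
  rewrite /g /diff_quot (negbTE uc) magM magV ler_pdivrMr; last by lra.
  apply: le_trans (magB _ _) _.
  have h1 := hM u u2; have h2 : mag (f c) <= M by apply: hM; rewrite subrr mag0; lra.
  have : 2 * M / L * L <= 2 * M / L * mag (u - c).
    by rewrite ler_wpM2l // divr_ge0 ?mulr_ge0 // ltW.
  by rewrite divfK ?gt_eqF //; lra.
set k := 32 * M / L ^+ 2.
have k0 : 0 <= k by rewrite divr_ge0 ?mulr_ge0 ?exprn_ge0 // ltW.
have lip z w : mag (z - c) <= L / 8 -> mag (w - c) <= L / 8 -> z != c -> w != c -> z != w ->
    mag (g z - g w) <= k * mag (z - w).
  move=> hz hw zc wc zw.
  have L40 : 0 < L / 4 by rewrite divr_gt0.
  have : mag (diff_quot g w z) <= k.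
    have hw16 : mag (w - c) <= 16 * L by lra.
    have hz2 : mag (z - c) <= L / 4 / 2 by lra.
    have cw : c != w by rewrite eq_sym.
    apply: (@maximum_principle c (L / 4) L40 _ w c z _ _ (diff_quot_cts (dg w hw16 wc))
      (diff_quot_cts_ne cw cg) _ hz2 zw zc) => [u hu uw uc|u /andP[u1 u2]].
      have hu16 : mag (u - c) <= 16 * L by lra.
      exact: (diff_quot_diff uw (dg u hu16 uc)).
    have uc : u != c by apply/eqP => uc; move: u1; rewrite uc subrr mag0; lra.
    have uw : L / 8 <= mag (u - w) by have := mag_tri w u c; lra.
    have uw0 : u != w by apply/eqP => uw'; move: uw; rewrite uw' subrr mag0; lra.
    rewrite /diff_quot (negbTE uw0) magM magV ler_pdivrMr; last by lra.
    apply: le_trans (magB _ _) _.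
    have hu2 : mag (u - c) <= L / 2 by lra.
    have hw2 : mag (w - c) <= L / 2 by lra.
    have h1 := gM u hu2 uc.
    have h2 := gM w hw2 wc.
    have : k * (L / 8) <= k * mag (u - w) by rewrite ler_wpM2l.
    rewrite (_ : k * (L / 8) = 2 * (2 * M / L)); last by rewrite /k; field; rewrite gt_eqF.
    by lra.
  rewrite /diff_quot (negbTE zw) magM magV ler_pdivrMr // mag_gt0 subr_eq0 //.
have [->|h0] := eqVneq h 0.
  by rewrite addr0 subrr sub0r linear0 oppr0 mag0 expr0n mulr0.
have mh0 : 0 < mag h by rewrite mag_gt0.
suff hg : mag (g (c + h) - 'd f c 1) <= k * mag h.
  have chc : c + h - c = h by rewrite addrAC subrr add0r.
  move: hg; rewrite /g /diff_quot -subr_eq0 chc (negbTE h0) => hg.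
  rewrite (diff_scalar f c h).
  rewrite (_ : _ - _ = ((f (c + h) - f c) / h - 'd f c 1) * h); last by field.
  by rewrite magM expr2 mulrA ler_wpM2r ?mag_ge0.
apply/ler_addgt0Pr => e e0.
have e20 : 0 < e / 2 by rewrite divr_gt0.
have [d d0 hd] := (cts_magP _ _).1 cg _ e20.
have k1 : 0 < 2 * (k + 1) by lra.
pose r := Num.min (Num.min (d / 2) (L / 8)) (Num.min (mag h / 2) (e / (2 * (k + 1)))).
have r0 : 0 < r by rewrite !lt_min !divr_gt0.
have [r1 r2 r3 r4] : [/\ r <= d / 2, r <= L / 8, r <= mag h / 2 & r <= e / (2 * (k + 1))].
  by split; rewrite !ge_min lexx ?orbT.
pose w := c + rc r.
have wcE : w - c = rc r by rewrite /w addrAC subrr add0r.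
have mw : mag (w - c) = r by rewrite wcE mag_rc gtr0_norm.
have wc : w != c by rewrite -subr_eq0 -mag_gt0 mw.
have gc : g c = 'd f c 1 by rewrite /g /diff_quot eqxx.
have H1 : mag (g w - 'd f c 1) < e / 2 by rewrite -gc; apply: hd; lra.
have chc : c + h - c = h by rewrite addrAC subrr add0r.
have cw : c + h != w.
  apply/eqP => E; have : mag (w - c) = mag h by rewrite -E chc.
  by rewrite mw; lra.
have H2 : mag (g (c + h) - g w) <= k * mag (c + h - w).
  have hch : mag (c + h - c) <= L / 8 by rewrite chc.
  have hwc : mag (w - c) <= L / 8 by rewrite mw.
  have chc0 : c + h != c by rewrite -subr_eq0 chc.
  exact: (lip _ _ hch hwc chc0 wc cw).
have H3 : mag (c + h - w) <= mag h + r.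
  have := magB h (rc r); rewrite mag_rc (gtr0_norm r0).
  by rewrite /w opprD addrA chc.
have H4 : k * mag (c + h - w) <= k * (mag h + r) by rewrite ler_wpM2l.
have H5 : (k + 1) * r <= e / 2.
  by move: r4; rewrite ler_pdivlMr //; lra.
apply: le_trans (mag_tri (g w) _ _) _; lra.
Qed.

End MaxPrinciple.

(** * Holomorphic functions of several variables *)

Section RowVectors.
Context {R : realType}.
Local Notation K := (Cplx R).
Local Notation iC := ('i%C : K).
Context {n : nat}.
Implicit Types v : 'rV[K]_n.

Lemma mag_coord v i : mag (v 0 i) <= mag v.
Proof.
apply/ler_addgt0Pr => e e0.
have : ball (0 : 'rV[K]_n) (rc (mag v + e)) v.
  rewrite -ball_normE /ball_ /= sub0r normrN magE rc_lt; lra.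
move=> [_ /(_ 0 i)]; rewrite mxE -ball_normE /ball_ /= sub0r normrN magE rc_lt.
exact: ltW.
Qed.

Lemma mag_rV_le v (B : R) : 0 <= B -> (forall i, mag (v 0 i) <= B) -> mag v <= B.
Proof.
move=> B0 h; have [v0|v0] := eqVneq (mx_norm v) 0.
  by rewrite (mx_norm_eq0 v0) mag0.
have [[j i] /= E] := mx_norm_neq0 v0.
rewrite -rc_le -magE [leLHS](_ : _ = mx_norm v) // E ord1 magE rc_le; exact: h.
Qed.

Lemma mag_rV_lt v (B : R) : 0 < B -> (forall i, mag (v 0 i) < B) -> mag v < B.
Proof.
move=> B0 h; have [v0|v0] := eqVneq (mx_norm v) 0.
  by rewrite (mx_norm_eq0 v0) mag0.
have [[j i] /= E] := mx_norm_neq0 v0.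
rewrite -rc_lt -magE [ltLHS](_ : _ = mx_norm v) // E ord1 magE rc_lt; exact: h.
Qed.

Lemma mag_delta i : mag (delta_mx 0 i : 'rV[K]_n) <= 1.
Proof.
by apply: mag_rV_le => // j; rewrite mxE eqxx /=; case: eqP; rewrite ?mag1 ?mag0 ?ler01.
Qed.

Definition dotf (l v : 'rV[K]_n) : K := \sum_i v 0 i * l 0 i.
Fact dotf_linear l : linear (dotf l).
Proof.
move=> a u v; rewrite /dotf scaler_sumr -big_split /=; apply: eq_bigr => i _.
by rewrite !mxE mulrDl -mulrA.
Qed.
HB.instance Definition _ l := GRing.isLinear.Build K _ _ _ (dotf l) (dotf_linear l).

Lemma dotf_mag l v : mag (dotf l v) <= n%:R * mag l * mag v.
Proof.
apply: le_trans (mag_sum _ _) _.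
apply: (@le_trans _ _ (\sum_(i < n) mag l * mag v)).
  by apply: ler_sum => i _; rewrite magM mulrC; apply: ler_pM; rewrite ?mag_ge0 ?mag_coord.
by rewrite sumr_const card_ord -mulrA mulr_natl.
Qed.

Lemma dotf_continuous l : continuous (dotf l).
Proof.
move=> v; apply/cts_magP => e e0; pose k := n%:R * mag l + 1.
have k0 : 0 < k by rewrite ltr_wpDl // mulr_ge0 ?mag_ge0.
exists (e / k) => [|u]; first by rewrite divr_gt0.
rewrite ltr_pdivlMr // => hu; rewrite -linearB; apply: le_lt_trans (dotf_mag _ _) _.
by apply: le_lt_trans hu; rewrite mulrC ler_wpM2l ?mag_ge0 // /k lerDl.
Qed.

Lemma linear_dotf (L : {linear 'rV[K]_n -> K}) v : L v = dotf (\row_i L (delta_mx 0 i)) v.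
Proof.
rewrite {1}(row_sum_delta v) linear_sum; apply: eq_bigr => i _.
by rewrite linearZ mxE.
Qed.

Lemma compact_square (r : R) : 
  exists A : set K, compact A /\ forall z, mag z <= r -> A z.
Proof.
pose g (xy : R * R) : K := rc xy.1 + iC * rc xy.2.
have cg : continuous g.
  move=> [x y] P /nbhs_magP[e e0 h]; have e2 : 0 < e / 2 by rewrite divr_gt0.
  rewrite /nbhs /=; exists (ball x (e / 2), ball y (e / 2)).
    by split; apply: nbhsx_ballx.
  move=> [x' y'] [/= hx hy]; apply: h; rewrite /g /=.
  rewrite (_ : _ - _ = rc (x' - x) + iC * rc (y' - y)); last by rewrite !rcB; ring.
  apply: le_lt_trans (magD _ _) _; rewrite magM mag_i mul1r !mag_rc.
  move: hx hy; rewrite -!ball_normE /ball_ /= (distrC x) (distrC y); lra.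
exists (g @` (`[- r, r] `*` `[- r, r])); split.
  apply: continuous_compact; first exact: continuous_subspaceT.
  exact: (compact_setX (@segment_compact R (- r) r) (@segment_compact R (- r) r)).
move=> z hz; exists (complex.Re z, complex.Im z); last by rewrite /g -cplxE.
have h1 := le_trans (mag_Re z) hz; have h2 := le_trans (mag_Im z) hz.
by split; rewrite /= in_itv /= -ler_norml.
Qed.

Lemma compact_ball (r : R) :
  exists A : set 'rV[K]_n, compact A /\ forall v, mag v <= r -> A v.
Proof.
have [A [cA hA]] := compact_square r.
exists [set v | forall i, A (v ord0 i)]; split; first exact: (@rV_compact K n (fun=> A) (fun=> cA)).
by move=> v hv i; apply: hA; apply: le_trans (mag_coord _ _) hv.
Qed.

Lemma bounded_cluster (u : nat -> 'rV[K]_n) (r : R) : (forall j, mag (u j) <= r) ->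
  exists l, forall e N, 0 < e -> exists2 j, (N <= j)%N & mag (u j - l) < e.
Proof.
move=> ur; have [A [cA hA]] := compact_ball r.
have hF : (\forall j \near \oo, A (u j))%classic by near=> j; apply: hA; apply: ur.
have [l [_ hl]] := cA (u @ \oo)%classic _ hF.
exists l => e N e0; have hB : nbhs l [set y | mag (y - l) < e].
  by apply/nbhs_magP; exists e.
have hU : (\forall j \near \oo, [set u j | j in [set j | (N <= j)%N]] (u j))%classic.
  by near=> j; exists j => //=; near: j; exact: nbhs_infty_ge.
by have [_ [[j Nj <-] hj]] := hl _ _ hU hB; exists j.
Unshelve. all: by end_near. Qed.

End RowVectors.

Section SecondDerivatives.
Context {R : realType}.
Local Notation K := (Cplx R).

Lemma diff_line {V : normedModType K} (z h : V) (x : K) :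
  differentiable (fun t : K => z + t *: h) x /\
  'd (fun t : K => z + t *: h) x = (fun t : K => t *: h) :> (K -> V).
Proof.
have D := is_diff_scalel x h.
have := @is_diffD K K V (cst z) (fun t : K => t *: h) _ _ x (is_diff_cst z x) D.
by case=> d1 d2; split=> //; rewrite d2; apply/funext => t; rewrite fctE add0r.
Qed.

(** The one-variable estimate on the complex line through [z] in the direction [h], whose parameter
    disc has radius [16 L = r / mag h]; the constant is [32 * 16 ^ 2]. *)
Lemma taylor2_mag {V : normedModType K} (f : V -> K) (z : V) (r M : R) : 0 < r ->
  (forall y, mag (y - z) <= r -> differentiable f y) ->
  (forall y, mag (y - z) <= r -> mag (f y) <= M) ->
  forall h, mag h <= r / 128 ->
    mag (f (z + h) - f z - 'd f z h) <= 2 ^+ 13 * M / r ^+ 2 * mag h ^+ 2.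
Proof.
move=> r0 df hM h hh; have [->|h0] := eqVneq h 0.
  by rewrite addr0 subrr linear0 subrr !mag0 expr0n /= mulr0.
have m0 : 0 < mag h by rewrite mag_gt0.
pose L := r / (16 * mag h).
have L0 : 0 < L by rewrite divr_gt0 // mulr_gt0.
have LE : 16 * L * mag h = r by rewrite /L; field; rewrite gt_eqF.
pose g (t : K) := f (z + t *: h).
have near (t : K) : mag (t - 0) <= 16 * L -> mag (z + t *: h - z) <= r.
  by rewrite subr0 addrAC subrr add0r magZ -LE ler_pM2r.
have dg (t : K) : mag (t - 0) <= 16 * L -> differentiable g t.
  by move=> /near ht; exact: (@differentiable_comp _ _ _ _ (fun t : K => z + t *: h) f t (diff_line z h t).1 (df _ ht)).
have gM (t : K) : mag (t - 0) <= 2 * L -> mag (g t) <= M.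
  by move=> ht; apply: hM; apply: near; lra.
have h1 : mag (1 : K) <= L / 8.
  by rewrite mag1 /L -mulrA -invfM ler_pdivlMr ?mulr_gt0 //; lra.
have := taylor2 L0 dg gM h1.
have z0 : z + 0 *: h = z by rewrite scale0r addr0.
have -> : 'd g 0 1 = 'd f z h.
  have [dl1 dl2] := diff_line z h 0.
  rewrite (@diff_comp _ _ _ _ _ f _ dl1) ?z0 /=; last by apply: df; rewrite subrr mag0 ltW.
  by rewrite dl2 scale1r.
rewrite add0r /g scale1r z0 mag1 expr1n mulr1 => h2; apply: le_trans h2 _.
by rewrite le_eqVlt; apply/orP; left; apply/eqP; rewrite /L; field; rewrite !gt_eqF.
Qed.

Lemma ball_shrink {V : normedModType K} (f : V -> K) (z : V) (r : R) : 0 < r ->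
  (forall y, mag (y - z) < r -> differentiable f y) ->
  exists s M : R, [/\ 0 < s, 0 <= M, forall y, mag (y - z) <= s -> differentiable f y &
    forall y, mag (y - z) <= s -> mag (f y) <= M].
Proof.
move=> r0 df.
have cf : {for z, continuous f}.
  by apply: differentiable_continuous; apply: df; rewrite subrr mag0.
have [d d0 hd] := (cts_magP _ _).1 cf 1 ltr01.
pose s := Num.min (r / 2) (d / 2).
have s1 : s <= r / 2 by rewrite ge_min lexx.
have s2 : s <= d / 2 by rewrite ge_min lexx orbT.
exists s, (mag (f z) + 1); split.
- by rewrite lt_min !divr_gt0.
- by rewrite addr_ge0 ?mag_ge0.
- by move=> y hy; apply: df; lra.
- move=> y hy; have : mag (f y - f z) < 1 by apply: hd; lra.
  by have := mag_sub (f y) (f z); lra.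
Qed.

Lemma approx_diff (a b l a' b' l' : K) (x1 x2 x3 x4 : R) :
  mag (a' - a) <= x1 -> mag (b' - b) <= x2 -> mag (a' - b' - l') <= x3 ->
  mag (l - l') <= x4 -> mag (a - b - l) <= x1 + x2 + x3 + x4.
Proof.
move=> h1 h2 h3 h4.
rewrite (_ : a - b - l = (b' - b) - (a' - a) + (a' - b' - l') - (l - l')); last by ring.
have := magB (b' - b - (a' - a) + (a' - b' - l')) (l - l').
have := magD (b' - b - (a' - a)) (a' - b' - l').
have := magB (b' - b) (a' - a).
lra.
Qed.

(** The derivative of [f] in the direction [v] is the limit, as [k] tends to [0], of the
    holomorphic difference quotients [(f (y + k v) - f y) / k]. These are uniformly bounded,
    so they have second-order Taylor estimates with a common constant, which pass to the
    limit; the differential of the limit is a cluster point of their differentials. *)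
Lemma diff_of_partial (n : nat) (f : 'rV[K]_n -> K) (z v : 'rV[K]_n) (r : R) : 0 < r ->
  (forall y, mag (y - z) < r -> differentiable f y) ->
  differentiable (fun y => 'd f y v) z /\
  forall h (e : R), 0 < e -> exists2 k : K, 0 < mag k < e &
    mag ('d (fun y => 'd f y v) z h - k^-1 * ('d f (z + k *: v) h - 'd f z h)) < e.
Proof.
move=> r0 /(ball_shrink r0) [s [M [s0 M0 df hM]]].
pose t := s / 2; have t0 : 0 < t by rewrite divr_gt0.
have [->|v0] := eqVneq v 0.
  have -> : (fun y => 'd f y 0) = cst 0 by apply/funext => y; rewrite linear0.
  split; first exact: differentiable_cst.
  move=> h e e0; exists (rc (e / 2)).
    by rewrite mag_rc gtr0_norm ?divr_gt0 //=; lra.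
  have key (a b c : K) : a = 0 -> b = 0 -> mag (a - c * b) < e.
    by move=> -> ->; rewrite mulr0 subr0 mag0.
  apply: key; first by rewrite diff_cst.
  by rewrite scaler0 addr0; apply: (subrr ('d f z h)).
have mv0 : 0 < mag v by rewrite mag_gt0.
(* The estimate for [f] with one constant for all centres at distance at most [t] from [z]. *)
pose C := 2 ^+ 13 * M / t ^+ 2.
have C0 : 0 <= C by rewrite divr_ge0 ?exprn_ge0 ?(ltW t0) // mulr_ge0 // exprn_ge0.
have T1 y h : mag (y - z) <= t -> mag h <= t / 128 ->
    mag (f (y + h) - f y - 'd f y h) <= C * mag h ^+ 2.
  move=> hy; apply: (taylor2_mag t0) => u hu; [apply: df|apply: hM].
    by apply: le_trans (mag_tri y _ _) _; rewrite /t in hu hy; lra.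
  by apply: le_trans (mag_tri y _ _) _; rewrite /t in hu hy; lra.
pose k0 := t / 128 / mag v; have k00 : 0 < k0 by rewrite divr_gt0 // divr_gt0.
have k0v : k0 * mag v = t / 128 by rewrite /k0 divfK // gt_eqF.
(* [B] bounds the derivative in the direction [v], hence the quotients [D k] defined below. *)
pose B := (2 * M + C * (t / 128) ^+ 2) / k0.
have B0 : 0 <= B.
  by apply: divr_ge0 (ltW k00); apply: addr_ge0; rewrite mulr_ge0 ?sqr_ge0.
have dB y : mag (y - z) <= t -> mag ('d f y v) <= B.
  move=> hy; rewrite /B ler_pdivlMr // mulrC.
  have hk : mag (rc k0 *: v) = t / 128 by rewrite magZ mag_rc (gtr0_norm k00).
  have := T1 y (rc k0 *: v) hy; rewrite hk lexx linearZ => /(_ isT).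
  have <- : mag (rc k0 *: 'd f y v) = k0 * mag ('d f y v) by rewrite magZ mag_rc (gtr0_norm k00).
  have hy2 : mag (y + rc k0 *: v - z) <= s.
    rewrite addrAC; apply: le_trans (magD _ _) _; rewrite hk /t in hy *; lra.
  have := hM _ hy2; have : mag (f y) <= M by apply: hM; rewrite /t in hy; lra.
  set A := f (y + _); set D := _ *: _ => h1 h2 h3.
  have := mag_tri (A - f y) D 0; rewrite !subr0 mag_distC => h4.
  have := magB A (f y); lra.
pose D (k : K) y := k^-1 * (f (y + k *: v) - f y).
have kle (k : K) : mag k <= k0 -> mag (k *: v) <= t / 128.
  by move=> hk; rewrite magZ -k0v ler_pM2r.
have Dlim (k : K) y : k != 0 -> mag k <= k0 -> mag (y - z) <= t ->
    mag (D k y - 'd f y v) <= C * mag v ^+ 2 * mag k.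
  move=> kn0 hk hy; have := T1 y (k *: v) hy (kle k hk).
  rewrite linearZ /= (_ : k *: 'd f y v = k * 'd f y v) // magZ => h1.
  have -> : D k y - 'd f y v = k^-1 * (f (y + k *: v) - f y - k * 'd f y v).
    by rewrite mulrBr mulKf.
  rewrite magM magV mulrC ler_pdivrMr ?mag_gt0 //; apply: le_trans h1 _.
  by rewrite le_eqVlt; apply/orP; left; apply/eqP; ring.
pose M1 := B + C * mag v ^+ 2 * k0.
have M10 : 0 <= M1 by rewrite addr_ge0 // mulr_ge0 ?(ltW k00) // mulr_ge0 ?sqr_ge0.
have DM (k : K) y : k != 0 -> mag k <= k0 -> mag (y - z) <= t -> mag (D k y) <= M1.
  move=> kn0 hk hy; have h1 := Dlim k y kn0 hk hy; have h2 := dB y hy.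
  have h3 : C * mag v ^+ 2 * mag k <= C * mag v ^+ 2 * k0.
    by rewrite ler_wpM2l // mulr_ge0 // sqr_ge0.
  by have := mag_sub (D k y) ('d f y v); rewrite /M1; lra.
have sh (k : K) y : is_diff y (fun y => y + k *: v) id.
  have := @is_diffD K _ _ id (cst (k *: v)) _ _ y (is_diff_id y) (is_diff_cst _ y).
  by case=> d1 d2; constructor=> //; rewrite d2; apply/funext => u; rewrite fctE addr0.
have Ddiff (k : K) y : k != 0 -> mag k <= k0 -> mag (y - z) <= t ->
    differentiable (D k) y /\
    'd (D k) y = (fun h => k^-1 * ('d f (y + k *: v) h - 'd f y h)) :> (_ -> _).
  move=> kn0 hk hy.
  have hyk : mag (y + k *: v - z) <= s.
    rewrite addrAC; apply: le_trans (magD _ _) _; have := kle k hk; rewrite /t in hy *; lra.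
  have dfy : differentiable f y by apply: df; rewrite /t in hy; lra.
  have d1 : differentiable (f \o (fun y => y + k *: v)) y.
    by apply: differentiable_comp; [case: (sh k y) | exact: df].
  have d2 := differentiableB d1 dfy.
  split; first exact: (@differentiableZ _ _ _ _ k^-1 _ d2).
  apply: (etrans (@diffZ _ _ _ (f \o (fun y => y + k *: v) - f) k^-1 _ d2)).
  apply/funext => h; have [s1 s2] := sh k y.
  have EB : 'd (f \o (fun y => y + k *: v) - f) y h =
    'd (f \o (fun y => y + k *: v)) y h - 'd f y h := congr1 (@^~ h) (diffB d1 dfy).
  have EC : 'd (f \o (fun y => y + k *: v)) y h = 'd f (y + k *: v) h.
    by apply: (etrans (congr1 (@^~ h) (diff_comp s1 (df _ hyk)))); rewrite /= s2.
  exact: (congr1 (fun x => k^-1 * x) (etrans EB (congr1 (fun x => x - 'd f y h) EC))).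
pose C2 := 2 ^+ 13 * M1 / t ^+ 2.
have C20 : 0 <= C2 by rewrite divr_ge0 ?exprn_ge0 ?(ltW t0) // mulr_ge0 // exprn_ge0.
have T2 (k : K) h : k != 0 -> mag k <= k0 -> mag h <= t / 128 ->
    mag (D k (z + h) - D k z - 'd (D k) z h) <= C2 * mag h ^+ 2.
  by move=> kn0 hk; apply: (taylor2_mag t0) => y hy; [exact: (Ddiff k y kn0 hk hy).1 | exact: DM].
pose kj (j : nat) : K := rc (k0 / j.+1%:R).
have kjm j : mag (kj j) = k0 / j.+1%:R by rewrite mag_rc gtr0_norm // divr_gt0.
have kj0 j : kj j != 0 by rewrite -mag_gt0 kjm divr_gt0.
have kjle j : mag (kj j) <= k0.
  by rewrite kjm ler_pdivrMr // ler_peMr ?ler1n // ltW.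
have zz : mag (z - z) <= t by rewrite subrr mag0 ltW.
pose l j : 'rV[K]_n := \row_i ('d (D (kj j)) z (delta_mx 0 i)).
have lE j h : 'd (D (kj j)) z h = dotf (l j) h by exact: linear_dotf.
pose q := t / 128; have q0 : 0 < q by rewrite divr_gt0.
have lM j : mag (l j) <= (2 * M1 + C2 * q ^+ 2) / q.
  apply: mag_rV_le => [|i].
    by apply: divr_ge0 (ltW q0); apply: addr_ge0; rewrite mulr_ge0 ?sqr_ge0.
  rewrite mxE ler_pdivlMr //.
  set di := delta_mx 0 i.
  have hq : mag (rc q *: di) <= q.
    by rewrite magZ mag_rc (gtr0_norm q0) ler_piMr ?mag_delta ?(ltW q0).
  have := T2 (kj j) (rc q *: di) (kj0 j) (kjle j) hq.
  have -> : 'd (D (kj j)) z (rc q *: di) = rc q *: 'd (D (kj j)) z di by exact: linearZ.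
  have <- : mag (rc q *: 'd (D (kj j)) z di) = mag ('d (D (kj j)) z di) * q.
    by rewrite magZ mag_rc (gtr0_norm q0) mulrC.
  have h1 : mag (D (kj j) (z + rc q *: di)) <= M1.
    by apply: DM => //; rewrite addrAC subrr add0r; apply: le_trans hq _; rewrite /q; lra.
  have h2 : mag (D (kj j) z) <= M1 by apply: DM.
  have h3 : C2 * mag (rc q *: di) ^+ 2 <= C2 * q ^+ 2.
    by rewrite ler_wpM2l // lerXn2r ?nnegrE ?mag_ge0 // ltW.
  set E := rc q *: 'd (D (kj j)) z di => h4.
  have := mag_tri (D (kj j) (z + rc q *: di) - D (kj j) z) E 0; rewrite !subr0 mag_distC => h5.
  have := magB (D (kj j) (z + rc q *: di)) (D (kj j) z); lra.
have [l0 hl] := bounded_cluster lM.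
have kjsmall (e : R) : 0 < e -> exists N, forall j, (N <= j)%N -> mag (kj j) < e.
  move=> e0; exists (Num.bound (k0 / e)) => j Nj; rewrite kjm ltr_pdivrMr // mulrC -ltr_pdivrMr //.
  apply: lt_le_trans (archi_boundP _) _; first by rewrite divr_ge0 // ltW.
  by rewrite ler_nat (leq_trans Nj).
have pick h (e : R) : 0 < e -> exists2 j, mag (kj j) < e & mag (dotf l0 h - 'd (D (kj j)) z h) < e.
  move=> e0; have [N hN] := kjsmall e e0.
  pose c := n%:R * mag h + 1; have c0 : 0 < c by rewrite ltr_wpDl // mulr_ge0 ?mag_ge0.
  have [j Nj hj] := hl (e / c) N (divr_gt0 e0 c0); exists j; first exact: hN.
  rewrite lE (_ : _ - _ = dotf (l0 - l j) h); last first.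
    by rewrite /dotf -sumrB; apply: eq_bigr => i _; rewrite !mxE mulrBr.
  apply: le_lt_trans (dotf_mag _ _) _; rewrite mag_distC.
  rewrite ltr_pdivlMr // in hj; apply: le_lt_trans hj.
  rewrite mulrAC mulrC; apply: ler_wpM2l; [exact: mag_ge0 | rewrite /c; lra].
have T3 h : mag h <= q -> mag ('d f (z + h) v - 'd f z v - dotf l0 h) <= C2 * mag h ^+ 2.
  move=> hh; apply/ler_addgt0Pr => e e0.
  pose c := 2 * (C * mag v ^+ 2) + 1.
  have c0 : 0 < c.
    by rewrite ltr_wpDl // mulr_ge0 // mulr_ge0 // sqr_ge0.
  pose e' := Num.min (e / 2) (e / (2 * c)).
  have e'0 : 0 < e' by rewrite lt_min !divr_gt0 // mulr_gt0.
  have [j hj1 hj2] := pick h e' e'0.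
  have he1 : e' <= e / 2 by rewrite ge_min lexx.
  have he2 : e' * c <= e / 2.
    have : e' <= e / (2 * c) by rewrite ge_min lexx orbT.
    by rewrite ler_pdivlMr ?mulr_gt0 //; lra.
  have zh : mag (z + h - z) <= t by rewrite addrAC subrr add0r; apply: le_trans hh _; rewrite /q; lra.
  have h1 := Dlim (kj j) (z + h) (kj0 j) (kjle j) zh.
  have h2 := Dlim (kj j) z (kj0 j) (kjle j) zz.
  have h3 := T2 (kj j) h (kj0 j) (kjle j) hh.
  have h4 : C * mag v ^+ 2 * mag (kj j) <= C * mag v ^+ 2 * e'.
    by rewrite ler_wpM2l ?(ltW hj1) // mulr_ge0 ?sqr_ge0.
  apply: le_trans (approx_diff h1 h2 h3 (ltW hj2)) _.
  have h5 : C * mag v ^+ 2 * e' + C * mag v ^+ 2 * e' + e' = e' * c by rewrite /c; ring.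
  have h6 : e' * c <= e by apply: le_trans he2 _; rewrite ler_pdivrMr // ler_peMr ?ler1n // ltW.
  rewrite [leLHS](_ : _ = C2 * mag h ^+ 2 + (C * mag v ^+ 2 * mag (kj j) + C * mag v ^+ 2 * mag (kj j) + e')).
    by rewrite lerD2l; apply: le_trans h6; rewrite -h5; rewrite lerD2r; exact: lerD.
  by rewrite [RHS]addrC -!addrA; congr (_ + (_ + _)); exact: addrC.
have [d1 d2] : differentiable (fun y => 'd f y v) z /\ 'd (fun y => 'd f y v) z = dotf l0 :> (_ -> _).
  apply: mag_diff; first exact: dotf_continuous.
  move=> e e0; pose c := C2 + 1; have c0 : 0 < c by rewrite ltr_wpDl.
  exists (Num.min q (e / c)) => [|h]; first by rewrite lt_min q0 divr_gt0.
  rewrite lt_min => /andP[h1 h2]; apply: le_trans (T3 h (ltW h1)) _.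
  rewrite expr2 mulrA ler_wpM2r ?mag_ge0 //; rewrite ltr_pdivlMr // in h2.
  by apply: le_trans (ltW h2); rewrite mulrC ler_wpM2l ?mag_ge0 // /c lerDl.
split; first exact: d1.
move=> h e e0; have [j h1 h2] := pick h e e0; exists (kj j).
  by rewrite h1 mag_gt0 kj0.
have E : 'd (fun y => 'd f y v) z h = dotf l0 h := congr1 (@^~ h) d2.
have E2 := congr1 (@^~ h) (Ddiff (kj j) z (kj0 j) (kjle j) zz).2.
exact: (eq_ind_r (fun x => x < e) h2 (congr2 (fun a b : K => mag (a - b)) E (esym E2))).
Qed.

(** The left-hand side is a limit of the difference quotients [k^-1 * (g (z + k v) - g z)] of
    [g y = 'd f y u]; since [g] is itself differentiable, they tend to the right-hand side. *)
Lemma diff_partial_sym (n : nat) (f : 'rV[K]_n -> K) (z u v : 'rV[K]_n) (r : R) : 0 < r ->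
  (forall y, mag (y - z) < r -> differentiable f y) ->
  'd (fun y => 'd f y v) z u = 'd (fun y => 'd f y u) z v.
Proof.
move=> r0 df; have [_ H] := diff_of_partial v r0 df; have [du _] := diff_of_partial u r0 df.
set a := LHS; set b := RHS.
apply/eqP; rewrite -subr_eq0 -mag_eq0 eq_le mag_ge0 andbT; apply/ler_addgt0Pr => e e0.
rewrite add0r; pose c := mag v + 1; have c0 : 0 < c by rewrite ltr_wpDl // mag_ge0.
have ec0 : 0 < e / 2 / c by rewrite !divr_gt0.
have [d d0 hd] := diff_mag du ec0.
pose e' := Num.min (e / 2) (d / c).
have e'0 : 0 < e' by rewrite lt_min !divr_gt0.
have [k /andP[k0 k1] hk] := H u e' e'0.
have he1 : e' <= e / 2 by rewrite ge_min lexx.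
have he2 : e' <= d / c by rewrite ge_min lexx orbT.
have hkv : mag (k *: v) < d.
  rewrite magZ; have : mag k < d / c by apply: lt_le_trans he2.
  rewrite ltr_pdivlMr //; apply: le_lt_trans; apply: ler_wpM2l; first exact: mag_ge0.
  by rewrite /c lerDl.
have {hd} := hd _ hkv; have kn0 : k != 0 by rewrite -mag_gt0.
have E : 'd (fun y => 'd f y u) z (k *: v) = k * b by exact: linearZ.
have key (x y : K) : mag (x - y - k * b) <= e / 2 / c * mag (k *: v) ->
    mag (a - k^-1 * (x - y)) < e' -> mag (a - b) <= e.
  move=> h1 h2; have h3 : mag (k^-1 * (x - y) - b) <= e / 2.
    rewrite (_ : _ - _ = k^-1 * (x - y - k * b)); last by field.
    rewrite magM magV mulrC ler_pdivrMr //; apply: le_trans h1 _.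
    rewrite magZ mulrCA [leRHS]mulrC; apply: ler_wpM2l; first exact: mag_ge0.
    rewrite mulrAC ler_pdivrMr //; apply: ler_wpM2l; last by rewrite /c lerDl.
    by rewrite divr_ge0 // ltW.
  by apply: le_trans (mag_tri (k^-1 * (x - y)) _ _) _; lra.
move=> h1; apply: (key ('d f (z + k *: v) u) ('d f z u) _ hk).
exact: (eq_ind _ (fun x => mag ('d f (z + k *: v) u - 'd f z u - x) <= e / 2 / c * mag (k *: v)) h1 _ E).
Qed.

End SecondDerivatives.

(** * Liouville's theorem *)

Section Liouville.
Context {R : realType}.
Local Notation K := (Cplx R).
Context {V : normedModType K}.

(** For a function of linear growth, the Taylor estimate on a ball of radius [r] is of order [1 / r],
    and [r] is arbitrary. *)
Lemma entire_affine (f : V -> K) (A B : R) : 0 <= A -> 0 <= B ->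
  (forall v, differentiable f v) -> (forall v, mag (f v) <= A + B * mag v) ->
  forall v, f v = f 0 + 'd f 0 v.
Proof.
move=> A0 B0 df hf v.
apply/eqP; rewrite -subr_eq0 opprD addrA -mag_eq0 eq_le mag_ge0 andbT.
apply/ler_addgt0Pr => e e0; rewrite add0r.
pose C : R := 2 ^+ 13 * (A + B) * mag v ^+ 2.
have C0 : 0 <= C by apply: mulr_ge0 (sqr_ge0 _); apply: mulr_ge0 (addr_ge0 A0 B0); rewrite exprn_ge0.
pose r := 1 + 128 * mag v + C / e.
have v0 := mag_ge0 v; have Ce0 : 0 <= C / e by rewrite divr_ge0 // ltW.
have r1 : 1 <= r by rewrite /r; lra.
have r0 : 0 < r by lra.
have rv : mag v <= r / 128 by rewrite /r; lra.
have rC : C <= e * r.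
  have : C / e <= r by rewrite /r; lra.
  by rewrite ler_pdivrMr // mulrC.
have hM y : mag (y - 0 : V) <= r -> mag (f y) <= A + B * r.
  by rewrite subr0 => hy; apply: le_trans (hf y) _; rewrite lerD2l ler_wpM2l.
have := taylor2_mag r0 (fun y _ => df y) hM rv.
rewrite add0r => h; apply: le_trans h _.
rewrite mulrAC ler_pdivrMr ?exprn_gt0 //.
apply: (@le_trans _ _ (C * r)); last first.
  by rewrite expr2 mulrA ler_wpM2r // ltW.
rewrite /C [leRHS]mulrAC; apply: ler_wpM2r; first exact: sqr_ge0.
rewrite -[leRHS]mulrA; apply: ler_wpM2l; first by rewrite exprn_ge0.
by rewrite mulrDl lerD2r ler_peMr.
Qed.

Lemma entire_bounded (f : V -> K) (A : R) :
  (forall v, differentiable f v) -> (forall v, mag (f v) <= A) ->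
  forall v, f v = f 0.
Proof.
move=> df hf v.
have A0 : 0 <= A by apply: le_trans (mag_ge0 _) (hf 0).
have haff := entire_affine A0 (lexx 0) df.
have {}haff u : f u = f 0 + 'd f 0 u.
  by apply: haff => w; rewrite mul0r addr0; apply: hf.
suff h0 : 'd f 0 v = 0 by rewrite haff h0 addr0.
apply/eqP; rewrite -mag_eq0 eq_le mag_ge0 andbT; apply/ler_addgt0Pr => e e0.
rewrite add0r; pose k := (2 * A) / e + 1.
have k0 : 0 < k by rewrite ltr_wpDl // divr_ge0 ?mulr_ge0 // ltW.
have E : 'd f 0 (rc k *: v) = f (rc k *: v) - f 0 by rewrite (haff (rc k *: v)) addrAC subrr add0r.
have E2 : 'd f 0 (rc k *: v) = rc k * 'd f 0 v by exact: linearZ.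
have : mag (rc k * 'd f 0 v) <= 2 * A.
  rewrite -E2 E; apply: le_trans (magB _ _) _.
  by have := hf (rc k *: v); have := hf 0; lra.
rewrite magM mag_rc (gtr0_norm k0) => h.
have ke : 2 * A <= k * e by rewrite /k (mulrDl (2 * A / e)) divfK ?gt_eqF // mul1r lerDl ltW.
by rewrite -(ler_pM2l k0); apply: le_trans h ke.
Qed.

End Liouville.

(** * Orbit spaces *)

Section Subspaces.
Context {T : topologicalType} (A : set T).

Lemma open_set_val (U : set T) : open U -> open (set_val @^-1` U : set A).
Proof. by move=> oU; exists U. Qed.

Lemma set_val_continuous : continuous (set_val : A -> T).
Proof. by apply/continuousP => U; exact: open_set_val. Qed.

Lemma nbhs_set_val (x : A) (P : set A) : nbhs x P ->
  exists2 U : set T, open U /\ U (set_val x) & (set_val @^-1` U) `<=` P.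
Proof.
rewrite nbhsE => -[B [[U oU <-] Bx] BP]; exists U => //.
Qed.

Lemma set_valA (x : A) : A (set_val x).
Proof. by rewrite set_valE; case: x => x /= /set_mem. Qed.

Lemma set_type_hausdorff : hausdorff_space T -> hausdorff_space (set_type A).
Proof.
move=> hT x y cxy; apply: val_inj; rewrite -!set_valE.
apply: hT => P Q; rewrite !nbhsE => -[U [oU Ux] UP] [W [oW Wy] WQ].
have [z [Uz Wz]] := cxy (set_val @^-1` U) (set_val @^-1` W)
  (open_nbhs_nbhs (conj (open_set_val oU) Ux)) (open_nbhs_nbhs (conj (open_set_val oW) Wy)).
by exists (set_val z); split; [apply: UP | apply: WQ].
Qed.

Lemma set_type_second_countable : @second_countable T -> @second_countable (set_type A).
Proof.
move=> [B cB [oB bB]].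
exists [set (set_val @^-1` U : set A) | U in B].
  exact: sub_countable (card_image_le _ _) cB.
split=> [_ [U BU <-]|x P /nbhs_set_val[U [oU Ux] UP]].
  by apply: open_set_val; exact: oB.
have [W [BW Wx] WU] := bB (set_val x) U (open_nbhs_nbhs (conj oU Ux)).
exists (set_val @^-1` W); first by split; [exists W | exact: Wx].
by move=> y /= /WU; exact: UP.
Qed.

Lemma set_type_compact : compact A -> compact [set: set_type A].
Proof.
move=> cA F PF _.
have FA : (fmap (set_val : A -> T) F) A by apply: (@filterS _ F _ setT) filterT => x _; exact: set_valA.
have [x [Ax cx]] := cA _ (fmap_proper_filter (set_val : A -> T) PF) FA.
exists (exist _ x (mem_set Ax)); split=> // P Q FP /nbhs_set_val[U [oU Ux] UQ].
have FP' : fmap (set_val : A -> T) F (set_val @` P).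
  by apply: (@filterS _ F _ P) FP => y Py; exists y.
have [_ [[y Py <-] Uy]] := cx _ _ FP' (open_nbhs_nbhs (conj oU Ux)).
by exists y; split=> //; apply: UQ.
Qed.

End Subspaces.

Section OrbitSpace.
Context {V : topologicalType} {G : Type} (Y : set V) (act : G -> V -> V).

Definition orbit_of (z : V) : set V := [set w | exists g, act g z = w].

(** Points are the orbits themselves, as subsets of [V]; only orbits that meet [Y] are points. *)
Record orbit_space := OrbitSpace {
  orbit_set : set V;
  orbit_setP : exists2 z, Y z & orbit_set = orbit_of z }.

HB.instance Definition _ := gen_eqMixin orbit_space.
HB.instance Definition _ := gen_choiceMixin orbit_space.

(** This is the quotient topology, expressed without a projection: the union of the orbits in [U]
    is open. *)
Definition orbit_open (U : set orbit_space) : Prop :=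
  forall x z, U x -> orbit_set x = orbit_of z ->
    \forall w \near z, forall x', orbit_set x' = orbit_of w -> U x'.

Fact orbit_openT : orbit_open setT.
Proof. by move=> x z _ _; exact: nearW. Qed.

Fact orbit_openI : setI_closed orbit_open.
Proof.
move=> A B oA oB x z [Ax Bx] xz; have hA := oA x z Ax xz; have hB := oB x z Bx xz.
by apply: filterS2 hA hB => w h1 h2 x' xw; split; [exact: h1 | exact: h2].
Qed.

Fact orbit_open_bigU (I : Type) (f : I -> set orbit_space) :
  (forall i, orbit_open (f i)) -> orbit_open (\bigcup_i f i).
Proof.
move=> of_ x z [i _ fx] xz; apply: filterS (of_ i x z fx xz) => w h x' xw.
by exists i => //; exact: h.
Qed.

HB.instance Definition _ :=
  isOpenTopological.Build orbit_space orbit_openT orbit_openI orbit_open_bigU.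

Variable y0 : V.
Hypotheses (Yy0 : Y y0) (oY : open Y)
  (act_Y : forall g z, Y z -> Y (act g z))
  (act_id : exists g, forall z, act g z = z)
  (act_comp : forall g h, exists k, forall z, act k z = act h (act g z))
  (act_inv : forall g, exists h, forall z, act h (act g z) = z)
  (act_cts : forall g, continuous (act g)).

Lemma orbit_ofP z z' : orbit_of z = orbit_of z' <-> exists g, act g z = z'.
Proof.
have [e he] := act_id; split=> [E|[g <-]].
  have : orbit_of z' z' by exists e; exact: he.
  by rewrite -E.
apply/seteqP; split=> w [h <-].
  have [g' hg'] := act_inv g; have [k hk] := act_comp g' h.
  by exists k; rewrite hk hg'.
by have [k hk] := act_comp g h; exists k; rewrite hk.
Qed.

(* Outside of [Y] the value is the junk orbit of [y0]. *)
Definition orbit_map (z : V) : orbit_space :=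
  match pselect (Y z) with
  | left Yz => OrbitSpace (ex_intro2 _ _ z Yz erefl)
  | right _ => OrbitSpace (ex_intro2 _ _ y0 Yy0 erefl)
  end.

Lemma orbit_map_set z : Y z -> orbit_set (orbit_map z) = orbit_of z.
Proof. by rewrite /orbit_map; case: pselect. Qed.

Lemma orbit_set_inj : injective orbit_set.
Proof.
move=> [A pA] [B pB] /= AB; move: pA pB; rewrite AB => pA pB.
by rewrite (Prop_irrelevance pA pB).
Qed.

Lemma orbit_mapP z z' : Y z -> Y z' ->
  (orbit_map z = orbit_map z' <-> exists g, act g z = z').
Proof.
move=> Yz Yz'; rewrite -orbit_ofP -!orbit_map_set //.
by split=> [->//|]; exact: orbit_set_inj.
Qed.

Lemma orbit_map_surj x : exists2 z, Y z & orbit_map z = x.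
Proof.
have [z Yz xz] := orbit_setP x; exists z => //.
by apply: orbit_set_inj; rewrite orbit_map_set.
Qed.

Lemma orbit_map_continuous z : Y z -> {for z, continuous orbit_map}.
Proof.
move=> Yz P; rewrite nbhsE => -[U [oU Ux] UP].
have := oU _ z Ux (orbit_map_set Yz) => h.
have nY : nbhs z Y by apply: open_nbhs_nbhs.
apply: filterS2 h nY => w hw Yw /=; apply: UP; apply: hw.
exact: orbit_map_set.
Qed.

Lemma orbit_map_open (U : set V) : open U -> U `<=` Y -> open (orbit_map @` U).
Proof.
move=> oU UY; change (orbit_open (orbit_map @` U)) => x z [u Uu <-].
rewrite (orbit_map_set (UY _ Uu)) => /orbit_ofP[g gu].
have [h hg] := act_inv g.
have : nbhs z (act h @^-1` U).
  by apply: act_cts; rewrite -gu hg; exact: open_nbhs_nbhs.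
apply: filterS => w Uw x' xw; exists (act h w) => //.
apply: orbit_set_inj; rewrite xw (orbit_map_set (UY _ Uw)); apply/orbit_ofP.
by have [h' hh'] := act_inv h; exists h'.
Qed.

End OrbitSpace.

(** * The atlas of local inverses of a quotient map *)

Section OrbitAtlas.
Context {R : realType}.
Local Notation K := (Cplx R).
Local Notation iC := ('i%C : K).
Context {n : nat} {G : Type} {X : topologicalType}.
Local Notation V := 'rV[K]_n.
Variables (Y : set V) (act : G -> V -> V) (q : V -> X) (r : R).
Hypotheses (oY : open Y)
  (act_Y : forall g z, Y z -> Y (act g z))
  (act_diff : forall g z, differentiable (act g) z)
  (qP : forall z z', Y z -> Y z' -> (q z = q z' <-> exists g, act g z = z'))
  (q_surj : forall x, exists2 z, Y z & q z = x)
  (q_cts : forall z, Y z -> {for z, continuous q})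
  (q_open : forall U : set V, open U -> U `<=` Y -> open (q @` U))
  (r0 : 0 < r)
  (act_free : forall z0 z g, mag (z - z0) < r -> mag (act g z - z0) < r -> act g z = z)
  (act_proper : forall z z', Y z -> Y z' ->
     (forall e : R, 0 < e -> exists g u, mag (u - z) < e /\ mag (act g u - z') < e) ->
     exists g, act g z = z').

Lemma open_mag_ball (z : V) (e : R) : open [set u | mag (u - z) < e].
Proof.
rewrite openE => u /= hu; apply/nbhs_magP; exists (e - mag (u - z)); first by lra.
by move=> w hw; apply: le_lt_trans (mag_tri u _ _) _; lra.
Qed.

Definition qball (z : V) (e : R) : set V := [set u | Y u /\ mag (u - z) < e].

Lemma open_qball z e : open (qball z e).
Proof. exact: (openI oY (open_mag_ball (z := z) (e := e))). Qed.

Lemma qball_Y z e : qball z e `<=` Y. Proof. by move=> u []. Qed.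

Lemma qball_center z e : Y z -> 0 < e -> qball z e z.
Proof. by move=> Yz e0; split=> //; rewrite subrr mag0. Qed.

(** If the images of [z] and [z'] cannot be separated then some transformations move points
    arbitrarily close to [z] to points arbitrarily close to [z'], and properness applies. *)
Lemma quotient_hausdorff : hausdorff_space X.
Proof.
move=> x y; have [z Yz <-] := q_surj x; have [z' Yz' <-] := q_surj y => cxy.
apply/qP => //; apply: act_proper => // e e0.
have nb w : Y w -> nbhs (q w) (q @` qball w e).
  move=> Yw; apply: open_nbhs_nbhs; split.
    by apply: q_open; [exact: open_qball | exact: qball_Y].
  by exists w => //; exact: qball_center.
have [_ [[u [Yu hu] <-] [u' [Yu' hu'] uu']]] := cxy _ _ (nb _ Yz) (nb _ Yz').
have [g gu] := (qP Yu Yu').1 (esym uu').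
by exists g, u; rewrite gu.
Qed.

Let rat_pt (x y : 'rV[rat]_n) : V := \row_i (rc (ratr (x 0 i)) + iC * rc (ratr (y 0 i))).

Lemma rat_pt_dense (z : V) (e : R) : 0 < e -> exists x y, mag (z - rat_pt x y) < e.
Proof.
move=> e0; have approx (a : R) : exists p : rat, `|a - ratr p| < e / 2.
  have [p] := @rat_in_itvoo R (a - e / 2) (a + e / 2) ltac:(lra).
  rewrite in_itv /= => /andP[p1 p2]; exists p.
  by rewrite ltr_norml; apply/andP; split; lra.
have [x hx] := choice (fun i => approx (complex.Re (z 0 i))).
have [y hy] := choice (fun i => approx (complex.Im (z 0 i))).
exists (\row_i x i), (\row_i y i); apply: mag_rV_lt => // i; rewrite !mxE.
rewrite {1}(cplxE (z 0 i)).
rewrite (_ : _ - _ = rc (complex.Re (z 0 i) - ratr (x i)) + iC * rc (complex.Im (z 0 i) - ratr (y i))).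
  apply: le_lt_trans (magD _ _) _; rewrite magM mag_i mul1r !mag_rc.
  by have := hx i; have := hy i; lra.
by rewrite !rcB; ring.
Qed.

(** The images of the balls with rational centre and radius [1 / (k + 1)]. *)
Lemma quotient_second_countable : @second_countable X.
Proof.
pose c (i : 'rV[rat]_n * 'rV[rat]_n * nat) := q @` qball (rat_pt i.1.1 i.1.2) (i.2.+1%:R^-1).
exists [set c i | i in setT].
  exact: sub_countable (card_image_le _ _) (countableP _).
split=> [_ [i _ <-]|x P]; first by apply: q_open; [exact: open_qball | exact: qball_Y].
have [z Yz <-] := q_surj x => /(q_cts Yz) /nbhs_magP[d d0 hd].
have /nbhs_magP[d' d'0 hd'] : nbhs z Y by exact: open_nbhs_nbhs.
have [k hk] : exists k : nat, k.+1%:R^-1 < d / 2.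
  have h : 0 < 2 / d by rewrite divr_gt0.
  exists (Num.bound (2 / d)); rewrite -[ltRHS]invrK ltf_pV2 ?posrE ?invr_gt0 ?divr_gt0 //.
  rewrite invf_div; apply: lt_le_trans (archi_boundP (ltW h)) _.
  by rewrite ler_nat.
have k0 : 0 < (k.+1%:R^-1 : R) by rewrite invr_gt0.
have [a [b hab]] := rat_pt_dense z k0.
exists (c (a, b, k)) => /=.
  by split; [exists (a, b, k) | exists z].
move=> _ [u [Yu /= hu] <-]; apply: hd.
have h1 := lt_trans hu hk; have h2 := lt_trans hab hk.
by apply: le_lt_trans (mag_tri (rat_pt a b) _ _) _; rewrite (mag_distC (rat_pt a b)) (splitr d); exact: ltrD.
Qed.

Definition lift (z0 : V) (x : X) : V := get [set z | qball z0 r z /\ q z = x].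

Lemma lift_q z0 z : qball z0 r z -> lift z0 (q z) = z.
Proof.
move=> hz; have [Yz hz'] := hz.
have ex : exists z', [set z' | qball z0 r z' /\ q z' = q z] z' by exists z.
have [[Yl hl] /esym /(qP Yz Yl)[g gz]] := getPex ex; rewrite -/(lift z0 (q z)) in Yl hl gz *.
by rewrite -gz; apply: (@act_free z0); rewrite ?gz.
Qed.

(** The quotient map is injective on balls of radius [r], because there a transformation that keeps
    a point in the ball fixes it. *)
Definition qchart (z0 : V) : chart K X n := Chart (q @` qball z0 r) (lift z0) q.

Lemma qchart_img z0 : cimg (qchart z0) = qball z0 r.
Proof.
apply/seteqP; split=> [_ [_ [z hz <-] <-]|z hz]; first by rewrite /= lift_q.
by exists (q z) => /=; [exists z | rewrite lift_q].
Qed.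

Lemma qchart_is_chart z0 : is_chart (qchart z0).
Proof.
split.
- by apply: q_open; [exact: open_qball | exact: qball_Y].
- by rewrite qchart_img; exact: open_qball.
- by move=> _ [z hz <-] /=; rewrite lift_q.
- rewrite continuous_open_subspace; last first.
    by apply: q_open; [exact: open_qball | exact: qball_Y].
  move=> x; rewrite inE => -[z hz <-] P; rewrite /= lift_q // => nP.
  have nb : nbhs z (qball z0 r) := open_nbhs_nbhs (conj (@open_qball z0 r) hz).
  have : nbhs z (P `&` qball z0 r) by exact: filterI nP nb.
  rewrite nbhsE => -[W [oW Wz] WP].
  have oWq : open (q @` W) by apply: q_open => // u /WP[_ []].
  have : nbhs (q z) (q @` W) by apply: open_nbhs_nbhs; split=> //; exists z.
  by apply: filterS => _ [u /WP[Pu hu] <-] /=; rewrite lift_q.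
- rewrite continuous_open_subspace; last by rewrite qchart_img; exact: open_qball.
  by move=> z; rewrite inE qchart_img => -[Yz _]; exact: q_cts.
Qed.

Definition qatlas : set (chart K X n) := [set qchart z0 | z0 in setT].

(** In terms of the covering, a change of charts is locally one of the given transformations; this
    is why chart changes are holomorphic. *)
Lemma lift_act z1 z : Y z -> (q @` qball z1 r) (q z) ->
  exists g, qball z1 r (act g z) /\
    \forall y \near z, lift z1 (q y) = act g y.
Proof.
move=> Yz [z' hz' z'z]; have [Yz' _] := hz'.
have [g gz] := (qP Yz Yz').1 (esym z'z); exists g; rewrite gz; split=> //.
have nY : nbhs z Y by exact: open_nbhs_nbhs.
have nb : nbhs z (act g @^-1` qball z1 r).
  apply: (differentiable_continuous (act_diff g z)); rewrite gz.
  by apply: open_nbhs_nbhs; split; [exact: open_qball |].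
apply: filterS2 nY nb => y Yy /= hy; rewrite -(lift_q hy); congr lift.
by apply/qP => //; [exact: act_Y | exists g].
Qed.

Lemma qatlas_manifold : complex_manifold qatlas.
Proof.
split.
- exact: quotient_hausdorff.
- exact: quotient_second_countable.
- by move=> _ [z0 _ <-]; exact: qchart_is_chart.
- move=> x; have [z Yz <-] := q_surj x.
  by exists (qchart z); [exists z | exists z => //; exact: qball_center].
- move=> _ _ [z0 _ <-] [z1 _ <-] z [x [/= [u hu ux] h1] zE].
  have uz : u = z by rewrite -zE -ux lift_q.
  have xq : x = q z by rewrite -uz ux.
  have [Yu _] := hu; rewrite uz in Yu; rewrite xq in h1.
  have [g [_ hg]] := lift_act Yu h1.
  have hg' : \forall y \near z, act g y = (qchart z1 \o cinv (qchart z0)) y.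
    by apply: filterS hg => y /= ->.
  exact: (near_eq_diff hg' (act_diff g z)).1.
Qed.

End OrbitAtlas.

(** * The deck group *)

Section Family.
Context {R : realType}.
Local Notation K := (Cplx R).
Local Notation iC := ('i%C : K).
Local Notation V := 'rV[K]_5.

Definition co {n : nat} (z : 'rV[K]_n.+1) (k : nat) : K := z 0 (inord k).

Lemma coP {n : nat} (u v : 'rV[K]_n.+1) : (forall k, (k <= n)%N -> co u k = co v k) -> u = v.
Proof.
move=> h; apply/rowP => i; have := h i (leq_ord i).
by rewrite /co inord_val.
Qed.

Lemma coB {n : nat} (u v : 'rV[K]_n.+1) k : co (u - v) k = co u k - co v k.
Proof. by rewrite /co !mxE. Qed.
Lemma coD {n : nat} (u v : 'rV[K]_n.+1) k : co (u + v) k = co u k + co v k.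
Proof. by rewrite /co !mxE. Qed.
Lemma coZ {n : nat} a (v : 'rV[K]_n.+1) k : co (a *: v) k = a * co v k.
Proof. by rewrite /co !mxE. Qed.

Definition rowl {n : nat} (s : seq K) : 'rV[K]_n.+1 := \row_i s`_i.
Lemma co_rowl {n : nat} (s : seq K) k : (k <= n)%N -> co (rowl s : 'rV[K]_n.+1) k = s`_k.
Proof. by move=> kn; rewrite /co mxE inordK. Qed.

Lemma mag_co {n : nat} (v : 'rV[K]_n.+1) k : mag (co v k) <= mag v.
Proof. exact: mag_coord. Qed.

Lemma diff_co {n : nat} k (v : 'rV[K]_n.+1) : differentiable (co ^~ k) v.
Proof. exact: differentiable_coord. Qed.

Lemma diff_coE {n : nat} k (v : 'rV[K]_n.+1) : 'd (co ^~ k) v = co ^~ k :> ('rV[K]_n.+1 -> K).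
Proof.
have @f : {linear 'rV[K]_n.+1 -> K}.
  by exists (fun N : 'rV[K]_n.+1 => N 0 (inord k)); do 2![eexists]; do ?[constructor];
     rewrite ?mxE// => ? *; rewrite ?mxE//; move=> ?; rewrite !mxE.
exact: (@diff_lin K _ _ f v (@coord_continuous K 1 n.+1 0 (inord k))).
Qed.

Lemma diff_rowP {W : normedModType K} {n : nat} (f : W -> 'rV[K]_n) x :
  (forall i, differentiable (fun y => f y 0 i) x) -> differentiable f x.
Proof.
move=> h; have -> : f = \sum_(i < n) (fun y => f y 0 i *: delta_mx 0 i).
  by apply/funext => y; rewrite fct_sumE; exact: row_sum_delta.
by apply: differentiable_sum => i; exact: differentiableZl.
Qed.

(** An element of the deck group, a nilpotent group with underlying set [Z^8]: [(a_k, b_k)] are the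
    base translations [a_k + 2 i b_k] of [z0] and [z1], the [m_k] translations of the fiber
    coordinates [z2] and [z3]. *)
Record deck := Deck { da1 : int; db1 : int; da2 : int; db2 : int;
  dm1 : int; dm2 : int; dm3 : int; dm4 : int }.
Implicit Types g h : deck.

Definition itr (m : int) : K := m%:~R.

(** The term [i b^2] corrects [b z0] to a cocycle: translating [z0] by [2 i b'] contributes
    [2 i b b'], which is the difference between [i (b + b')^2] and [i b^2 + i b'^2]. *)
Definition fib1 g (z : V) : K := itr (db1 g) * co z 0 + iC * itr (db1 g) ^+ 2 + itr (dm1 g).
Definition fib2 g (z : V) : K := itr (db2 g) * co z 1 + iC * itr (db2 g) ^+ 2 + itr (dm2 g).

(** The pair [(fib1, fib2)] translates [(z2, z3)] along the vectors [(1, 0)] and [(i, t)], where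
    [t] is the last coordinate. These are linearly independent over the complex numbers exactly
    when [t] is not [0]. *)
Definition deck_act g (z : V) : V := rowl
  [:: co z 0 + itr (da1 g) + 2 * iC * itr (db1 g);
      co z 1 + itr (da2 g) + 2 * iC * itr (db2 g);
      co z 2 + fib1 g z + iC * fib2 g z;
      co z 3 + co z 4 * fib2 g z + itr (dm3 g) + iC * itr (dm4 g);
      co z 4].

Lemma act0 g z : co (deck_act g z) 0 = co z 0 + itr (da1 g) + 2 * iC * itr (db1 g).
Proof. by rewrite co_rowl. Qed.
Lemma act1 g z : co (deck_act g z) 1 = co z 1 + itr (da2 g) + 2 * iC * itr (db2 g).
Proof. by rewrite co_rowl. Qed.
Lemma act2 g z : co (deck_act g z) 2 = co z 2 + fib1 g z + iC * fib2 g z.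
Proof. by rewrite co_rowl. Qed.
Lemma act3 g z : co (deck_act g z) 3 =
  co z 3 + co z 4 * fib2 g z + itr (dm3 g) + iC * itr (dm4 g).
Proof. by rewrite co_rowl. Qed.
Lemma act4 g z : co (deck_act g z) 4 = co z 4.
Proof. by rewrite co_rowl. Qed.
Definition actE := (act0, act1, act2, act3, act4).

Lemma co5P (u v : V) : co u 0 = co v 0 -> co u 1 = co v 1 -> co u 2 = co v 2 ->
  co u 3 = co v 3 -> co u 4 = co v 4 -> u = v.
Proof. by move=> h0 h1 h2 h3 h4; apply: coP => -[|[|[|[|[|k]]]]]. Qed.

Lemma itrD m n : itr (m + n) = itr m + itr n. Proof. exact: intrD. Qed.
Lemma itrN m : itr (- m) = - itr m. Proof. exact: mulrNz. Qed.
Lemma itrM m n : itr (m * n) = itr m * itr n. Proof. exact: intrM. Qed.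
Lemma itr0 : itr 0 = 0. Proof. by []. Qed.
Definition itrE := (itrD, itrN, itrM, itr0).

Definition deck_id := Deck 0 0 0 0 0 0 0 0.
Definition deck_comp g h := Deck (da1 g + da1 h) (db1 g + db1 h) (da2 g + da2 h) (db2 g + db2 h)
  (dm1 g + dm1 h + db1 h * da1 g) (dm2 g + dm2 h + db2 h * da2 g)
  (dm3 g + dm3 h) (dm4 g + dm4 h).
Definition deck_inv g := Deck (- da1 g) (- db1 g) (- da2 g) (- db2 g)
  (- dm1 g + db1 g * da1 g) (- dm2 g + db2 g * da2 g) (- dm3 g) (- dm4 g).

Lemma deck_act_id z : deck_act deck_id z = z.
Proof. by apply: co5P; rewrite !actE /fib1 /fib2 /= ?itr0; ring. Qed.

Lemma deck_act_comp g h z : deck_act (deck_comp g h) z = deck_act h (deck_act g z).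
Proof. by apply: co5P; rewrite !actE /fib1 /fib2 /= ?actE ?itrE; ring. Qed.

Lemma deck_act_inv g z : deck_act (deck_inv g) (deck_act g z) = z.
Proof. by apply: co5P; rewrite !actE /fib1 /fib2 /= ?actE ?itrE; ring. Qed.

Lemma diff_fib1 g z : differentiable (fib1 g) z.
Proof.
apply: (differentiableD _ (differentiable_cst _ _)).
apply: (differentiableD _ (differentiable_cst _ _)).
exact: (differentiableM (differentiable_cst _ _) (diff_co _ _)).
Qed.
Lemma diff_fib2 g z : differentiable (fib2 g) z.
Proof.
apply: (differentiableD _ (differentiable_cst _ _)).
apply: (differentiableD _ (differentiable_cst _ _)).
exact: (differentiableM (differentiable_cst _ _) (diff_co _ _)).
Qed.

Lemma deck_act_diff g z : differentiable (deck_act g) z.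
Proof.
apply: diff_rowP => i.
have -> : (fun y => deck_act g y 0 i) = (fun y => co (deck_act g y) i).
  by apply/funext => y; rewrite /co inord_val.
case: i => -[|[|[|[|[|k]]]]] //= _.
- rewrite (_ : (fun y => _) = (fun y => co y 0 + itr (da1 g) + 2 * iC * itr (db1 g))); last first.
    by apply/funext => y; rewrite actE.
  apply: (differentiableD _ (differentiable_cst _ _)).
  exact: (differentiableD (diff_co _ _) (differentiable_cst _ _)).
- rewrite (_ : (fun y => _) = (fun y => co y 1 + itr (da2 g) + 2 * iC * itr (db2 g))); last first.
    by apply/funext => y; rewrite actE.
  apply: (differentiableD _ (differentiable_cst _ _)).
  exact: (differentiableD (diff_co _ _) (differentiable_cst _ _)).
- rewrite (_ : (fun y => _) = (fun y => co y 2 + fib1 g y + iC * fib2 g y)); last first.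
    by apply/funext => y; rewrite actE.
  apply: differentiableD; first exact: (differentiableD (diff_co _ _) (diff_fib1 _ _)).
  exact: (differentiableM (differentiable_cst _ _) (diff_fib2 _ _)).
- rewrite (_ : (fun y => _) = (fun y => co y 3 + co y 4 * fib2 g y + itr (dm3 g) + iC * itr (dm4 g))); last first.
    by apply/funext => y; rewrite actE.
  apply: (differentiableD _ (differentiable_cst _ _)).
  apply: (differentiableD _ (differentiable_cst _ _)).
  apply: (differentiableD (diff_co _ _)).
  exact: (differentiableM (diff_co _ _) (diff_fib2 _ _)).
- rewrite (_ : (fun y => _) = (fun y => co y 4)); last first.
    by apply/funext => y; rewrite actE.
  exact: diff_co.
Qed.

End Family.

(** * The total space and its projection to the disc *)

Section FamilyManifold.
Context {R : realType}.
Local Notation K := (Cplx R).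
Local Notation iC := ('i%C : K).
Local Notation V := 'rV[K]_5.
Implicit Types g h : deck.

Lemma itr_rc m : (itr m : K) = rc m%:~R. Proof. by rewrite rc_int. Qed.

Lemma int_small (m : int) : `|m%:~R : R| < 1 -> m = 0.
Proof.
rewrite -intr_norm -[1]/(1%:~R) ltr_int => h.
by apply/eqP; rewrite -normr_eq0 eq_le normr_ge0 andbT -ltzD1.
Qed.

Lemma gauss_small (m n k : int) : (0 < k)%R -> mag (itr m + itr k * iC * itr n : K) < 1 -> m = 0 /\ n = 0.
Proof.
move=> k0; have -> : itr m + itr k * iC * itr n = rc m%:~R + iC * rc (k * n)%:~R :> K.
  by rewrite !itr_rc intrM rcM; ring.
move=> h; split; apply: int_small.
  by apply: le_lt_trans h; rewrite -[X in `|X| <= _](Re_cplx m%:~R (k * n)%:~R); exact: mag_Re.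
have : `|(k * n)%:~R : R| < 1.
  by apply: le_lt_trans h; rewrite -[X in `|X| <= _](Im_cplx m%:~R (k * n)%:~R); exact: mag_Im.
move=> /int_small /eqP; rewrite mulf_eq0 (gt_eqF k0) /= => /eqP ->.
by rewrite normr0 ltr01.
Qed.

Lemma int_approx (x : R) : exists m : int, `|x + m%:~R| <= 1.
Proof.
exists (- Num.floor x); rewrite intrN ler_norml; apply/andP; split.
  by have := floor_le x; lra.
have := floorD1_gt x; rewrite intrD; lra.
Qed.

Lemma gauss_approx (x : K) (k : R) : 0 < k -> k <= 2 ->
  exists m n : int, mag (x + itr m + rc k * iC * itr n) <= 3.
Proof.
move=> k0 k2; have [m hm] := int_approx (complex.Re x).
have [n hn] := int_approx (complex.Im x / k); exists m, n.
have -> : x + itr m + rc k * iC * itr n =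
    rc (complex.Re x + m%:~R) + iC * rc (k * (complex.Im x / k + n%:~R)).
  rewrite mulrDr mulrCA divff ?gt_eqF // mulr1 !rcD rcM -!itr_rc {1}(cplxE x); ring.
apply: le_trans (magD _ _) _; rewrite magM mag_i mul1r !mag_rc normrM (gtr0_norm k0).
have : k * `|complex.Im x / k + n%:~R| <= 2 * 1 by apply: ler_pM => //; exact: ltW.
lra.
Qed.

Lemma deck_act_gamma g (z : V) :
  [/\ co (deck_act g z) 0 - co z 0 = itr (da1 g) + itr 2 * iC * itr (db1 g),
      co (deck_act g z) 1 - co z 1 = itr (da2 g) + itr 2 * iC * itr (db2 g),
      co (deck_act g z) 2 - co z 2 = fib1 g z + iC * fib2 g z &
      co (deck_act g z) 3 - co z 3 = co z 4 * fib2 g z + (itr (dm3 g) + itr 1 * iC * itr (dm4 g))].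
Proof.
have i2 : itr 2 = 2 :> K by [].
have i1 : itr 1 = 1 :> K by [].
by split; rewrite actE ?i2 ?i1; ring.
Qed.

(** Translation parts are Gaussian integers, with [2 i] in place of [i] for the base, so a
    displacement of modulus less than [1] makes them vanish. This applies to [z0] and [z1] first; then
    [fib1] and [fib2] are integers and it applies to [z2], then to [z3]. *)
Lemma deck_free (z0 z : V) g :
  mag (z - z0) < 1 / 2 -> mag (deck_act g z - z0) < 1 / 2 -> deck_act g z = z.
Proof.
move=> h1 h2.
have hk k : mag (co (deck_act g z) k - co z k) < 1.
  rewrite -coB; apply: le_lt_trans (mag_co _ _) _.
  apply: le_lt_trans (mag_tri z0 _ _) _; rewrite (mag_distC z0); lra.
have [g0 g1 g2 g3] := deck_act_gamma g z.
have := hk 0%N; rewrite g0 => /(@gauss_small _ _ 2 isT)[a1 b1].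
have := hk 1%N; rewrite g1 => /(@gauss_small _ _ 2 isT)[a2 b2].
have f1 : fib1 g z = itr (dm1 g) by rewrite /fib1 b1 itr0 expr0n /=; ring.
have f2 : fib2 g z = itr (dm2 g) by rewrite /fib2 b2 itr0 expr0n /=; ring.
have := hk 2%N; rewrite g2 f1 f2 (_ : iC * itr (dm2 g) = itr 1 * iC * itr (dm2 g)); last by rewrite mul1r.
move=> /(@gauss_small _ _ 1 isT)[m1 m2].
have := hk 3%N; rewrite g3 f2 m2 itr0 mulr0 add0r => /(@gauss_small _ _ 1 isT)[m3 m4].
by apply: co5P; rewrite !actE ?f1 ?f2 ?a1 ?b1 ?a2 ?b2 ?m1 ?m2 ?m3 ?m4 ?itr0; ring.
Qed.

Section Proper.
Variables (z z' : V).
Let S (e : R) g := exists u, mag (u - z) < e /\ mag (deck_act g u - z') < e.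

Let S_le e e' g : e <= e' -> S e g -> S e' g.
Proof.
by move=> h [u [h1 h2]]; exists u; split; apply: lt_le_trans h.
Qed.

(** Deck transformations that move some point close to [z] to a point close to [z'] have
    nearby, hence equal, translation parts as soon as their linear parts agree. *)
Lemma deck_separated (k : nat) (P : deck -> Prop) (gam : deck -> K) (phi : V -> K) :
  {for z, continuous phi} ->
  (forall g u, P g -> co (deck_act g u) k = phi u + gam g) ->
  exists2 e, 0 < e & forall g h, P g -> P h -> S e g -> S e h -> mag (gam g - gam h) < 1.
Proof.
move=> /cts_magP cphi E; have e4 : 0 < (4^-1 : R) by rewrite invr_gt0.
have [d d0 hd] := cphi _ e4; exists (Num.min d 4^-1); first by rewrite lt_min d0.
move=> g h Pg Ph [u [u1 u2]] [w [w1 w2]].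
have du : mag (phi u - phi z) < 4^-1.
  by apply: hd; apply: lt_le_trans u1 _; rewrite ge_min lexx.
have dw : mag (phi w - phi z) < 4^-1.
  by apply: hd; apply: lt_le_trans w1 _; rewrite ge_min lexx.
have bu : mag (co (deck_act g u) k - co z' k) < 4^-1.
  rewrite -coB; apply: le_lt_trans (mag_co _ _) _.
  by apply: lt_le_trans u2 _; rewrite ge_min lexx orbT.
have bw : mag (co (deck_act h w) k - co z' k) < 4^-1.
  rewrite -coB; apply: le_lt_trans (mag_co _ _) _.
  by apply: lt_le_trans w2 _; rewrite ge_min lexx orbT.
rewrite (E g u Pg) in bu; rewrite (E h w Ph) in bw.
rewrite (_ : gam g - gam h = (phi u + gam g - co z' k) - (phi w + gam h - co z' k)
   - (phi u - phi z) + (phi w - phi z)); last by ring.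
apply: le_lt_trans (magD _ _) _; apply: le_lt_trans (lerD (magB _ _) (lexx _)) _.
apply: le_lt_trans (lerD (lerD (magB _ _) (lexx _)) (lexx _)) _.
rewrite (_ : 1 = 4^-1 + 4^-1 + 4^-1 + 4^-1 :> R); last by field.
exact: ltrD (ltrD (ltrD bu bw) du) dw.
Qed.

(** Once the approximation is good enough, [deck_separated] applied to [z0] and [z1], then to [z2],
    then to [z3] determines the deck transformation; a single one then brings points
    arbitrarily close to [z] arbitrarily close to [z'], so it maps [z] to [z']. *)
Lemma deck_proper : (forall e, 0 < e -> exists g, S e g) -> exists g, deck_act g z = z'.
Proof.
move=> H.
have cco k : {for z, continuous (co ^~ k)} by exact: differentiable_continuous (diff_co k z).
have sub_gauss (m n m' n' : int) (k : int) : itr m + itr k * iC * itr n - (itr m' + itr k * iC * itr n') =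
    itr (m - m') + itr k * iC * itr (n - n') :> K by rewrite !itrE; ring.
have [e1 e10 H1] := @deck_separated 0 (fun _ => True)
   (fun g => itr (da1 g) + itr 2 * iC * itr (db1 g)) _ (cco 0%N)
   (fun g u _ => let: And4 a _ _ _ := deck_act_gamma g u in etrans (esym (subrKC _ _)) (congr1 _ a)).
have [e2 e20 H2] := @deck_separated 1 (fun _ => True)
   (fun g => itr (da2 g) + itr 2 * iC * itr (db2 g)) _ (cco 1%N)
   (fun g u _ => let: And4 _ a _ _ := deck_act_gamma g u in etrans (esym (subrKC _ _)) (congr1 _ a)).
pose E2 := Num.min e1 e2; have E20 : 0 < E2 by rewrite lt_min e10.
have {H1 H2}eq12 g h : S E2 g -> S E2 h ->
    [/\ da1 g = da1 h, db1 g = db1 h, da2 g = da2 h & db2 g = db2 h].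
  move=> Sg Sh.
  have l1 : E2 <= e1 by rewrite ge_min lexx.
  have l2 : E2 <= e2 by rewrite ge_min lexx orbT.
  have := H1 g h I I (S_le l1 Sg) (S_le l1 Sh); rewrite sub_gauss => /(@gauss_small _ _ 2 isT)[/subr0_eq ? /subr0_eq ?].
  by have := H2 g h I I (S_le l2 Sg) (S_le l2 Sh); rewrite sub_gauss => /(@gauss_small _ _ 2 isT)[/subr0_eq ? /subr0_eq ?].
have [g1 Sg1] := H E2 E20.
pose g1' := Deck (da1 g1) (db1 g1) (da2 g1) (db2 g1) 0 0 0 0.
have [e3 e30 H3] := @deck_separated 2
   (fun g => db1 g = db1 g1 /\ db2 g = db2 g1)
   (fun g => itr (dm1 g) + itr 1 * iC * itr (dm2 g))
   (fun u => co u 2 + fib1 g1' u + iC * fib2 g1' u)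
   (differentiable_continuous (differentiableD
      (differentiableD (diff_co 2 z) (diff_fib1 g1' z))
      (differentiableM (differentiable_cst iC z) (diff_fib2 g1' z))))
   ltac:(by move=> g u [h1 h2]; rewrite actE /fib1 /fib2 h1 h2 /= !itr0 (_ : itr 1 = 1) //; ring).
pose E3 := Num.min E2 e3; have E30 : 0 < E3 by rewrite lt_min E20.
have E32 : E3 <= E2 by rewrite ge_min lexx.
have {H3}eq3 g h : S E3 g -> S E3 h -> dm1 g = dm1 h /\ dm2 g = dm2 h.
  move=> Sg Sh; have l3 : E3 <= e3 by rewrite ge_min lexx orbT.
  have [_ b1 _ b2] := eq12 g g1 (S_le E32 Sg) Sg1.
  have [_ b1' _ b2'] := eq12 h g1 (S_le E32 Sh) Sg1.
  have := H3 g h (conj b1 b2) (conj b1' b2') (S_le l3 Sg) (S_le l3 Sh).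
  by rewrite sub_gauss => /(@gauss_small _ _ 1 isT)[/subr0_eq ? /subr0_eq ?].
have [g3 Sg3] := H E3 E30.
have [e4 e40 H4] := @deck_separated 3
   (fun g => db2 g = db2 g3 /\ dm2 g = dm2 g3)
   (fun g => itr (dm3 g) + itr 1 * iC * itr (dm4 g))
   (fun u => co u 3 + co u 4 * fib2 g3 u)
   (differentiable_continuous (differentiableD (diff_co 3 z)
      (differentiableM (diff_co 4 z) (diff_fib2 g3 z))))
   ltac:(by move=> g u [h1 h2]; rewrite actE /fib2 h1 h2 (_ : itr 1 = 1) //; ring).
pose E4 := Num.min E3 e4; have E40 : 0 < E4 by rewrite lt_min E30.
have E43 : E4 <= E3 by rewrite ge_min lexx.
have eq4 g h : S E4 g -> S E4 h -> g = h.
  move=> Sg Sh; have l4 : E4 <= e4 by rewrite ge_min lexx orbT.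
  have Sg' := S_le E43 Sg; have Sh' := S_le E43 Sh.
  have [a1 b1 a2 b2] := eq12 g h (S_le E32 Sg') (S_le E32 Sh').
  have [m1 m2] := eq3 g h Sg' Sh'.
  have [_ _ _ b2g] := eq12 g g3 (S_le E32 Sg') (S_le E32 Sg3).
  have [_ _ _ b2h] := eq12 h g3 (S_le E32 Sh') (S_le E32 Sg3).
  have [_ m2g] := eq3 g g3 Sg' Sg3; have [_ m2h] := eq3 h g3 Sh' Sg3.
  have := H4 g h (conj b2g m2g) (conj b2h m2h) (S_le l4 Sg) (S_le l4 Sh).
  rewrite sub_gauss => /(@gauss_small _ _ 1 isT)[/subr0_eq m3 /subr0_eq m4].
  by move: a1 b1 a2 b2 m1 m2 m3 m4; clear; case: g => ? ? ? ? ? ? ? ?; case: h => ? ? ? ? ? ? ? ? /=;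
    move=> -> -> -> -> -> -> -> ->.
have [g4 Sg4] := H E4 E40; exists g4.
apply/eqP; rewrite -subr_eq0 -mag_eq0 eq_le mag_ge0 andbT; apply/ler_addgt0Pr => e e0; rewrite add0r.
have /cts_magP cg := differentiable_continuous (deck_act_diff g4 z).
have e2' : 0 < e / 2 by rewrite divr_gt0.
have [d d0 hd] := cg _ e2'.
pose e' := Num.min (Num.min E4 d) (e / 2).
have e'0 : 0 < e' by rewrite lt_min e2' andbT lt_min E40 d0.
have [l1 l2 l3] : [/\ e' <= E4, e' <= d & e' <= e / 2].
  have h : e' <= Num.min E4 d by rewrite ge_min lexx.
  split; [apply: le_trans h _| apply: le_trans h _|]; by rewrite ge_min lexx ?orbT.
have [g Sg] := H e' e'0; have gg4 := eq4 g g4 (S_le l1 Sg) Sg4.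
move: Sg => [u [u1 u2]]; rewrite gg4 in u2.
have := hd u (lt_le_trans u1 l2); rewrite mag_distC => h1.
have h2 := lt_le_trans u2 l3.
by apply: le_trans (mag_tri (deck_act g4 u) _ _) _; rewrite (splitr e); apply: lerD; exact: ltW.
Qed.

End Proper.

(** Compactness of the fibers: the base translations bring [z0] and [z1] into a bounded region,
    then [m1], [m2] do so for [z2] and [m3], [m4] for [z3], without moving the coordinates already
    treated. *)
Lemma deck_reduce (z : V) : exists g, forall k, (k < 4)%N -> mag (co (deck_act g z) k) <= 3.
Proof.
have two0 : (0 : R) < 2 by []. have two2 : (2 : R) <= 2 by [].
have one0 : (0 : R) < 1 by []. have one2 : (1 : R) <= 2 by rewrite ler1n.
have [a1 [b1 h0]] := gauss_approx (co z 0) two0 two2.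
have [a2 [b2 h1]] := gauss_approx (co z 1) two0 two2.
pose g0 := Deck a1 b1 a2 b2 0 0 0 0.
have [m1 [m2 h2]] := gauss_approx (co z 2 + fib1 g0 z + iC * fib2 g0 z) one0 one2.
pose g1 := Deck a1 b1 a2 b2 m1 m2 0 0.
have [m3 [m4 h3]] := gauss_approx (co z 3 + co z 4 * fib2 g1 z) one0 one2.
exists (Deck a1 b1 a2 b2 m1 m2 m3 m4) => -[|[|[|[|k]]]] // _; rewrite actE.
- by move: h0; rewrite rc_nat.
- by move: h1; rewrite rc_nat.
- move: h2; rewrite rc1 mul1r; congr (mag _ <= _); rewrite /fib1 /fib2 /= itr0; ring.
- by move: h3; rewrite rc1 mul1r.
Qed.

Definition disc_dom : set V := [set z | mag (co z 4) < 1].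

Lemma open_disc_dom : open disc_dom.
Proof.
rewrite openE => z hz; apply/nbhs_magP; exists (1 - mag (co z 4)); first by rewrite subr_gt0.
move=> y hy; have h := le_lt_trans (mag_co (y - z) 4) hy; rewrite coB in h.
rewrite /disc_dom /=; have := mag_tri (co z 4) (co y 4) 0; rewrite !subr0 => h2.
by apply: le_lt_trans h2 _; lra.
Qed.

Lemma disc_dom0 : disc_dom 0. Proof. by rewrite /disc_dom /= /co mxE mag0 ltr01. Qed.

Lemma deck_act_dom g z : disc_dom z -> disc_dom (deck_act g z).
Proof. by rewrite /disc_dom /= act4. Qed.

Definition total_space := orbit_space disc_dom (@deck_act R).
Definition tot_map : V -> total_space := orbit_map (@deck_act R) disc_dom0.

Lemma tot_mapP z z' : disc_dom z -> disc_dom z' -> (tot_map z = tot_map z' <-> exists g, deck_act g z = z').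
Proof.
apply: orbit_mapP => [|g h|g].
- by exists deck_id => u; exact: deck_act_id.
- by exists (deck_comp g h) => u; exact: deck_act_comp.
- by exists (deck_inv g) => u; exact: deck_act_inv.
Qed.

Lemma tot_map_surj x : exists2 z, disc_dom z & tot_map z = x.
Proof. exact: orbit_map_surj. Qed.

Lemma tot_map_cts z : disc_dom z -> {for z, continuous tot_map}.
Proof. apply: orbit_map_continuous; exact: open_disc_dom. Qed.

Lemma tot_map_open (U : set V) : open U -> U `<=` disc_dom -> open (tot_map @` U).
Proof.
apply: orbit_map_open => [|g h|g|g z].
- by exists deck_id => u; exact: deck_act_id.
- by exists (deck_comp g h) => u; exact: deck_act_comp.
- by exists (deck_inv g) => u; exact: deck_act_inv.
- exact: differentiable_continuous (deck_act_diff g z).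
Qed.

Definition rad : R := 1 / 2.
Lemma rad0 : 0 < rad. Proof. by rewrite divr_gt0. Qed.

Definition tot_atlas : set (chart K total_space 5) := qatlas disc_dom tot_map rad.

Lemma tot_manifold : complex_manifold tot_atlas.
Proof.
apply: (qatlas_manifold open_disc_dom deck_act_dom deck_act_diff tot_mapP tot_map_surj
  tot_map_cts tot_map_open rad0 deck_free) => z z' _ _; exact: deck_proper.
Qed.

Definition tot_proj (x : total_space) : K := co (get [set z | disc_dom z /\ tot_map z = x]) 4.

Lemma tot_projE z : disc_dom z -> tot_proj (tot_map z) = co z 4.
Proof.
move=> Yz; have ex : exists z', [set z' | disc_dom z' /\ tot_map z' = tot_map z] z' by exists z.
have [Yl /(tot_mapP Yl Yz)[g gz]] := getPex ex.
by rewrite -[X in _ = co X _]gz act4.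
Qed.

Lemma unit_discE (t : K) : unit_disc t <-> mag t < 1.
Proof. by rewrite /unit_disc /= magE -rc1 rc_lt. Qed.

Lemma tot_proj_disc x : unit_disc (tot_proj x).
Proof. by have [z Yz <-] := tot_map_surj x; apply/unit_discE; rewrite tot_projE. Qed.

Lemma tot_proj_diff z : disc_dom z ->
  differentiable (tot_proj \o tot_map) z /\ 'd (tot_proj \o tot_map) z = co ^~ 4 :> (V -> K).
Proof.
move=> Yz; have h : \forall y \near z, co y 4 = (tot_proj \o tot_map) y.
  have nY : nbhs z disc_dom by apply: open_nbhs_nbhs; split; [exact: open_disc_dom|].
  by apply: filterS nY => y Yy /=; rewrite tot_projE.
have [d1 d2] := near_eq_diff h (diff_co 4 z); split; first exact: d1.
apply: (etrans d2); exact: diff_coE.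
Qed.

Lemma tot_holomorphic : holomorphic_function tot_atlas tot_proj.
Proof.
move=> _ [z0 _ <-] z; rewrite (qchart_img tot_mapP deck_free) => -[Yz _].
exact: (tot_proj_diff Yz).1.
Qed.

Lemma tot_submersion : submersion tot_atlas tot_proj.
Proof.
move=> _ z [z0 _ <-]; rewrite (qchart_img tot_mapP deck_free) => -[Yz _] w.
exists (rowl [:: 0; 0; 0; 0; w]).
apply: (etrans (congr1 (@^~ _) (tot_proj_diff Yz).2)).
by rewrite co_rowl.
Qed.

Lemma tot_proper : proper_to_disc tot_proj.
Proof.
move=> B cB Bd; have [A [cA hA]] := @compact_square R 3.
pose C : set V := [set v | forall i : 'I_5, (if (i < 4)%N then A else B) (v ord0 i)].
have cC : compact C.
  by apply: (@rV_compact K 5 (fun i : 'I_5 => if (i < 4)%N then A else B)) => i; case: ifP.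
have CY : C `<=` disc_dom.
  by move=> v /(_ (inord 4)); rewrite inordK //= => /Bd /unit_discE.
have -> : tot_proj @^-1` B = tot_map @` C.
  apply/seteqP; split=> [x|_ [v Cv <-]] /=.
    have [z Yz <-] := tot_map_surj x; rewrite tot_projE // => Bz.
    have [g hg] := deck_reduce z.
    exists (deck_act g z); last first.
      by apply/esym/(tot_mapP Yz (deck_act_dom g Yz)); exists g.
    move=> i; case: ifP => i4.
      by apply: hA; have := hg i i4; rewrite /co inord_val.
    have -> : i = inord 4.
      apply/val_inj; rewrite /= inordK //; have := ltn_ord i; move/negbT: i4; rewrite -leqNgt ltnS => h1 h2.
      by apply/eqP; rewrite eqn_leq h1 h2.
    by have := act4 g z; rewrite /co => ->.
  by rewrite tot_projE; [have := Cv (inord 4); rewrite inordK | exact: CY].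
apply: continuous_compact cC; apply: continuous_in_subspaceT => v; rewrite inE => /CY.
exact: tot_map_cts.
Qed.

Lemma tot_family : holomorphic_family tot_atlas tot_proj.
Proof.
split; [exact: tot_manifold | exact: tot_proj_disc | exact: tot_holomorphic
  | exact: tot_submersion | exact: tot_proper].
Qed.

End FamilyManifold.

(** * Lifting through immersions *)

Section Immersions.
Context {R : realType}.
Local Notation K := (Cplx R).

Lemma linear_rV_bound {n : nat} {W : normedModType K} (P : {linear 'rV[K]_n -> W}) :
  exists2 C : R, 0 <= C & forall u, mag (P u) <= C * mag u.
Proof.
exists (\sum_i mag (P (delta_mx 0 i))); first by apply: sumr_ge0 => i _; exact: mag_ge0.
move=> u; rewrite {1}(row_sum_delta u) linear_sum; apply: le_trans (mag_sum _ _) _.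
rewrite mulr_suml; apply: ler_sum => i _.
by rewrite linearZ /= magZ mulrC; apply: ler_wpM2l (mag_coord _ _); exact: mag_ge0.
Qed.

Lemma linear_rV_continuous {n : nat} {W : normedModType K} (P : {linear 'rV[K]_n -> W}) :
  continuous P.
Proof.
have [C C0 hC] := linear_rV_bound P.
move=> v; apply/cts_magP => e e0; have k0 : 0 < C + 1 by lra.
exists (e / (C + 1)) => [|u]; first by rewrite divr_gt0.
rewrite ltr_pdivlMr // => hu; rewrite -linearB; apply: le_lt_trans (hC _) _.
by apply: le_lt_trans hu; rewrite mulrC; apply: (ler_wpM2l (mag_ge0 _)); rewrite lerDl.
Qed.

Lemma linear_left_inverse {m n : nat} (L : {linear 'rV[K]_m -> 'rV[K]_n}) : injective L ->
  exists P : {linear 'rV[K]_n -> 'rV[K]_m}, forall u, P (L u) = u.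
Proof.
move=> iL; pose A := lin1_mx L.
have fA : row_free A.
  by apply/inj_row_free => v; rewrite mul_rV_lin1 => h; apply: iL; rewrite h linear0.
exists (mulmxr (pinvmx A)) => u; by rewrite /= -(mul_rV_lin1 L) -mulmxA mulmxVp // mulmx1.
Qed.

(** A left inverse [P] of the differential of the immersion [F] at [phi z] recovers the increment
    [k] of [phi] from that of [F \o phi], up to an error [eF * mag k]. Continuity of [phi] makes
    [eF] small, so [k] is bounded by a multiple of the increment of the variable, and with this
    bound the error becomes negligible. This makes chart changes between arbitrary charts of a fiber holomorphic. *)
Lemma immersion_lift {l m n : nat} (phi : 'rV[K]_l -> 'rV[K]_m) (F : 'rV[K]_m -> 'rV[K]_n)
    (H : 'rV[K]_l -> 'rV[K]_n) (z : 'rV[K]_l) :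
  {for z, continuous phi} -> differentiable F (phi z) -> injective ('d F (phi z)) ->
  differentiable H z -> (\forall y \near z, F (phi y) = H y) -> differentiable phi z.
Proof.
move=> cphi dF iF dH E.
have [P PK] := linear_left_inverse iF.
have [C C0 hC] := linear_rV_bound P.
have [B B0 hB] := linear_rV_bound ('d H z).
pose C1 := C + 1; have C10 : 0 < C1 by rewrite /C1; lra.
have hC1 u : mag (P u) <= C1 * mag u.
  by apply: le_trans (hC u) _; apply: (ler_wpM2r (mag_ge0 _)); rewrite /C1; lra.
have /nbhs_magP[d1 d10 hd1] := E.
have Ez : F (phi z) = H z by apply: hd1; rewrite subrr mag0.
refine (proj1 (@mag_diff R _ _ phi z (P \o 'd H z) _ _)).
  move=> x; apply: continuous_comp; first exact: diff_continuous.
  exact: linear_rV_continuous.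
move=> e e0.
pose D := 2 * C1 * (B + 1).
have D0 : 0 < D by apply: mulr_gt0; [rewrite mulr_gt0 | lra].
(* [eF] is the tolerance for [F] and [eH] that for [H]. *)
pose eF := Num.min (1 / (2 * C1)) (e / (2 * C1 * D)).
have c1 : 0 < 2 * C1 by rewrite mulr_gt0.
have c2 : 0 < 2 * C1 * D by rewrite mulr_gt0.
have eF0 : 0 < eF by rewrite lt_min; apply/andP; split; rewrite divr_gt0.
have eF1 : C1 * eF <= 1 / 2.
  have : eF <= 1 / (2 * C1) by rewrite ge_min lexx.
  by rewrite (ler_pdivlMr _ _ c1); lra.
have eF2 : C1 * eF * D <= e / 2.
  have : eF <= e / (2 * C1 * D) by rewrite ge_min lexx orbT.
  by rewrite (ler_pdivlMr _ _ c2) => h; rewrite ler_pdivlMr //; apply: le_trans h; rewrite le_eqVlt; apply/orP; left; apply/eqP; ring.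
pose eH := Num.min 1 (e / (2 * C1)).
have eH0 : 0 < eH by rewrite lt_min ltr01 divr_gt0.
have eH1 : eH <= 1 by rewrite ge_min lexx.
have eH2 : C1 * eH <= e / 2.
  have : eH <= e / (2 * C1) by rewrite ge_min lexx orbT.
  by rewrite (ler_pdivlMr _ _ c1); lra.
have [d2 d20 hd2] := diff_mag dF eF0.
have [d3 d30 hd3] := (cts_magP _ _).1 cphi d2 d20.
have [d4 d40 hd4] := diff_mag dH eH0.
exists (Num.min (Num.min d1 d3) d4); first by rewrite !lt_min d10 d30.
move=> h; rewrite !lt_min => /andP[/andP[h1 h3] h4].
have zh : z + h - z = h by rewrite addrAC subrr add0r.
have Eh : F (phi (z + h)) = H (z + h) by apply: hd1; rewrite zh.
pose k := phi (z + h) - phi z.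
have kE : phi z + k = phi (z + h) by rewrite /k addrC subrK.
have kd : mag k < d2 by apply: hd3; rewrite zh.
have r1 := hd2 k kd; rewrite kE Eh Ez in r1.
have r2 := hd4 h h4.
set u := H (z + h) - H z in r1 r2.
have kP : k - P ('d H z h) = P (u - 'd H z h) - P (u - 'd F (phi z) k).
  have zl (a b c : 'rV[K]_m) : a - b = c - b - (c - a) by rewrite opprB [RHS]addrC addrA subrK.
  by rewrite (linearB P u ('d H z h)) (linearB P u ('d F (phi z) k)) PK; exact: zl.
have s1 : mag (k - P ('d H z h)) <= C1 * (eH * mag h) + C1 * (eF * mag k).
  rewrite kP; apply: le_trans (magB _ _) _; apply: lerD; apply: le_trans (hC1 _) _.
    by apply: ler_wpM2l r2; exact: ltW.
  by apply: ler_wpM2l r1; exact: ltW.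
have m0 := mag_ge0 h; have k0 := mag_ge0 k.
have s2 : mag k <= D * mag h.
  have t1 : mag (P ('d H z h)) <= C1 * (B * mag h).
    by apply: le_trans (hC1 _) _; apply: ler_wpM2l (hB h); exact: ltW.
  have t2 : C1 * (eH * mag h) <= C1 * (1 * mag h).
    by apply: ler_wpM2l; [exact: ltW | apply: ler_wpM2r].
  have t3 : C1 * (eF * mag k) <= 1 / 2 * mag k by rewrite mulrA; apply: ler_wpM2r.
  have t4 := mag_sub k (P ('d H z h)).
  rewrite (_ : D * mag h = 2 * (C1 * (1 * mag h) + C1 * (B * mag h))); last by rewrite /D; ring.
  move: s1 t1 t2 t3 t4; move: (mag (P _)) (mag (k - _)) (C1 * (eH * _)) (C1 * (1 * _))
    (C1 * (B * _)) (C1 * (eF * _)) => *; lra.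
apply: le_trans s1 _.
have t1 : C1 * (eH * mag h) <= e / 2 * mag h by rewrite mulrA; apply: ler_wpM2r.
have t2 : C1 * (eF * mag k) <= e / 2 * mag h.
  apply: (@le_trans _ _ (C1 * (eF * (D * mag h)))).
    by apply: ler_wpM2l; [exact: ltW | apply: ler_wpM2l => //; exact: ltW].
  rewrite (_ : C1 * (eF * (D * mag h)) = C1 * eF * D * mag h); last by ring.
  by apply: ler_wpM2r.
by rewrite (_ : e * mag h = e / 2 * mag h + e / 2 * mag h); [exact: lerD | field].
Qed.

Lemma near_left_inverse_inj {V W : normedModType K} (f : V -> W) (g : W -> V) (z : V) :
  differentiable f z -> differentiable g (f z) -> (\forall y \near z, g (f y) = y) ->
  injective ('d f z).
Proof.
move=> df dg E.
have E' : \forall y \near z, id y = (g \o f) y by apply: filterS E => y /= ->.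
have [_ h] := near_eq_diff E' (ex_diff : differentiable id z).
have hid u : 'd g (f z) ('d f z u) = u.
  have e1 := congr1 (@^~ u) (diff_comp df dg).
  have e2 := congr1 (@^~ u) h.
  have e3 : 'd id z u = u by case: (is_diff_id z) => _ ->.
  exact: (etrans (esym e1) (etrans e2 e3)).
by move=> u v uv; rewrite -(hid u) -(hid v) uv.
Qed.

End Immersions.

(** * The fibers *)

Section Fibers.
Context {R : realType}.
Local Notation K := (Cplx R).
Local Notation V := 'rV[K]_5.
Local Notation W := 'rV[K]_4.

Definition forget (z : V) : W := rowl [:: co z 0; co z 1; co z 2; co z 3].
Definition incl (t : K) (w : W) : V := rowl [:: co w 0; co w 1; co w 2; co w 3; t].

Lemma forgetE z k : (k < 4)%N -> co (forget z) k = co z k.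
Proof. by rewrite /forget => k4; rewrite co_rowl //; case: k k4 => [|[|[|[|k]]]]. Qed.
Lemma inclE t w k : (k < 4)%N -> co (incl t w) k = co w k.
Proof. by rewrite /incl => k4; rewrite co_rowl ?(ltnW k4) //; case: k k4 => [|[|[|[|k]]]]. Qed.
Lemma incl4 t w : co (incl t w) 4 = t.
Proof. by rewrite /incl co_rowl. Qed.

Lemma forget_incl t w : forget (incl t w) = w.
Proof. by apply: coP => k k4; rewrite forgetE ?inclE. Qed.
Lemma incl_forget z : incl (co z 4) (forget z) = z.
Proof.
apply: coP => k; rewrite leq_eqVlt => /orP[/eqP ->|k4]; first by rewrite incl4.
by rewrite inclE ?forgetE.
Qed.

Lemma diff_incl t w : differentiable (incl t) w.
Proof.
apply: diff_rowP => i; rewrite (_ : (fun y => _) = (fun y => co (incl t y) i)); last first.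
  by apply/funext => y; rewrite /co inord_val.
have [i4|i4] := ltnP i 4.
  rewrite (_ : (fun y => _) = (co ^~ i)); first exact: diff_co.
  by apply/funext => y; rewrite inclE.
rewrite (_ : (fun y => _) = cst t); first exact: differentiable_cst.
have -> : (i : nat) = 4%N by apply/eqP; rewrite eqn_leq i4 andbT -ltnS ltn_ord.
by apply/funext => y; rewrite incl4.
Qed.

Lemma diff_forget z : differentiable forget z.
Proof.
apply: diff_rowP => i; rewrite (_ : (fun y => _) = (co ^~ i)); first exact: diff_co.
by apply/funext => y; rewrite -[RHS]forgetE // /co inord_val.
Qed.

Lemma mag_forget z z' : mag (forget z - forget z') <= mag (z - z').
Proof.
apply: mag_rV_le; first exact: mag_ge0.
move=> i; have := mag_co (z - z') i; rewrite coB -!forgetE // -coB.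
by rewrite /co inord_val.
Qed.

Lemma mag_incl t w w' : mag (incl t w - incl t w') <= mag (w - w').
Proof.
apply: mag_rV_le; first exact: mag_ge0.
have E (u : V) (i : 'I_5) : u 0 i = co u i by rewrite /co inord_val.
move=> i; rewrite E coB.
have [i4|i4] := ltnP i 4; first by rewrite !inclE // -coB mag_co.
have -> : (i : nat) = 4%N by apply/eqP; rewrite eqn_leq i4 andbT -ltnS ltn_ord.
by rewrite !incl4 subrr mag0 mag_ge0.
Qed.

Variables (t : K) (t1 : mag t < 1).
Local Notation F := (fiber (@tot_proj R) t).

Lemma incl_dom w : disc_dom (incl t w).
Proof. by rewrite /disc_dom /= incl4. Qed.

Lemma tot_proj_incl w : (tot_proj @^-1` [set t]) (tot_map (incl t w)).
Proof. by rewrite /= (tot_projE (incl_dom w)) incl4. Qed.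

Definition fib_map (w : W) : F := exist _ (tot_map (incl t w)) (mem_set (tot_proj_incl w)).

Lemma fib_mapE w : set_val (fib_map w) = tot_map (incl t w).
Proof. by rewrite set_valE. Qed.

Lemma fib_map_lift (x : F) (z : V) : disc_dom z -> set_val x = tot_map z ->
  z = incl t (forget z) /\ x = fib_map (forget z).
Proof.
move=> Yz xz; have z4 : co z 4 = t.
  by rewrite -(tot_projE Yz) -xz; exact: set_valA x.
have E : z = incl t (forget z) by rewrite -z4 incl_forget.
split=> //; apply: val_inj; rewrite -!set_valE fib_mapE -E; exact: xz.
Qed.

Lemma fib_map_surj (x : F) : exists w, fib_map w = x.
Proof.
have [z Yz zx] := tot_map_surj (set_val x).
by exists (forget z); rewrite -(fib_map_lift Yz (esym zx)).2.
Qed.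

Definition tlift (z0 : V) (x : total_space) : V := lift disc_dom (@tot_map R) rad z0 x.
Definition tball (z0 : V) : set V := qball disc_dom z0 rad.

(** The slice with last coordinate [t] in a chart of the total space. *)
Definition fib_chart (w0 : W) : chart K F 4 :=
  Chart (set_val @^-1` (@tot_map R @` tball (incl t w0)))
    (fun x => forget (tlift (incl t w0) (set_val x))) fib_map.

Lemma tball_incl w0 w : tball (incl t w0) (incl t w) <-> mag (w - w0) < rad.
Proof.
split=> [[_ h]|h].
  have := mag_forget (incl t w) (incl t w0); rewrite !forget_incl => h'.
  exact: le_lt_trans h' h.
by split; [exact: incl_dom | exact: le_lt_trans (mag_incl _ _ _) h].
Qed.

Lemma tlift_map z0 z : tball z0 z -> tlift z0 (tot_map z) = z.
Proof. exact: (lift_q tot_mapP deck_free). Qed.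

Lemma fib_chart_dom w0 x : cdom (fib_chart w0) x ->
  exists2 w, mag (w - w0) < rad & x = fib_map w.
Proof.
move=> [z hz zx]; have [E1 E2] := fib_map_lift (@qball_Y _ _ _ _ _ _ hz) (esym zx).
exists (forget z) => //; apply/tball_incl; rewrite -E1; exact: hz.
Qed.

Lemma fib_chart_dom_map w0 w : mag (w - w0) < rad -> cdom (fib_chart w0) (fib_map w).
Proof. by move=> h; rewrite /= fib_mapE; exists (incl t w) => //; apply/tball_incl. Qed.

Lemma fib_chart_map w0 w : mag (w - w0) < rad -> fib_chart w0 (fib_map w) = w.
Proof. by move=> h; rewrite /= fib_mapE tlift_map ?forget_incl //; apply/tball_incl. Qed.

Lemma fib_chart_img w0 : cimg (fib_chart w0) = [set w | mag (w - w0) < rad].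
Proof.
apply/seteqP; split=> [_ [x /fib_chart_dom[w hw ->] <-]|w hw].
  by rewrite fib_chart_map.
by exists (fib_map w); [exact: fib_chart_dom_map | exact: fib_chart_map].
Qed.

Lemma fib_map_continuous : continuous fib_map.
Proof.
move=> w P /nbhs_set_val[U [oU Ux] UP].
have : nbhs w ((@tot_map R \o incl t) @^-1` U).
  have c1 : {for w, continuous (@tot_map R \o incl t)}.
    apply: continuous_comp; last exact: (tot_map_cts (incl_dom w)).
    exact: differentiable_continuous (diff_incl t w).
  rewrite fib_mapE in Ux.
  exact: c1 (open_nbhs_nbhs (conj oU Ux)).
by apply: filterS => u Uu; apply: UP; rewrite /= fib_mapE.
Qed.

Lemma open_tot_ball z0 : open (@tot_map R @` tball z0).
Proof.
apply: tot_map_open; last exact: qball_Y.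
exact: (open_qball open_disc_dom).
Qed.

Lemma fib_chart_is_chart w0 : is_chart (fib_chart w0).
Proof.
have oD : open (cdom (fib_chart w0)) by apply: open_set_val; exact: open_tot_ball.
have oI : open (cimg (fib_chart w0)) by rewrite fib_chart_img; exact: open_mag_ball.
split=> //.
- by move=> x /fib_chart_dom[w hw ->]; rewrite fib_chart_map.
- rewrite continuous_open_subspace // => x; rewrite inE => hx.
  apply: (@continuous_comp F _ _ set_val (fun y => forget (tlift (incl t w0) y))); first exact: set_val_continuous.
  apply: (@continuous_comp _ _ _ (tlift (incl t w0)) forget); last first.
    exact: differentiable_continuous (diff_forget _).
  have [_ _ _ + _] := qchart_is_chart open_disc_dom tot_mapP (@tot_map_cts R) (@tot_map_open R) deck_free (incl t w0).
  rewrite continuous_open_subspace; last exact: open_tot_ball.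
  by apply; rewrite inE.
- by apply: continuous_subspaceT; exact: fib_map_continuous.
Qed.

(** In a chart of the total space, the fiber is locally a deck transformation applied
    to a slice with constant last coordinate. *)
Lemma tot_chart_fib z1 w : (@tot_map R @` tball z1) (tot_map (incl t w)) ->
  exists g, tball z1 (deck_act g (incl t w)) /\
   \forall y \near w, tlift z1 (tot_map (incl t y)) = deck_act g (incl t y).
Proof.
move=> h; have [g [h1 h2]] := lift_act open_disc_dom deck_act_dom deck_act_diff tot_mapP deck_free (incl_dom w) h.
exists g; split=> //.
exact: (differentiable_continuous (diff_incl t w)) h2.
Qed.

Lemma fib_chart_atlas w0 : fiber_atlas tot_atlas (@tot_proj R) t 4 (fib_chart w0).
Proof.
split; first exact: fib_chart_is_chart.
move=> _ [z1 _ <-] /= .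
have loc (w : W) : (fib_chart w0 @` (cdom (fib_chart w0) `&` set_val @^-1` cdom (qchart disc_dom (@tot_map R) rad z1))) w ->
    exists g, \forall y \near w, deck_act g (incl t y) = (qchart disc_dom (@tot_map R) rad z1 \o set_val \o cinv (fib_chart w0)) y.
  move=> [x [/fib_chart_dom[u hu ->] h1] <-]; rewrite fib_chart_map //.
  have [|g [_ hg]] := @tot_chart_fib z1 u; first by rewrite -fib_mapE.
  by exists g; apply: filterS hg => y /= <-; rewrite fib_mapE.
have D g w : differentiable (deck_act g \o incl t) w.
  by apply: differentiable_comp; [exact: diff_incl | exact: deck_act_diff].
split=> w /loc[g hg].
  exact: (near_eq_diff hg (D g w)).1.
rewrite (near_eq_diff hg (D g w)).2.
apply: (@near_left_inverse_inj _ _ _ _ (forget \o deck_act (deck_inv g))); first exact: D.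
  by apply: differentiable_comp; [exact: deck_act_diff | exact: diff_forget].
apply/nbhs_magP; exists 1; first exact: ltr01.
by move=> y _ /=; rewrite deck_act_inv forget_incl.
Qed.

Lemma fiber_compact : compact [set: F].
Proof.
apply: set_type_compact; apply: tot_proper; first exact: compact_set1.
by move=> _ ->; apply/unit_discE.
Qed.

(** A change between two charts of the fiber atlas is continuous, and its composite with the
    immersion given by the second chart is the immersion given by the first. *)
Lemma fiber_manifold : complex_manifold (fiber_atlas tot_atlas (@tot_proj R) t 4).
Proof.
have [hX sX _ covX _] := @tot_manifold R.
split.
- exact: set_type_hausdorff.
- exact: set_type_second_countable.
- by move=> c [].
- move=> x; have [w <-] := fib_map_surj x; exists (fib_chart w); first exact: fib_chart_atlas.
  by apply: fib_chart_dom_map; rewrite subrr mag0 rad0.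
move=> c d [cc hc] [cd hd] _ [x [xc xd] <-].
have [a Aa xa] := covX (set_val x).
have [oc oic cK c_cts ci_cts] := cc; have [od oid dK d_cts di_cts] := cd.
have [hc1 _] := hc a Aa; have [hd1 hd2] := hd a Aa.
have cx : cinv c (c x) = x := cK x xc.
have ci : {for c x, continuous (cinv c)}.
  by move: ci_cts; rewrite continuous_open_subspace //; apply; rewrite inE; exists x.
have dcts : {for x, continuous d}.
  by move: d_cts; rewrite continuous_open_subspace //; apply; rewrite inE.
have Dd : (d @` (cdom d `&` set_val @^-1` cdom a)) (d x) by exists x.
have Dc : (c @` (cdom c `&` set_val @^-1` cdom a)) (c x) by exists x.
have phix : (d \o cinv c) (c x) = d x by rewrite /= cx.
apply: (@immersion_lift _ _ _ _ _ (a \o set_val \o cinv d) (a \o set_val \o cinv c)).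
- by apply: (@continuous_comp _ _ _ (cinv c) d); [exact: ci | rewrite cx; exact: dcts].
- by rewrite phix; exact: hd1.
- by rewrite phix; exact: hd2.
- exact: hc1.
have : nbhs (c x) (cinv c @^-1` cdom d).
  by apply: ci; rewrite cx; exact: open_nbhs_nbhs.
by apply: filterS => y /= hy; rewrite dK.
Qed.

End Fibers.

(** * Local lifts of the charts of a fiber *)

Section ScalarRules.
Context {R : realType}.
Local Notation K := (Cplx R).
Context {V : normedModType K} (x : V).

(** The rules of differentiation for scalar functions, with differentials in applied form: nested
    applications produce a closed formula for the differential of a polynomial expression. *)
Lemma sdD (f g df dg : V -> K) : is_diff x f df -> is_diff x g dg ->
  is_diff x (fun y => f y + g y) (fun v => df v + dg v).
Proof. exact: is_diffD. Qed.
Lemma sdB (f g df dg : V -> K) : is_diff x f df -> is_diff x g dg ->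
  is_diff x (fun y => f y - g y) (fun v => df v - dg v).
Proof. exact: is_diffB. Qed.
Lemma sdM (f g df dg : V -> K) : is_diff x f df -> is_diff x g dg ->
  is_diff x (fun y => f y * g y) (fun v => f x * dg v + g x * df v).
Proof. exact: is_diffM. Qed.
Lemma sdC (c : K) : is_diff x (fun _ : V => c) (fun _ => 0).
Proof. exact: is_diff_cst. Qed.
Lemma sdE (f df : V -> K) v : is_diff x f df -> 'd f x v = df v.
Proof. by case=> _ ->. Qed.
End ScalarRules.

Lemma sd_co {R : realType} {n : nat} k (v : 'rV[Cplx R]_n.+1) : is_diff v (co ^~ k) (co ^~ k).
Proof. by constructor; [exact: diff_co | exact: diff_coE]. Qed.

Section LocalLifts.
Context {R : realType}.
Local Notation K := (Cplx R).
Local Notation iC := ('i%C : K).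
Local Notation V := 'rV[K]_5.
Local Notation W := 'rV[K]_4.
Variables (t : K).
Local Notation F := (fiber (@tot_proj R) t).
Local Notation atlas := (fiber_atlas (@tot_atlas R) (@tot_proj R) t 4).

(** A lift of the inverse of the chart [c] to the covering, with values close to [p]. *)
Definition fib_lift (c : chart K F 4) (p : V) (y : W) : V := tlift p (set_val (cinv c y)).

Definition in_lift (c : chart K F 4) (p : V) (z : W) : Prop :=
  (@tot_map R @` tball p) (set_val (cinv c z)).

Lemma tlift_dom p X : (@tot_map R @` tball p) X -> disc_dom (tlift p X) /\ tot_map (tlift p X) = X.
Proof. by move=> [z hz <-]; rewrite tlift_map //; split=> //; exact: qball_Y hz. Qed.

Lemma cimg_cdom (c : chart K F 4) z : is_chart c -> cimg c z -> cdom c (cinv c z) /\ c (cinv c z) = z.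
Proof. by move=> [_ _ cK _ _] [x xc <-]; rewrite cK. Qed.

Lemma in_lift_near c p z : atlas c -> cimg c z -> in_lift c p z ->
  \forall y \near z, cimg c y /\ in_lift c p y.
Proof.
move=> [cc _] hz hp; have [_ oi _ _ ci] := cc.
have cz : {for z, continuous (cinv c)}.
  by move: ci; rewrite continuous_open_subspace //; apply; rewrite inE.
have n1 : nbhs z (cimg c) by exact: open_nbhs_nbhs.
have n2 : nbhs z (cinv c @^-1` (set_val @^-1` (@tot_map R @` tball p))).
  have oU := @open_set_val _ (@tot_proj R @^-1` [set t]) _ (@open_tot_ball R p).
  exact: cz (open_nbhs_nbhs (conj oU hp)).
by apply: filterS2 n1 n2 => y.
Qed.

Lemma fib_lift_diff c p z : atlas c -> cimg c z -> in_lift c p z ->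
  [/\ differentiable (fib_lift c p) z, injective ('d (fib_lift c p) z) & co (fib_lift c p z) 4 = t].
Proof.
move=> [cc hc] hz hp.
have [xc cx] := cimg_cdom cc hz.
have Aa : tot_atlas (qchart disc_dom (@tot_map R) rad p) by exists p.
have [h1 h2] := hc _ Aa.
have Dz : (c @` (cdom c `&` set_val @^-1` cdom (qchart disc_dom (@tot_map R) rad p))) z.
  by exists (cinv c z).
split; [exact: h1 | exact: h2 |].
have [Yl El] := tlift_dom hp.
by rewrite /fib_lift -(tot_projE Yl) El; exact: set_valA (cinv c z).
Qed.

(** This is why an object on the covering that is invariant under deck transformations can be
    pulled back along local lifts. *)
Lemma fib_lift_change c p p' z : atlas c -> cimg c z -> in_lift c p z -> in_lift c p' z ->
  exists g, \forall y \near z, deck_act g (fib_lift c p y) = fib_lift c p' y.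
Proof.
move=> hc hz hp hp'.
have [df _ _] := fib_lift_diff hc hz hp.
have [Yl El] := tlift_dom hp.
have h : (@tot_map R @` tball p') (tot_map (fib_lift c p z)) by rewrite El.
have [g [_ hg]] := lift_act open_disc_dom (@deck_act_dom R) (@deck_act_diff R) (@tot_mapP R) (@deck_free R) Yl h.
exists g; have n1 : \forall y \near z, tlift p' (tot_map (fib_lift c p y)) = deck_act g (fib_lift c p y) :=
  differentiable_continuous df hg.
have n2 := in_lift_near hc hz hp.
apply: filterS2 n1 n2 => y /= h1 [_ /tlift_dom[_ h2]].
by rewrite -h1 /fib_lift h2.
Qed.

Definition lift_pt (x : F) : V := get [set z | disc_dom z /\ tot_map z = set_val x].

Lemma lift_ptP c z : in_lift c (lift_pt (cinv c z)) z.
Proof.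
have ex : exists z', [set z' | disc_dom z' /\ tot_map z' = set_val (cinv c z)] z'.
  by have [u Yu hu] := tot_map_surj (set_val (cinv c z)); exists u.
have [Yl hl] := getPex ex.
by exists (lift_pt (cinv c z)) => //; exact: qball_center Yl rad0.
Qed.

Lemma diff_co_comp {U : normedModType K} {n : nat} (f : U -> 'rV[K]_n.+1) (y v : U) k : differentiable f y ->
  differentiable (fun x => co (f x) k) y /\ 'd (fun x => co (f x) k) y v = co ('d f y v) k.
Proof.
move=> df; have dc := diff_co k (f y).
split; first exact: (differentiable_comp df dc).
apply: (etrans (congr1 (@^~ v) (diff_comp df dc))) => /=.
by rewrite diff_coE.
Qed.

Lemma fib_lift_diff4 c p z v : atlas c -> cimg c z -> in_lift c p z ->
  co ('d (fib_lift c p) z v) 4 = 0.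
Proof.
move=> hc hz hp; have [df _ _] := fib_lift_diff hc hz hp.
rewrite -(diff_co_comp v 4 df).2.
have E : \forall y \near z, cst t y = co (fib_lift c p y) 4.
  by apply: filterS (in_lift_near hc hz hp) => y [h1 h2]; have [_ _ ->] := fib_lift_diff hc h1 h2.
have [_ e] := near_eq_diff E (differentiable_cst t z).
apply: (etrans (congr1 (@^~ v) e)).
exact: (congr1 (@^~ v) (diff_cst _ _)).
Qed.

Lemma diff_deck_act g (u v : V) :
  [/\ co ('d (deck_act g) u v) 0 = co v 0, co ('d (deck_act g) u v) 1 = co v 1,
      co ('d (deck_act g) u v) 2 = co v 2 + itr (db1 g) * co v 0 + iC * (itr (db2 g) * co v 1) &
      co v 4 = 0 -> co ('d (deck_act g) u v) 3 = co v 3 + co u 4 * (itr (db2 g) * co v 1)].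
Proof.
have D := deck_act_diff g u.
have A k f df : (fun y => co (deck_act g y) k) = f -> is_diff u f df -> co ('d (deck_act g) u v) k = df v.
  by move=> E h; rewrite -(diff_co_comp v k D).2 E; exact: sdE h.
have d1 : is_diff u (fib1 g) _ := sdD (sdD (sdM (sdC u (itr (db1 g))) (sd_co 0 u)) (sdC u _)) (sdC u _).
have d2 : is_diff u (fib2 g) _ := sdD (sdD (sdM (sdC u (itr (db2 g))) (sd_co 1 u)) (sdC u _)) (sdC u _).
split.
- rewrite (A 0%N _ _ (funext (fun y => act0 g y)) (sdD (sdD (sd_co 0 u) (sdC u _)) (sdC u _))); ring.
- rewrite (A 1%N _ _ (funext (fun y => act1 g y)) (sdD (sdD (sd_co 1 u) (sdC u _)) (sdC u _))); ring.
- rewrite (A 2%N _ _ (funext (fun y => act2 g y)) (sdD (sdD (sd_co 2 u) d1) (sdM (sdC u _) d2))); ring.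
- move=> v4; rewrite (A 3%N _ _ (funext (fun y => act3 g y))
    (sdD (sdD (sdD (sd_co 3 u) (sdM (sd_co 4 u) d2)) (sdC u _)) (sdC u _))) v4; ring.
Qed.

End LocalLifts.

(** * The symplectic form *)

Section SymplecticForm.
Context {R : realType}.
Local Notation K := (Cplx R).
Local Notation iC := ('i%C : K).
Local Notation V := 'rV[K]_5.
Local Notation W := 'rV[K]_4.
Variables (t : K) (t1 : mag t < 1) (t0 : t != 0).
Local Notation F := (fiber (@tot_proj R) t).
Local Notation atlas := (fiber_atlas (@tot_atlas R) (@tot_proj R) t 4).

Definition wedge (p q : nat) (u v : V) : K := co u p * co v q - co u q * co v p.

(** [dz0 /\ dz2 - (i / t) dz0 /\ dz3 + (1 / t) dz1 /\ dz3]: in the basis [(1, 0)], [(i, t)] of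
    the plane of [(z2, z3)] the coordinates are [s1 = z2 - (i / t) z3] and [s2 = z3 / t], and this is
    [dz0 /\ ds1 + dz1 /\ ds2]. Up to constants, deck transformations add multiples of [z0] to [s1]
    and of [z1] to [s2], which leaves it invariant. *)
Definition sform (u v : V) : K := wedge 0 2 u v - iC / t * wedge 0 3 u v + t^-1 * wedge 1 3 u v.

Lemma sform_deck g (p u v : V) : co p 4 = t -> co u 4 = 0 -> co v 4 = 0 ->
  sform ('d (deck_act g) p u) ('d (deck_act g) p v) = sform u v.
Proof.
move=> p4 u4 v4; have [a0 a1 a2 a3] := diff_deck_act g p u; have [b0 b1 b2 b3] := diff_deck_act g p v.
by rewrite /sform /wedge a0 a1 a2 (a3 u4) b0 b1 b2 (b3 v4) p4; field.
Qed.

Lemma sform_linl (u u' v : V) a : sform (a *: u + u') v = a * sform u v + sform u' v.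
Proof. by rewrite /sform /wedge !coD !coZ; ring. Qed.
Lemma sformN u v : sform v u = - sform u v.
Proof. by rewrite /sform /wedge; ring. Qed.

Definition pull_form (f : W -> V) (z : W) : 'M[K]_4 :=
  \matrix_(i, j) sform ('d f z (delta_mx 0 i)) ('d f z (delta_mx 0 j)).

(** The lift is chosen at each point separately; [sympl_lift] allows any other lift, hence a single
    one near a given point. *)
Definition sympl (c : chart K F 4) (z : W) : 'M[K]_4 :=
  pull_form (fib_lift c (lift_pt (cinv c z))) z.

Lemma sform_suml (I : Type) (r : seq I) (a : I -> K) (x : I -> V) v :
  sform (\sum_(i <- r) a i *: x i) v = \sum_(i <- r) a i * sform (x i) v.
Proof.
elim: r => [|i r IH]; last by rewrite !big_cons sform_linl IH.
by rewrite !big_nil /sform /wedge /co !mxE; ring.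
Qed.

Lemma pull_formE (f : W -> V) (z u v : W) :
  (u *m pull_form f z *m v^T) 0 0 = sform ('d f z u) ('d f z v).
Proof.
have L (w : W) : 'd f z w = \sum_i w 0 i *: 'd f z (delta_mx 0 i).
  by rewrite {1}(row_sum_delta w) linear_sum; apply: eq_bigr => i _; rewrite linearZ.
rewrite (L u) sform_suml mxE.
transitivity (\sum_i \sum_j u 0 i * pull_form f z i j * v 0 j); last first.
  apply: eq_bigr => i _; rewrite sformN (L v) sform_suml -sumrN mulr_sumr.
  by apply: eq_bigr => j _; rewrite mxE (sformN ('d f z (delta_mx 0 i))); ring.
rewrite (eq_bigr (fun j => \sum_i u 0 i * pull_form f z i j * v 0 j)); last first.
  by move=> j _; rewrite !mxE mulr_suml.
by rewrite exchange_big.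
Qed.

Lemma sympl_lift c p z : atlas c -> cimg c z -> in_lift c p z ->
  sympl c z = pull_form (fib_lift c p) z.
Proof.
move=> hc hz hp; have hp0 := lift_ptP c z.
have [g hg] := fib_lift_change hc hz hp0 hp.
have [df _ f4] := fib_lift_diff hc hz hp0.
have dg := deck_act_diff g (fib_lift c (lift_pt (cinv c z)) z).
have [_ e] := near_eq_diff hg (differentiable_comp df dg).
have E v : 'd (fib_lift c p) z v =
    'd (deck_act g) (fib_lift c (lift_pt (cinv c z)) z) ('d (fib_lift c (lift_pt (cinv c z))) z v).
  exact: (etrans (congr1 (@^~ v) e) (congr1 (@^~ v) (diff_comp df dg))).
apply/matrixP => i j; rewrite [LHS]mxE [RHS]mxE.
have v4 v := fib_lift_diff4 v hc hz hp0.
exact: (etrans (esym (sform_deck g f4 (v4 _) (v4 _))) (congr2 sform (esym (E _)) (esym (E _)))).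
Qed.

Lemma sympl_near c z : atlas c -> cimg c z -> exists2 p, in_lift c p z &
  \forall y \near z, [/\ cimg c y, in_lift c p y & sympl c y = pull_form (fib_lift c p) y].
Proof.
move=> hc hz; exists (lift_pt (cinv c z)); first exact: lift_ptP.
apply: filterS (in_lift_near hc hz (lift_ptP c z)) => y [h1 h2].
by split; [exact: h1 | exact: h2 | exact: (sympl_lift hc h1 h2)].
Qed.

Lemma sympl_antisym c z : (sympl c z)^T = - sympl c z.
Proof. by apply/matrixP => i j; rewrite !mxE; exact: sformN. Qed.

Lemma sympl_change c d x : atlas c -> atlas d -> cdom c x -> cdom d x ->
  let J := jacobian (d \o cinv c) (c x) in
  sympl c (c x) = J *m sympl d (d x) *m J^T.
Proof.
move=> hc hd xc xd J; have [cc _] := hc; have [cd _] := hd.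
have [_ _ _ _ trans] := fiber_manifold t1.
have [_ _ cK _ _] := cc; have [_ _ dK _ _] := cd.
have cx : cinv c (c x) = x := cK x xc; have dx : cinv d (d x) = x := dK x xd.
have ic : cimg c (c x) by exists x.
have id_ : cimg d (d x) by exists x.
have dphi : differentiable (d \o cinv c) (c x) by apply: (trans c d hc hd); exists x.
have phix : (d \o cinv c) (c x) = d x by rewrite /= cx.
pose p := lift_pt x.
have pc : in_lift c p (c x) by rewrite /p -{1}cx; exact: lift_ptP.
have pd : in_lift d p (d x) by rewrite /p -{1}dx; exact: lift_ptP.
have [dfd _ _] := fib_lift_diff hd id_ pd.
have dfd' : differentiable (fib_lift d p) ((d \o cinv c) (c x)) by rewrite phix.
have E : \forall y \near c x, (fib_lift d p \o (d \o cinv c)) y = fib_lift c p y.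
  have : nbhs (c x) (cinv c @^-1` cdom d).
    have [_ oi _ _ ci] := cc; have [od _ _ _ _] := cd.
    have cz : {for c x, continuous (cinv c)}.
      by move: ci; rewrite continuous_open_subspace //; apply; rewrite inE.
    have xd' : cdom d (cinv c (c x)) by rewrite cx.
    exact: cz (open_nbhs_nbhs (conj od xd')).
  by apply: filterS => y /= hy; rewrite /fib_lift dK.
have [_ e] := near_eq_diff E (differentiable_comp dphi dfd').
have Ed v : 'd (fib_lift c p) (c x) v = 'd (fib_lift d p) (d x) (v *m J).
  apply: (etrans (congr1 (@^~ v) e)); apply: (etrans (congr1 (@^~ v) (diff_comp dphi dfd'))).
  by rewrite /J /jacobian mul_rV_lin1 /= cx.
rewrite (sympl_lift hc ic pc) (sympl_lift hd id_ pd).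
apply/matrixP => i j; rewrite [LHS]mxE.
apply: (etrans (congr2 sform (Ed _) (Ed _))); rewrite -pull_formE.
move: (pull_form _ _) => M.
have mxij (A : 'M[K]_4) : A i j = ((delta_mx 0 i : 'rV[K]_4) *m A *m (delta_mx 0 j : 'rV[K]_4)^T) 0 0.
  by rewrite -rowE trmx_delta -colE !mxE.
by rewrite [RHS]mxij trmx_mul !mulmxA.
Qed.

Lemma sform_nondeg (U : V) : co U 4 = 0 -> (forall w : W, sform U (incl 0 w) = 0) -> U = 0.
Proof.
move=> U4 hU.
have h0 := hU (rowl [:: 1; 0; 0; 0]); have h1 := hU (rowl [:: 0; 1; 0; 0]).
have h2 := hU (rowl [:: 0; 0; 1; 0]); have h3 := hU (rowl [:: 0; 0; 0; 1]).
rewrite /sform /wedge !inclE // !co_rowl //= in h0 h1 h2 h3.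
have U0 : co U 0 = 0 by rewrite -h2; ring.
have U1 : co U 1 = 0.
  have : t^-1 * co U 1 = 0 by rewrite -h3 U0; ring.
  by move/eqP; rewrite mulf_eq0 invr_eq0 (negbTE t0) => /eqP.
have U3 : co U 3 = 0.
  have : t^-1 * co U 3 = 0 by rewrite -[RHS]oppr0 -h1; ring.
  by move/eqP; rewrite mulf_eq0 invr_eq0 (negbTE t0) => /eqP.
have U2 : co U 2 = 0 by rewrite -[RHS]oppr0 -h0 U3; ring.
by apply: co5P; rewrite ?U0 ?U1 ?U2 ?U3 ?U4 /co mxE.
Qed.

Lemma forget_lin a (x y : V) : forget (a *: x + y) = a *: forget x + forget y.
Proof. by apply: coP => k k4; rewrite coD coZ !forgetE // coD coZ. Qed.

(** The differential of a local lift is injective with values in the hyperplane of vectors whose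
    last coordinate is [0], so it maps onto that hyperplane, where the form is nondegenerate. *)
Lemma sympl_nondeg : nondegenerate_2form atlas sympl.
Proof.
move=> c z hc hz u hu.
have [p hp0 hp] := sympl_near hc hz.
have [_ hp1 E] := nbhs_singleton hp.
set f := fib_lift c p in E *.
have [df finj _] := fib_lift_diff hc hz hp0.
have f4 v : co ('d f z v) 4 = 0 by exact: fib_lift_diff4.
have surj (w : W) : exists v, forget ('d f z v) = w.
  pose L : W -> W := fun v => forget ('d f z v).
  have linL : linear L.
    by move=> a v v'; exact: (etrans (congr1 forget (linearP ('d f z) a v v')) (forget_lin _ _ _)).
  pose LL : {linear W -> W} := HB.pack L (GRing.isLinear.Build _ _ _ _ L linL).
  have injL : row_free (lin1_mx LL).
    apply/inj_row_free => v; rewrite mul_rV_lin1 => h; apply: finj.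
    apply: (etrans _ (esym (linear0 ('d f z)))).
    have h4 := f4 v; move: h h4; rewrite /= /L; move: ('d f z v) => x h h4.
    apply: coP => k; rewrite leq_eqVlt => /orP[/eqP ->|k4].
      by rewrite h4 /co mxE.
    by rewrite -(forgetE _ k4) h /co !mxE.
  rewrite row_free_unit in injL.
  exists (w *m invmx (lin1_mx LL)).
  by rewrite -[LHS](mul_rV_lin1 LL) mulmxKV.
have {}hu v : sform ('d f z u) ('d f z v) = 0.
  apply: (etrans (esym (pull_formE f z u v))); have := hu v; rewrite E => ->.
  by rewrite mxE.
apply: finj; apply: (etrans _ (esym (linear0 ('d f z)))).
have U4 := f4 u; set U := 'd f z u in hu U4 *.
have hU (w : W) : sform U (incl 0 w) = 0.
  have [v vw] := surj w.
  have i0 (X : V) : co X 4 = 0 -> incl 0 (forget X) = X by move=> <-; exact: incl_forget.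
  exact: (etrans (congr1 (sform U) (etrans (congr1 (incl 0) (esym vw)) (i0 _ (f4 v)))) (hu v)).
exact: sform_nondeg.
Qed.

Definition wedge_fn (A : nat -> 'I_4 -> W -> K) (p q : nat) (j k : 'I_4) (y : W) : K :=
  A p j y * A q k y - A p k y * A q j y.
Definition form_fn (A : nat -> 'I_4 -> W -> K) (j k : 'I_4) (y : W) : K :=
  wedge_fn A 0 2 j k y - iC / t * wedge_fn A 0 3 j k y + t^-1 * wedge_fn A 1 3 j k y.

Lemma form_fnE (A : nat -> 'I_4 -> W -> K) y j k (u v : V) :
  (forall m, A m j y = co u m) -> (forall m, A m k y = co v m) -> form_fn A j k y = sform u v.
Proof. by move=> hu hv; rewrite /form_fn /wedge_fn /sform /wedge !hu !hv; ring. Qed.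

(** The coefficients of the form are polynomials in the partial derivatives of a local lift;
    these are holomorphic and satisfy the symmetry of second derivatives. *)
Lemma sympl_coef c z : atlas c -> cimg c z -> exists A : nat -> 'I_4 -> W -> K,
  [/\ forall j k, \forall y \near z, form_fn A j k y = sympl c y j k,
      forall p l, differentiable (A p l) z &
      forall p l m, 'd (A p l) z (delta_mx 0 m) = 'd (A p m) z (delta_mx 0 l)].
Proof.
move=> hc hz; have [p hp0 hp] := sympl_near hc hz.
pose f := fib_lift c p.
pose fc k (y : W) : K := co (f y) k.
exists (fun k l y => 'd (fc k) y (delta_mx 0 l)).
have /nbhs_magP[d d0 hd] : \forall y \near z, forall k, differentiable (fc k) y.
  apply: filterS hp => y [h1 h2 _] k.
  have [df _ _] := fib_lift_diff hc h1 h2.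
  exact: (diff_co_comp 0 k df).1.
split.
- move=> j k; apply: filterS hp => y [h1 h2 E]; rewrite E mxE.
  have [df _ _] := fib_lift_diff hc h1 h2.
  have D m v : 'd (fc m) y v = co ('d f y v) m := (diff_co_comp v m df).2.
  exact: (@form_fnE (fun k l y => 'd (fc k) y (delta_mx 0 l)) y j k _ _
    (fun m => D m (delta_mx 0 j)) (fun m => D m (delta_mx 0 k))).
- by move=> k l; exact: (diff_of_partial (delta_mx 0 l) d0 (fun y hy => hd y hy k)).1.
- by move=> k l m; exact: (diff_partial_sym (delta_mx 0 m) (delta_mx 0 l) d0 (fun y hy => hd y hy k)).
Qed.

Lemma sd_wedge (A : nat -> 'I_4 -> W -> K) z p q j k : (forall p l, differentiable (A p l) z) ->
  is_diff z (wedge_fn A p q j k) (fun v => (A p j z * 'd (A q k) z v + A q k z * 'd (A p j) z v)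
    - (A p k z * 'd (A q j) z v + A q j z * 'd (A p k) z v)).
Proof.
move=> dA; have D p0 l := differentiableP (dA p0 l).
exact: sdB (sdM (D p j) (D q k)) (sdM (D p k) (D q j)).
Qed.

Lemma sd_form (A : nat -> 'I_4 -> W -> K) z j k : (forall p l, differentiable (A p l) z) ->
  exists2 D : W -> K, is_diff z (form_fn A j k) D &
  forall v, D v = let w p q := (A p j z * 'd (A q k) z v + A q k z * 'd (A p j) z v)
    - (A p k z * 'd (A q j) z v + A q j z * 'd (A p k) z v) in
    w 0 2 - iC / t * w 0 3 + t^-1 * w 1 3.
Proof.
move=> dA; have D p q := sd_wedge p q j k dA.
refine (ex_intro2 _ _ _ (sdD (sdB (D 0%N 2%N) (sdM (sdC z (iC / t)) (D 0%N 3%N))) (sdM (sdC z t^-1) (D 1%N 3%N))) _).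
have drop0 (a b e c d x y : K) : a - (c * b + x * 0) + (d * e + y * 0) = a - c * b + d * e.
  by rewrite !mulr0 !addr0.
by move=> v; exact: drop0.
Qed.

Lemma sympl_holomorphic c : atlas c -> forall i j, holomorphic (cimg c) (fun z => sympl c z i j).
Proof.
move=> hc i j z hz; have [A [hA dA _]] := sympl_coef hc hz.
have [D hD _] := sd_form i j dA.
by apply: (near_eq_diff (hA i j) _).1; case: hD.
Qed.

Lemma wedge_cyclic (A : nat -> 'I_4 -> K) (H : nat -> 'I_4 -> 'I_4 -> K) (p q : nat) (i j k : 'I_4) :
  (forall p l m, H p l m = H p m l) ->
  let w i j k := (A p j * H q k i + A q k * H p j i) - (A p k * H q j i + A q j * H p k i) in
  w i j k + w j k i + w k i j = 0.
Proof.
move=> S w; rewrite /w (S p j i) (S p k i) (S p k j) (S q j i) (S q k i) (S q k j); ring.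
Qed.

(** By the symmetry of second derivatives, the cyclic sums of the derivatives of each of the three
    products in the form cancel. *)
Lemma sympl_closed : closed_2form atlas sympl.
Proof.
move=> c z hc hz i j k partial; have [A [hA dA S]] := sympl_coef hc hz.
pose a p l := A p l z; pose H p l m := 'd (A p l) z (delta_mx 0 m).
pose w p q i j k := (a p j * H q k i + a q k * H p j i) - (a p k * H q j i + a q j * H p k i).
have P i' j' k' : partial i' (fun y => sympl c y j' k') =
    w 0 2 i' j' k' - iC / t * w 0 3 i' j' k' + t^-1 * w 1 3 i' j' k'.
  have [D [dD eD] hD] := sd_form j' k' dA.
  have [d1 d2] := near_eq_diff (hA j' k') dD.
  apply: (etrans (deriveE (delta_mx 0 i') d1)).
  apply: (etrans (congr1 (@^~ (delta_mx 0 i')) d2)).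
  apply: (etrans (congr1 (@^~ (delta_mx 0 i')) eD)); exact: hD.
rewrite !P.
have C p q : w p q i j k + w p q j k i + w p q k i j = 0 by exact: wedge_cyclic S.
clearbody w; transitivity ((w 0 2 i j k + w 0 2 j k i + w 0 2 k i j)
  - iC / t * (w 0 3 i j k + w 0 3 j k i + w 0 3 k i j)
  + t^-1 * (w 1 3 i j k + w 1 3 j k i + w 1 3 k i j)); first by ring.
by rewrite !C !mulr0 subr0 addr0.
Qed.

Lemma fiber_symplectic : admits_complex_symplectic_form atlas.
Proof.
exists sympl; split; [split | exact: sympl_closed | exact: sympl_nondeg].
- by move=> c z _ _; exact: sympl_antisym.
- exact: sympl_holomorphic.
- exact: sympl_change.
Qed.

End SymplecticForm.

(** * Quasi-periodic entire functions *)

Section QuasiPeriodic.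
Context {R : realType}.
Local Notation K := (Cplx R).
Local Notation iC := ('i%C : K).

Lemma bounded_on_ball {n : nat} (f : 'rV[K]_n -> K) (r : R) :
  (forall w, differentiable f w) -> exists2 M : R, 0 <= M & forall w, mag w <= r -> mag (f w) <= M.
Proof.
move=> df; apply: contrapT => H.
have ex (j : nat) : exists u : 'rV[K]_n, mag u <= r /\ j%:R < mag (f u).
  apply: contrapT => Hj; apply: H; exists j%:R; first exact: ler0n.
  by move=> w hw; rewrite leNgt; apply/negP => hlt; apply: Hj; exists w.
have [u hu] := choice ex.
have [l hl] := bounded_cluster (fun j => (hu j).1).
have /cts_magP cf := differentiable_continuous (df l).
have [d d0 hd] := cf 1 ltr01.
have M0 : 0 <= mag (f l) + 1 by rewrite addr_ge0 ?mag_ge0.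
have [j hj1 hj2] := hl d (Num.bound (mag (f l) + 1)) d0.
have h1 := hd _ hj2; have [_ h2] := hu j.
have h3 := mag_sub (f (u j)) (f l).
have h4 : mag (f l) + 1 < j%:R.
  by apply: lt_le_trans (archi_boundP M0) _; rewrite ler_nat.
by lra.
Qed.

Lemma bounded_on_disc (f : K -> K) (r : R) :
  (forall w, differentiable f w) -> exists2 M : R, 0 <= M & forall w, mag w <= r -> mag (f w) <= M.
Proof.
move=> df.
have D (v : 'rV[K]_1) : differentiable (fun v : 'rV[K]_1 => f (co v 0)) v.
  exact: (differentiable_comp (diff_co 0 v) (df _)).
have [M M0 hM] := bounded_on_ball r D; exists M => // w hw.
have := hM (rowl [:: w] : 'rV[K]_1); rewrite co_rowl // => h; apply: h.
apply: mag_rV_le; first exact: le_trans (mag_ge0 w) hw.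
by move=> i; rewrite mxE ord1.
Qed.

Lemma doubly_periodic_const (f : K -> K) : (forall s, differentiable f s) ->
  (forall s (m n : int), f (s + itr m + iC * itr n) = f s) -> forall s, f s = f 0.
Proof.
move=> df per; have [M M0 hM] := bounded_on_disc 3 df.
apply: (entire_bounded (A := M)) => // s.
have [m [n h]] := @gauss_approx R s 1 ltr01 (ler1n _ _ : 1 <= 2%:R).
by rewrite rc1 mul1r in h; rewrite -(per s m n); exact: hM.
Qed.

(** An additive period in the direction [2i] of an entire function with the ordinary period [1]
    vanishes: the function has at most linear growth, hence is affine, hence constant. *)
Lemma quasi_periodic_zero (f : K -> K) (k : K) : (forall s, differentiable f s) ->
  (forall s (m n : int), f s = f (s + itr m + 2 * iC * itr n) + itr n * k) -> k = 0.
Proof.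
move=> df per; have [M M0 hM] := bounded_on_disc 3 df.
have growth s : mag (f s) <= (M + 3 * mag k) + mag k * mag s.
  have [m [n h]] := @gauss_approx R s 2 (ltr0Sn _ 1) (lexx _).
  rewrite rc_nat in h; rewrite (per s m n); apply: le_trans (magD _ _) _.
  have h1 := hM _ h; rewrite magM.
  have hn : mag (itr n : K) <= 3 + mag s.
    have e : itr m + 2 * iC * itr n = rc m%:~R + iC * rc (2 * n%:~R) :> K.
      by rewrite !itr_rc rcM rc_nat; ring.
    have := mag_Im (itr m + 2 * iC * itr n : K); rewrite e Im_cplx -e normrM ger0_norm // => h2.
    have := magB (s + itr m + 2 * iC * itr n) s.
    rewrite (_ : s + itr m + 2 * iC * itr n - s = itr m + 2 * iC * itr n); last by ring.
    have E : mag (itr n : K) = `|n%:~R : R| by rewrite itr_rc mag_rc.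
    by have := normr_ge0 (n%:~R : R); rewrite E; lra.
  have : mag (itr n : K) * mag k <= (3 + mag s) * mag k by rewrite ler_wpM2r ?mag_ge0.
  lra.
have A0 : 0 <= M + 3 * mag k by rewrite addr_ge0 // mulr_ge0 ?mag_ge0.
have aff := entire_affine A0 (mag_ge0 k) df growth.
have lin s : f s = f 0 + s * 'd f 0 1 by rewrite {1}aff (diff_scalar f 0 s).
have e1 := per 0 1 0; have e2 := per 0 0 1.
rewrite (lin (_ + _)) in e1; rewrite (lin (_ + _)) in e2.
move: e1 e2; move: ('d f 0 1) (f 0) => a b e1 e2.
have a0 : a = 0.
  have : b + a = b by rewrite [RHS]e1 /itr; ring.
  by move=> h; apply: (addrI b); rewrite h addr0.
apply: (addrI b); rewrite addr0 [RHS]e2 a0 /itr; ring.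
Qed.

End QuasiPeriodic.

(** * The central fiber *)

Section CentralFiber.
Context {R : realType}.
Local Notation K := (Cplx R).
Local Notation iC := ('i%C : K).
Local Notation W := 'rV[K]_4.

Lemma zero_disc : mag (0 : K) < 1. Proof. by rewrite mag0 ltr01. Qed.
Local Notation fm := (fib_map zero_disc).
Implicit Types (w v : W) (g : deck).

Definition act_fib (g : deck) (w : W) : W := forget (deck_act g (incl 0 w)).

Lemma incl_act_fib g w : incl 0 (act_fib g w) = deck_act g (incl 0 w).
Proof. by rewrite /act_fib -{2}(incl_forget (deck_act g (incl 0 w))) act4 incl4. Qed.

Lemma co_act_fib g w k : (k < 4)%N -> co (act_fib g w) k = co (deck_act g (incl 0 w)) k.
Proof. exact: forgetE. Qed.

Lemma fm_act g w : fm (act_fib g w) = fm w.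
Proof.
apply: val_inj; rewrite -!set_valE !fib_mapE incl_act_fib; apply/esym.
apply/tot_mapP; [exact: (incl_dom zero_disc) | exact/deck_act_dom/(incl_dom zero_disc) | by exists g].
Qed.

Lemma diff_act_fib g w : differentiable (act_fib g) w.
Proof.
have d1 : differentiable (deck_act g \o incl 0) w.
  exact: differentiable_comp (diff_incl 0 w) (deck_act_diff g _).
exact: (differentiable_comp d1 (diff_forget _)).
Qed.

Lemma co_diff_incl w v k : (k < 4)%N -> co ('d (incl (0 : K)) w v) k = co v k.
Proof.
move=> k4; rewrite -(diff_co_comp v k (diff_incl 0 w)).2.
rewrite (_ : (fun x : W => co (incl (0 : K) x) k) = (fun x : W => @co R 3 x k)); first by rewrite diff_coE.
by apply/funext => x; rewrite inclE.
Qed.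

Lemma co_diff_incl4 w v : co ('d (incl (0 : K)) w v) 4 = 0.
Proof.
rewrite -(diff_co_comp v 4 (diff_incl 0 w)).2.
rewrite (_ : (fun x : W => co (incl (0 : K) x) 4) = cst (0 : K)); first by rewrite diff_cst.
by apply/funext => x; rewrite incl4.
Qed.

Lemma diff_act_fibE g w v : 'd (act_fib g) w v =
  rowl [:: co v 0; co v 1; co v 2 + itr (db1 g) * co v 0 + iC * (itr (db2 g) * co v 1); co v 3].
Proof.
have [a0 a1 a2 a3] := diff_deck_act g (incl 0 w) ('d (incl (0 : K)) w v).
have {a3}a3 := a3 (co_diff_incl4 w v).
rewrite !co_diff_incl // incl4 mul0r addr0 in a0 a1 a2 a3.
have d1 : differentiable (deck_act g \o incl 0) w.
  exact: differentiable_comp (diff_incl 0 w) (deck_act_diff g _).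
have E k : (k < 4)%N -> co ('d (act_fib g) w v) k = co ('d (deck_act g) (incl 0 w) ('d (incl (0 : K)) w v)) k.
  move=> k4; rewrite -(diff_co_comp v k (diff_act_fib g w)).2.
  rewrite (_ : (fun x => co (act_fib g x) k) = (fun x => co ((deck_act g \o incl 0) x) k)); last first.
    by apply/funext => x; rewrite co_act_fib.
  rewrite (diff_co_comp v k d1).2; congr (co _ k).
  exact: (congr1 (@^~ v) (diff_comp (diff_incl 0 w) (deck_act_diff g _))).
by apply: coP => -[|[|[|[|k]]]] // _; rewrite E // co_rowl.
Qed.

Lemma act_fib_bounded w : exists g, mag (act_fib g w) <= 3.
Proof.
have [g hg] := deck_reduce (incl 0 w); exists g; apply: mag_rV_le => // i.
by have := hg i (ltn_ord i); rewrite -co_act_fib // /co inord_val.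
Qed.

(** Every point is equivalent to one of a fixed ball, so the function is bounded. *)
Lemma act_fib_inv_const (f : W -> K) : (forall w, differentiable f w) ->
  (forall g w, f w = f (act_fib g w)) -> forall w, f w = f 0.
Proof.
move=> df inv; have [M M0 hM] := bounded_on_ball 3 df.
apply: (entire_bounded df (A := M)) => w.
by have [g hg] := act_fib_bounded w; rewrite (inv g w); exact: hM.
Qed.

Definition axis (k : nat) (s : K) : W := s *: delta_mx 0 (inord k).

Lemma co_axis k s l : (k < 4)%N -> (l < 4)%N -> co (axis k s) l = if l == k then s else 0.
Proof.
move=> k4 l4; rewrite /co !mxE eqxx /= -val_eqE /= !inordK //.
by case: eqP => _; rewrite ?mulr1 ?mulr0.
Qed.

Lemma diff_axis (f : W -> K) (w : W) k s : (forall w, differentiable f w) ->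
  differentiable (fun s => f (w + axis k s)) s.
Proof. move=> df; exact: (differentiable_comp (diff_line w (delta_mx 0 (inord k)) s).1 (df _)). Qed.

(** The translations of the fiber make [f] doubly periodic, hence constant, in [z2]. Along the base
    direction [d], deck transformations move only [z_d] and [z2], so they act on [f] as
    translations of [z_d], and [quasi_periodic_zero] applies. *)
Lemma quasi_invariant_zero (f : W -> K) (d : nat) (k : K) : (d < 2)%N ->
  (forall w, differentiable f w) ->
  (forall g w, (d == 0%N -> db2 g = 0) -> (d == 1%N -> db1 g = 0) ->
     f w = f (act_fib g w) + itr (if d == 0%N then db1 g else db2 g) * k) -> k = 0.
Proof.
move=> d2 df per.
have indep w s : f (w + axis 2 s) = f w.
  have := @doubly_periodic_const R (fun s => f (w + axis 2 s)) (fun s => diff_axis w 2 s df).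
  move=> h; rewrite h.
    by rewrite /axis scale0r addr0.
  move=> s' m n; pose g := Deck 0 0 0 0 m n 0 0.
  rewrite [RHS](per g) // (_ : (if _ then _ else _) = 0); last by case: ifP.
  rewrite itr0 mul0r addr0; congr f.
  apply: coP => l l4; rewrite co_act_fib //; case: l l4 => [|[|[|[|l]]]] // _;
    rewrite actE /fib1 /fib2 ?incl4 ?inclE // ?coD ?co_axis //= ?itr0 /co ?mxE; ring.
apply: (@quasi_periodic_zero R (fun s => f (0 + axis d s)) k (fun s => diff_axis 0 d s df)).
move=> s m n; case: d d2 per => [|[|//]] _ per.
- pose g := Deck m n 0 0 0 0 0 0; rewrite (per g) //=; congr (_ + _).
  rewrite -[RHS](indep _ (itr n * s + iC * itr n ^+ 2)); congr f.
  apply: coP => l l4; rewrite co_act_fib //; case: l l4 => [|[|[|[|l]]]] // _;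
    rewrite actE /fib1 /fib2 ?incl4 ?inclE // ?coD ?co_axis //= ?itr0 /co ?mxE; ring.
- pose g := Deck 0 0 m n 0 0 0 0; rewrite (per g) //=; congr (_ + _).
  rewrite -[RHS](indep _ (iC * (itr n * s + iC * itr n ^+ 2))); congr f.
  apply: coP => l l4; rewrite co_act_fib //; case: l l4 => [|[|[|[|l]]]] // _;
    rewrite actE /fib1 /fib2 ?incl4 ?inclE // ?coD ?co_axis //= ?itr0 /co ?mxE; ring.
Qed.

End CentralFiber.

(** * Two-forms on the central fiber *)

Lemma bilinear_shear {A : comNzRingType} {n : nat} (N : 'M[A]_n) (u v w : 'rV[A]_n) (a b : A) :
  ((u + a *: w) *m N *m (v + b *: w)^T) 0 0 =
  (u *m N *m v^T) 0 0 + a * (w *m N *m v^T) 0 0 + b * (u *m N *m w^T) 0 0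
    + a * b * (w *m N *m w^T) 0 0.
Proof.
rewrite linearD linearZ /= !mulmxDl !mulmxDr -!scalemxAl -!scalemxAr.
move: (u *m _ *m v^T) (w *m _ *m v^T) (u *m _ *m w^T) (w *m _ *m w^T) => x y z t.
by rewrite !mxE; ring.
Qed.

Section CentralForms.
Context {R : realType}.
Local Notation K := (Cplx R).
Local Notation iC := ('i%C : K).
Local Notation W := 'rV[K]_4.
Local Notation F0 := (fiber (@tot_proj R) 0).
Local Notation atlas := (fiber_atlas (@tot_atlas R) (@tot_proj R) 0 4).

Local Notation fm := (fib_map zero_disc).
Local Notation fch := (fib_chart zero_disc).

Variable omega : chart K F0 4 -> W -> 'M[K]_4.
Hypothesis omegaP : holomorphic_2form atlas omega.

Local Notation o0 := (inord 0 : 'I_4).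
Local Notation o1 := (inord 1 : 'I_4).
Local Notation o2 := (inord 2 : 'I_4).
Local Notation o3 := (inord 3 : 'I_4).

Definition shear (g : deck) (i : 'I_4) : K :=
  if i == 0 :> nat then itr (db1 g) else if i == 1 :> nat then iC * itr (db2 g) else 0.

Lemma diff_act_fib_delta (g : deck) (w : W) (i : 'I_4) :
  'd (act_fib g) w (delta_mx 0 i) = delta_mx 0 i + shear g i *: delta_mx 0 o2.
Proof.
have cd (j : 'I_4) k : (k < 4)%N -> co (delta_mx 0 j : W) k = (k == j :> nat)%:R.
  by move=> k4; rewrite /co mxE eqxx -val_eqE /= inordK.
rewrite diff_act_fibE; apply: coP => k k3.
rewrite coD coZ co_rowl // !cd // inordK // /shear.
case: i => -[|[|[|[|]]]] // ? /=; case: k k3 => [|[|[|[|]]]] // _ /=; ring.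
Qed.

Lemma fib_chart_center (w : W) : mag (w - w) < rad :> R.
Proof. by rewrite subrr mag0 rad0. Qed.

(** Read in the charts at [w] and [w0], the identity of the fiber is [act_fib g], whose Jacobian is
    the shear of [diff_act_fib_delta]. *)
Lemma form_transition (w0 : W) (g : deck) (w : W) : mag (act_fib g w - w0) < rad ->
  let N := omega (fch w0) (act_fib g w) in forall i j,
  omega (fch w) w i j =
    N i j + shear g i * N o2 j + shear g j * N i o2 + shear g i * shear g j * N o2 o2.
Proof.
move=> hg N i j; have [_ _ tr] := omegaP.
have hw := fib_chart_center w.
have xc : cdom (fch w) (fm w) := fib_chart_dom_map zero_disc hw.
have xE : fm w = fm (act_fib g w) := esym (fm_act g w).
have xd : cdom (fch w0) (fm w) by rewrite xE; exact: (fib_chart_dom_map zero_disc hg).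
have cx : fch w (fm w) = w := fib_chart_map zero_disc hw.
have dx : fch w0 (fm w) = act_fib g w by rewrite xE; exact: (fib_chart_map zero_disc hg).
have := tr _ _ _ (fib_chart_atlas zero_disc w) (fib_chart_atlas zero_disc w0) xc xd.
rewrite cx dx; set f := (_ \o _); set J := jacobian f w => ->.
have E : \forall y \near w, act_fib g y = f y.
  have /cts_magP c := differentiable_continuous (diff_act_fib g w).
  have e0 : 0 < rad - mag (act_fib g w - w0) by lra.
  have [d d0 hd] := c _ e0; apply/nbhs_magP; exists d => // y /hd h.
  rewrite /f /comp -(_ : fm (act_fib g y) = cinv (fch w) y); last exact: fm_act.
  apply/esym/(fib_chart_map zero_disc).
  by have := mag_tri (act_fib g w) (act_fib g y) w0; lra.
have [_ dE] := near_eq_diff E (diff_act_fib g w).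
have JE k : (delta_mx 0 k : W) *m J = delta_mx 0 k + shear g k *: delta_mx 0 o2.
  apply: (etrans (mul_rV_lin1 ('d f w) _)); apply: (etrans (congr1 (@^~ (delta_mx 0 k)) dE)).
  exact: diff_act_fib_delta.
have mxij (A : 'M[K]_4) k l : A k l = ((delta_mx 0 k : W) *m A *m (delta_mx 0 l : W)^T) 0 0.
  by rewrite -rowE trmx_delta -colE !mxE.
rewrite [LHS]mxij -!mulmxA -trmx_mul JE 2!mulmxA JE -/N.
rewrite (mxij N i j) (mxij N o2 j) (mxij N i o2) (mxij N o2 o2).
exact: bilinear_shear.
Qed.

(** The coefficients of [omega] on the covering, where the slice charts are local inverses of the
    covering map. *)
Definition coef (i j : nat) (w : W) : K := omega (fch w) w (inord i) (inord j).

Lemma coef_local (w0 w : W) i j : mag (w - w0) < rad ->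
  coef i j w = omega (fch w0) w (inord i) (inord j).
Proof.
have idE : act_fib deck_id w = w by rewrite /act_fib deck_act_id forget_incl.
have s0 k : shear deck_id k = 0.
  by rewrite /shear; case: ifP => _; [|case: ifP => _]; rewrite //= ?itr0 ?mulr0.
move=> h; have := @form_transition w0 deck_id w; rewrite idE => /(_ h (inord i) (inord j)).
by rewrite !s0 !mul0r !addr0.
Qed.

Lemma coef_diff i j (w : W) : differentiable (coef i j) w.
Proof.
have [_ hol _] := omegaP.
have E : \forall y \near w, omega (fch w) y (inord i) (inord j) = coef i j y.
  apply/nbhs_magP; exists rad; first exact: rad0.
  by move=> y hy; rewrite (coef_local _ _ hy).
refine (near_eq_diff E _).1; apply: hol; first exact: fib_chart_atlas.
by rewrite fib_chart_img; exact: fib_chart_center.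
Qed.

Lemma coefN i j (w : W) : coef j i w = - coef i j w.
Proof.
have [anti _ _] := omegaP.
have wi : cimg (fch w) w by rewrite fib_chart_img; exact: fib_chart_center.
have /matrixP/(_ (inord i) (inord j)) := anti _ _ (fib_chart_atlas zero_disc w) wi.
by rewrite !mxE.
Qed.

Lemma coef_diag i (w : W) : coef i i w = 0.
Proof.
have /eqP := coefN i i w; rewrite -addr_eq0 -mulr2n -mulr_natr mulf_eq0.
by rewrite pnatr_eq0 orbF => /eqP.
Qed.

Lemma coef_act (g : deck) (w : W) i j : coef i j w = coef i j (act_fib g w)
  + shear g (inord i) * coef 2 j (act_fib g w) + shear g (inord j) * coef i 2 (act_fib g w).
Proof.
rewrite /coef (form_transition (fib_chart_center (act_fib g w)) (inord i) (inord j)).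
have /= c22 := coef_diag 2 (act_fib g w); rewrite /coef in c22.
by rewrite c22 mulr0 addr0.
Qed.

Lemma shearE (g : deck) : [/\ shear g o0 = itr (db1 g), shear g o1 = iC * itr (db2 g),
  shear g o2 = 0 & shear g o3 = 0].
Proof. by rewrite /shear !inordK. Qed.

(** Invariance first makes the coefficients of [dz2 /\ dzj] constant for [j = 0, 1, 3]; then the
    coefficients of [dz0 /\ dz3] and [dz0 /\ dz1] are quasi-periodic with these constants
    as additive periods, up to units, so the constants vanish. *)
Lemma coef2_zero j (w : W) : (j < 4)%N -> coef 2 j w = 0.
Proof.
have c22 := coef_diag 2.
have inv (k : nat) : (k < 4)%N -> forall u, coef 2 k u = coef 2 k 0.
  move=> k4; apply: act_fib_inv_const; first exact: coef_diff.
  move=> g u; rewrite (coef_act g); have [_ _ -> _] := shearE g.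
  by rewrite c22 mul0r mulr0 !addr0.
have c23 : coef 2 3 0 = 0.
  apply: (@quasi_invariant_zero R (coef 0 3) 0 _ isT (coef_diff 0 3)) => g u _ _ /=.
  rewrite (coef_act g) -(inv 3 isT (act_fib g u)); have [-> _ _ ->] := shearE g.
  by rewrite mul0r addr0.
have c21 : coef 2 1 0 = 0.
  apply: (@quasi_invariant_zero R (coef 0 1) 0 _ isT (coef_diff 0 1)) => g u /(_ isT) b2 _ /=.
  rewrite (coef_act g) -(inv 1 isT (act_fib g u)); have [-> -> _ _] := shearE g.
  by rewrite b2 itr0 mulr0 mul0r addr0.
have c20 : coef 2 0 0 = 0.
  have : - iC * coef 2 0 0 = 0.
    apply: (@quasi_invariant_zero R (coef 0 1) 1 _ isT (coef_diff 0 1)) => g u _ /(_ isT) b1 /=.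
    rewrite (coef_act g) -(inv 0 isT (act_fib g u)); have [-> -> _ _] := shearE g.
    by rewrite b1 itr0 mul0r addr0 (coefN 2 0); ring.
  move/eqP; rewrite mulf_eq0 oppr_eq0 => /orP[|/eqP //].
  by move=> /eqP i0; have := @mag_i R; rewrite i0 mag0 => /eqP; rewrite eq_sym oner_eq0.
case: j => [|[|[|[|//]]]] _; rewrite ?c22 // inv //.
Qed.

Lemma central_form_degenerate : ~ nondegenerate_2form atlas omega.
Proof.
move=> nd; pose w := 0 : W.
have wi : cimg (fch w) w by rewrite fib_chart_img; exact: fib_chart_center.
have row0 : row o2 (omega (fch w) w) = 0.
  by apply/rowP => j; rewrite !mxE; have := coef2_zero w (ltn_ord j); rewrite /coef inord_val.
have : (delta_mx 0 o2 : W) = 0.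
  by apply: (nd _ _ (fib_chart_atlas zero_disc w) wi) => v; rewrite -rowE row0 mul0mx.
by move/matrixP/(_ 0 o2)/eqP; rewrite !mxE !eqxx oner_eq0.
Qed.

End CentralForms.

Lemma central_fiber_not_symplectic (R : realType) :
  ~ admits_complex_symplectic_form (fiber_atlas (@tot_atlas R) (@tot_proj R) 0 4).
Proof. by move=> [omega [omegaP _]]; exact: central_form_degenerate. Qed.

Theorem theorem5p1 (R : realType) :
  exists (X : topologicalType) (A : set (chart (Cplx R) X 5)) (proj : X -> Cplx R),
    [/\ holomorphic_family A proj,
        forall t : Cplx R, unit_disc t ->
          compact [set: fiber proj t] /\ complex_manifold (fiber_atlas A proj t 4),
        forall t : Cplx R, unit_disc t -> t != 0 ->
          admits_complex_symplectic_form (fiber_atlas A proj t 4) &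
        ~ admits_complex_symplectic_form (fiber_atlas A proj 0 4)].
Proof.
exists (@total_space R), (@tot_atlas R), (@tot_proj R); split.
- exact: tot_family.
- by move=> t /unit_discE t1; split; [exact: fiber_compact | exact: fiber_manifold].
- by move=> t /unit_discE t1 t0; exact: fiber_symplectic.
- exact: central_fiber_not_symplectic.
Qed.
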